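(* The following decision problem is NP-complete: given a bipartite graph $G=(S,T;E)$ with maximum degree $4$, decide whether $G$ has a $\mathtt{V}$-free $2$-matching that covers $T$.
   Context: All graphs are finite and simple. The input is a bipartite graph given together with its two colour classes $S$ and $T$. A $2$-matching in $G$ is a subset $N\subseteq E$ of edges such that every node is incident to at most $2$ edges of $N$; thus the connected components of the subgraph formed by $N$ are node-disjoint paths and cycles. A $\mathtt{V}$-path is a path of length $2$ (three nodes, two edges) in $G$ whose two end-nodes are in $T$ (so its middle node is in $S$). A $2$-matching $N$ is $\mathtt{V}$-free if no connected component of the subgraph formed by $N$ is a $\mathtt{V}$-path. A set $N$ of edges covers $T$ if every node of $T$ is incident to at least one edge of $N$. *)

(* Defs.v *)
From mathcomp Require Import all_boot.

Set Implicit Arguments.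
Unset Strict Implicit.
Unset Printing Implicit Defensive.

Inductive move := MoveLeft | Stay | MoveRight.

Record machine := Machine {
  tapes : nat;                     (* the machine has [tapes.+1] tapes *)
  symbol : finType;
  blank : symbol;
  state : finType;
  start : state;
  halting : pred state;
  accepting : pred state;          (* only consulted in halting states *)
  delta : state -> {ffun 'I_tapes.+1 -> symbol} ->
          state * {ffun 'I_tapes.+1 -> symbol} * ('I_tapes.+1 -> move)
}.

(* Two-way infinite tapes: [(l, r)] is the tape whose scanned cell is the head
   of [r], the cells to its right being the tail of [r] and the cells to its
   left, nearest first, being [l]; every cell that is not listed is blank. *)
Definition tape (M : machine) : Type := seq (symbol M) * seq (symbol M).

Definition read (M : machine) (t : tape M) : symbol M := head (blank M) t.2.

Definition write (M : machine) (a : symbol M) (t : tape M) : tape M :=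
  (t.1, a :: behead t.2).

Definition shift (M : machine) (m : move) (t : tape M) : tape M :=
  match m with
  | MoveLeft => (behead t.1, head (blank M) t.1 :: t.2)
  | Stay => t
  | MoveRight => (read t :: t.1, behead t.2)
  end.

Definition config (M : machine) : Type :=
  state M * ('I_(tapes M).+1 -> tape M).

Definition step (M : machine) (c : config M) : config M :=
  if halting c.1 then c else
  let: (q, a, m) := delta c.1 [ffun i => read (c.2 i)] in
  (q, fun i => shift (m i) (write (a i) (c.2 i))).

(* The input is on tape 0, its first symbol being scanned. *)
Definition init (M : machine) (w : seq (symbol M)) : config M :=
  (start M, fun i => if i == ord0 then ([::], w) else ([::], [::])).

Definition run (M : machine) (w : seq (symbol M)) (n : nat) : config M :=
  iter n (@step M) (init w).

(* Representation of an input or output alphabet by tape symbols. *)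
Definition coding (A : Type) (M : machine) (code : A -> symbol M) : Prop :=
  injective code /\ forall a, code a <> blank M.

(* The output is the blank-delimited word that starts at the scanned cell of
   the last tape. *)
Definition outputs (A : Type) (M : machine) (code : A -> symbol M)
    (c : config M) (v : seq A) : Prop :=
  exists2 r, (c.2 ord_max).2 = map code v ++ r & head (blank M) r = blank M.

(* Every polynomial over [nat] is bounded by one of this form. *)
Definition poly_bound (a d n : nat) : nat := a * n ^ d + a.

Definition language (A : Type) : Type := seq A -> Prop.

Definition in_P (A : finType) (L : language A) : Prop :=
  exists (M : machine) (code : A -> symbol M) (a d : nat),
    coding code /\
    forall w, let c := run (map code w) (poly_bound a d (size w)) in
      halting c.1 /\ (accepting c.1 <-> L w).

Definition poly_time_computable (A B : finType) (f : seq A -> seq B) : Prop :=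
  exists (M : machine) (codeA : A -> symbol M) (codeB : B -> symbol M)
         (a d : nat),
    [/\ coding codeA, coding codeB &
    forall w, let c := run (map codeA w) (poly_bound a d (size w)) in
      halting c.1 /\ outputs codeB c (f w)].

(* The words [w#y] with [R w y], where [None] is the separator [#]. *)
Definition pair_language (A B : Type) (R : seq A -> seq B -> Prop) :
    language (option (A + B)) :=
  fun z => exists w y,
    z = map (fun a => Some (inl a)) w ++ None :: map (fun b => Some (inr b)) y
    /\ R w y.

Definition in_NP (A : finType) (L : language A) : Prop :=
  exists (B : finType) (R : seq A -> seq B -> Prop) (a d : nat),
    in_P (pair_language R) /\
    forall w, L w <-> exists y, size y <= poly_bound a d (size w) /\ R w y.

Definition poly_reducible (A B : finType) (L : language A) (L' : language B) :
    Prop :=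
  exists f : seq A -> seq B,
    poly_time_computable f /\ forall w, L w <-> L' (f w).

Definition NP_hard (B : finType) (L' : language B) : Prop :=
  forall (A : finType) (L : language A), in_NP L -> poly_reducible L L'.

Definition NP_complete (B : finType) (L : language B) : Prop :=
  in_NP L /\ NP_hard L.

(* The language of the decision problem "given [x : I] with [inst x], decide
   whether [yes x]"; words that do not encode an instance are rejected. *)
Definition problem_language (I B : Type) (encode : I -> seq B)
    (inst yes : I -> Prop) : language B :=
  fun w => exists x, [/\ w = encode x, inst x & yes x].

(* The nodes are [inl s] with [s] in the class S and [inr t] with [t] in the
   class T. *)
Record bigraph := BiGraph {
  nS : nat;
  nT : nat;
  edges : {set 'I_nS * 'I_nT}
}.

Section Matchings.

Variables S T : finType.
Implicit Types (E N F : {set S * T}) (e : S * T) (x y : S + T).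

Definition incident e x : bool :=
  match x with inl s => e.1 == s | inr t => e.2 == t end.

Definition degree F x : nat := #|[set e in F | incident e x]|.

Definition max_degree F : nat := \max_(x : S + T) degree F x.

Definition two_matching E N : Prop :=
  N \subset E /\ forall x, degree N x <= 2.

Definition adjacent N : rel (S + T) :=
  fun x y => (x != y) && [exists e in N, incident e x && incident e y].

Definition component N x : {set S + T} := [set y | connect (adjacent N) x y].

Definition component_edges N x : {set S * T} :=
  [set e in N | (inl e.1 \in component N x) && (inr e.2 \in component N x)].

(* The subgraph with node set [C] and edge set [F] is a V-path of the graph
   with edge set [E]. *)
Definition is_Vpath E (C : {set S + T}) F : Prop :=
  exists s t1 t2,
    [/\ t1 != t2, (s, t1) \in E, (s, t2) \in E,
        C = [set inr t1; inl s; inr t2] & F = [set (s, t1); (s, t2)]].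

Definition V_free E N : Prop :=
  forall x, ~ is_Vpath E (component N x) (component_edges N x).

Definition covers_T N : Prop :=
  forall t : T, exists2 e, e \in N & incident e (inr t).

End Matchings.

Definition has_Vfree_2matching_covering_T (G : bigraph) : Prop :=
  exists N : {set 'I_(nS G) * 'I_(nT G)},
    [/\ two_matching (edges G) N, V_free (edges G) N & covers_T N].

(* The adjacency matrix, row by row, each row being terminated by [None]; the
   leading row of [nT] ones fixes the number of columns even when [nS] is 0. *)
Definition encode_bigraph (G : bigraph) : seq (option bool) :=
  rcons (nseq (nT G) (Some true)) None ++
  flatten [seq rcons [seq Some ((s, t) \in edges G) | t <- enum 'I_(nT G)] None
          | s <- enum 'I_(nS G)].

Lemma size_encode_bigraph (G : bigraph) :
  size (encode_bigraph G) = (nT G).+1 * (nS G).+1.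
Proof.
rewrite /encode_bigraph size_cat size_rcons size_nseq size_flatten /shape.
rewrite -map_comp (eq_map (g := fun=> (nT G).+1)); last first.
  by move=> s /=; rewrite size_rcons size_map size_enum_ord.
rewrite sumnE big_map big_const_seq count_predT size_enum_ord iter_addn_0.
by rewrite mulnS.
Qed.

Lemma encode_bigraph_inj : injective encode_bigraph.
Proof.
have row_inj (u v : seq bool) (x y : seq (option bool)) :
    map Some u ++ None :: x = map Some v ++ None :: y -> u = v /\ x = y.
  elim: u v => [|a u IH] [|b v] //=; first by case.
  by case=> -> /IH [-> ->].
move=> G H e.
have sz : (nT G).+1 * (nS G).+1 = (nT H).+1 * (nS H).+1.
  by rewrite -!size_encode_bigraph e.
move: e; rewrite /encode_bigraph -!cats1 -!catA /=.
rewrite -!(map_nseq _ Some).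
move/row_inj=> [] /(congr1 size); rewrite !size_nseq => eT.
move: sz => /eqP; rewrite {1}eT eqn_pmul2l // => /eqP [] eS.
case: G H eT eS => [a b E] [a' b' E'] /= eT eS; subst a' b'.
move=> h; congr BiGraph; apply/setP=> -[s t].
suff rows (l : seq 'I_a) :
    flatten [seq rcons [seq Some ((s, t) \in E) | t <- enum 'I_b] None
            | s <- l] =
    flatten [seq rcons [seq Some ((s, t) \in E') | t <- enum 'I_b] None
            | s <- l] ->
    forall s, s \in l -> forall t, ((s, t) \in E) = ((s, t) \in E').
  by apply: (rows _ h); rewrite mem_enum.
elim: l => //= x l IH.
rewrite -!cats1 -!catA /= => h1 s0.
rewrite (map_comp Some (fun t => (x, t) \in E)) in h1.
rewrite (map_comp Some (fun t => (x, t) \in E')) in h1.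
case: (row_inj _ _ _ _ h1) => /eq_in_map h2 /IH h3.
rewrite in_cons => /orP [/eqP -> t0|]; last exact: h3.
by apply: h2; rewrite mem_enum.
Qed.

(* Main.v *)
(* Membership.  The certificate is the adjacency matrix of the 2-matching, each
   entry being annotated with the numbers of edges and of matching edges met so
   far in its row and in its column.  V-freeness is local: of two matching edges
   at an S-node, one must lead to a T-node of matching degree 2.  Hence every
   condition relates entries that are adjacent or one row apart, and one pass
   checks them all, with a second head that is delayed by one row.

   Hardness.  The accepting computations of a verifier are the tilings of a
   square grid whose first row is prescribed: a cell carries a piece of the tapes
   read relative to their heads, so that only neighbouring cells constrain each
   other.  In the matching, a coin is an S-node with a pendant leaf: the leaf has
   to be covered, which leaves the coin one further edge, and the T-node that
   takes this edge must take two, as otherwise it would end a V-path.  A link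
   joins two options (T-nodes) through an S-node followed by a pendant path of
   three edges, and it can cover at most one of them.  On a path of m options
   joined by m - 1 links, some option is therefore covered by its two coins, and
   options that share a coin exclude each other.  A cell of the grid is a path of
   options, one for each tile; the chosen tile is copied along a chain of pairs
   of options, and copies that face each other in neighbouring cells share a coin
   if their tiles do not match. *)

From mathcomp Require Import all_boot all_algebra.
From mathcomp Require Import zify ring.
Require Import Defs.

Set Implicit Arguments.
Unset Strict Implicit.
Unset Printing Implicit Defensive.

(** * Local form of V-freeness *)

(** Three constraints shape the construction. Degree: a tile can conflict with many tiles of a
    neighbouring cell, but an option has room for two coins only; so the chosen tile is replicated
    once for every possible conflict, and each copy spends one coin on the chain and one on a single
    conflict. Locality: the verifier has several tapes with independent heads; seen relative to the
    heads, all writing takes place in column 0, but every move shifts a whole tape. Hence each tile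
    knows the state and the scanned symbols, and stores a column with both neighbours, so that
    overlaps of adjacent tiles replace constraints between three cells. Uniformity: the reduction is
    carried out by an explicit machine. Nodes are therefore pairs of a cell and one of finitely many
    kinds, and adjacency depends only on two letters of the input row, on being in row or column 0,
    and on whether index differences are 0 or 1; heads moving in nested loops provide all of this
    without arithmetic. *)

Definition good (S T : finType) (E N : S -> T -> bool) : Prop :=
  [/\ forall s t, N s t -> E s t,
      forall s, #|[set t | N s t]| <= 2,
      forall t, #|[set s | N s t]| <= 2,
      forall t, exists s, N s t &
      forall s t1 t2, t1 != t2 -> N s t1 -> N s t2 ->
        exists2 s', s' != s & N s' t1 || N s' t2].

Section Local.
Variables S T : finType.
Implicit Types (E N : {set S * T}).

Lemma degree_inl N s : degree N (inl s) = #|[set t | (s, t) \in N]|.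
Proof.
rewrite /degree -[RHS](card_imset (f := fun t => (s, t))); last by move=> ? ? [].
apply: eq_card => -[s' t]; rewrite !inE /=.
apply/andP/imsetP => [[Nst /eqP <-]|[t' + [-> ->]]]; first by exists t; rewrite ?inE.
by rewrite inE.
Qed.

Lemma degree_inr N t : degree N (inr t) = #|[set s | (s, t) \in N]|.
Proof.
rewrite /degree -[RHS](card_imset (f := fun s => (s, t))); last by move=> ? ? [].
apply: eq_card => -[s t']; rewrite !inE /=.
apply/andP/imsetP => [[Nst /eqP <-]|[s' + [-> ->]]]; first by exists s; rewrite ?inE.
by rewrite inE.
Qed.

Lemma adjacentE N x y : adjacent N x y =
  match x, y with
  | inl s, inr t | inr t, inl s => (s, t) \in N
  | _, _ => false
  end.
Proof.
rewrite /adjacent; case: x y => [s|t] [s'|t'] /=.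
- apply/negP => /andP [ns /existsP [[a b] /and3P [_ /= /eqP e1 /eqP e2]]].
  by rewrite -e1 -e2 eqxx in ns.
- apply/existsP/idP => [[[a b] /and3P [h /eqP <- /eqP <-]] //|h].
  by exists (s, t'); rewrite h !eqxx.
- apply/existsP/idP => [[[a b] /and3P [h /eqP <- /eqP <-]] //|h].
  by exists (s', t); rewrite h !eqxx.
- apply/negP => /andP [ns /existsP [[a b] /and3P [_ /= /eqP e1 /eqP e2]]].
  by rewrite -e1 -e2 eqxx in ns.
Qed.

(** An S-node with two matching edges has no third, so its component is the bare V-path on [t1],
    [s], [t2] unless one of the two ends has another matching edge. *)
Lemma V_free_local E N : two_matching E N ->
  V_free E N <->
  forall s t1 t2, t1 != t2 -> (s, t1) \in N -> (s, t2) \in N ->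
    exists2 s', s' != s & ((s', t1) \in N) || ((s', t2) \in N).
Proof.
move=> [/subsetP sub deg]; split=> [free s t1 t2 nt N1 N2|loc x].
  case: (pickP [pred s' | (s' != s) && (((s', t1) \in N) || ((s', t2) \in N))]).
    by move=> s' /= /andP []; exists s'.
  move=> none; case: (free (inl s)); exists s, t1, t2.
  have onlys s' t : (s', t) \in N -> t \in [:: t1; t2] -> s' = s.
    move=> h; rewrite !inE => ht; have /= := none s'.
    case: eqVneq => //= _; case/orP: ht h => /eqP -> ->; by rewrite ?orbT.
  have onlyt t : (s, t) \in N -> t \in [:: t1; t2].
    move=> h; have := deg (inl s); rewrite degree_inl leqNgt; apply: contraR.
    rewrite !inE negb_or => /andP [h1 h2]; apply/card_gt2P.
    by exists t1, t2, t; rewrite !inE; split; split=> //; rewrite eq_sym.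
  have comp : component N (inl s) = [set inr t1; inl s; inr t2].
    apply/setP => y; rewrite inE; apply/idP/idP; last first.
      have a1 : adjacent N (inl s) (inr t1) by rewrite adjacentE.
      have a2 : adjacent N (inl s) (inr t2) by rewrite adjacentE.
      by rewrite !inE -orbA => /or3P [] /eqP ->; rewrite ?connect0 ?connect1.
    (* No matching edge leaves the three nodes, so the component cannot be larger. *)
    have cl : closed (adjacent N) [set inr t1; inl s; inr t2].
      move=> a b; rewrite adjacentE; case: a b => [a|a] [b|b] // h.
        rewrite !inE -!orbA /= orbF !(inj_eq inr_inj) !(inj_eq inl_inj).
        apply/eqP/idP => [ea|eb]; last by apply: onlys h _; rewrite !inE.
        by have := onlyt b; rewrite -ea h !inE; apply.
      rewrite !inE -!orbA /= orbF !(inj_eq inr_inj) !(inj_eq inl_inj).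
      apply/idP/eqP => [eb|eb]; first by apply: onlys h _; rewrite !inE.
      by have := onlyt a; rewrite -eb h !inE; apply.
    move/(closed_connect cl) => <-; by rewrite !inE eqxx.
  split=> //; try exact: sub.
  apply/setP => -[a b]; rewrite inE comp !inE /= !xpair_eqE.
  rewrite !(inj_eq inr_inj) !(inj_eq inl_inj) orbF -andb_orr (_ : inr b == inl s = false) // orbF.
  apply/and3P/andP => [[_ -> ->] //|[/eqP -> h]]; rewrite eqxx h; split=> //.
  by case/orP: h => /eqP ->.
move=> [s [t1 [t2 [nt _ _ cE fE]]]].
have N12 : ((s, t1) \in N) && ((s, t2) \in N).
  have : (s, t1) \in component_edges N x by rewrite fE !inE eqxx.
  have : (s, t2) \in component_edges N x by rewrite fE !inE eqxx orbT.
  by rewrite !inE => /andP [-> _] /andP [-> _].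
case/andP: N12 => N1 N2; have [s' ns h] := loc s t1 t2 nt N1 N2.
suff : inl s' \in component N x.
  by rewrite cE !inE /= orbF (inj_eq inl_inj) (negPf ns).
case/orP: h => h; rewrite inE.
  apply: (@connect_trans _ _ (inr t1)); last by apply: connect1; rewrite adjacentE.
  have : inr t1 \in component N x by rewrite cE !inE eqxx.
  by rewrite inE.
apply: (@connect_trans _ _ (inr t2)); last by apply: connect1; rewrite adjacentE.
have : inr t2 \in component N x by rewrite cE !inE eqxx orbT.
by rewrite inE.
Qed.

End Local.

Lemma has_VfreeP (G : bigraph) :
  has_Vfree_2matching_covering_T G <->
  exists N, good (fun s t => (s, t) \in edges G) N.
Proof.
split=> [[N [m free cov]]|[N [sub dS dT cov loc]]].
  have [/subsetP sub deg] := m.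
  exists (fun s t => (s, t) \in N); split.
  - by move=> s t /sub.
  - by move=> s; rewrite -degree_inl.
  - by move=> t; rewrite -degree_inr.
  - by move=> t; have [[a b] h /= /eqP <-] := cov t; exists a.
  - exact/(V_free_local m).
exists [set e | N e.1 e.2].
have m : two_matching (edges G) [set e | N e.1 e.2].
  split; first by apply/subsetP => -[a b]; rewrite inE /=; exact: sub.
  case=> [s|t]; rewrite ?degree_inl ?degree_inr.
    by under eq_finset do rewrite inE /=.
  by under eq_finset do rewrite inE /=.
split=> //.
  apply/(V_free_local m) => s t1 t2; rewrite !inE /= => nt n1 n2.
  by have [s' h1 h2] := loc _ _ _ nt n1 n2; exists s'; rewrite ?inE.
by move=> t; have [s h] := cov t; exists (s, t); rewrite ?inE /=.
Qed.

Section Transfer.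
Variables (S T S' T' : finType) (f : S' -> S) (g : T' -> T).
Hypotheses (fb : bijective f) (gb : bijective g).

Lemma good_transfer E N : good E N ->
  good (fun s t => E (f s) (g t)) (fun s t => N (f s) (g t)).
Proof.
have [f' fK f'K] := fb; have [g' gK g'K] := gb.
move=> [sub dS dT cov loc]; split.
- by move=> s t /sub.
- move=> s; apply: leq_trans (dS (f s)).
  rewrite -(card_imset _ (can_inj gK)); apply/subset_leq_card/subsetP => t.
  by move=> /imsetP [u + ->]; rewrite !inE.
- move=> t; apply: leq_trans (dT (g t)).
  rewrite -(card_imset _ (can_inj fK)); apply/subset_leq_card/subsetP => s.
  by move=> /imsetP [u + ->]; rewrite !inE.
- by move=> t; have [s h] := cov (g t); exists (f' s); rewrite f'K.
- move=> s t1 t2 nt n1 n2.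
  have [||| s' h1 h2] := loc (f s) (g t1) (g t2) => //.
    by rewrite (can_eq gK).
  by exists (f' s'); rewrite ?f'K //; apply: contraNneq h1 => <-; rewrite f'K.
Qed.

End Transfer.

(** * Coins and links *)

Lemma card_le2 (T : finType) (A : {set T}) :
  (forall x y z, x \in A -> y \in A -> z \in A ->
     x != y -> y != z -> z != x -> False) -> #|A| <= 2.
Proof.
move=> h; rewrite leqNgt; apply/card_gt2P => -[x [y [z [[? ? ?] [? ? ?]]]]].
exact: (h x y z).
Qed.

Lemma card_le2_neq (T : finType) (A : {set T}) x y z :
  #|A| <= 2 -> x \in A -> y \in A -> z \in A -> x != y -> z != x -> z = y.
Proof.
move=> h *; apply/eqP; apply: contraTT h => nzy; rewrite -ltnNge.
by apply/card_gt2P; exists x, y, z; split; split=> //; rewrite eq_sym.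
Qed.

Ltac eqs := repeat match goal with
  | H : is_true (?a == ?b) |- _ => move/eqP: H => H; subst
  end.

Section Gadget.
Variables (Y Z C : finType) (inc : Z -> Y -> bool) (cad : C -> Y -> bool).

(* Sum types carry the nodes: [Z + Z + C] are the two S-nodes of each link and
   the coins, [Y + (Z + Z + C)] the options, the two T-nodes of each link and
   the pendant leaf of each coin. *)
Definition gadget (s : Z + Z + C) (t : Y + (Z + Z + C)) : bool :=
  match s, t with
  | inl (inl z), inl y => inc z y
  | inl (inl z), inr (inl (inl z')) => z == z'
  | inl (inr z), inr (inl (inl z')) => z == z'
  | inl (inr z), inr (inl (inr z')) => z == z'
  | inr c, inl y => cad c y
  | inr c, inr (inr c') => c == c'
  | _, _ => false
  end.

Definition allowed (y : Y) (v : Z + C * C) : bool :=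
  match v with
  | inl z => inc z y
  | inr (c, c') => [&& c != c', cad c y & cad c' y]
  end.

Definition clash (v v' : Z + C * C) : bool :=
  match v, v' with
  | inl z, inl z' => z == z'
  | inr (c1, c2), inr (c1', c2') =>
    (c1 \in [:: c1'; c2']) || (c2 \in [:: c1'; c2'])
  | _, _ => false
  end.

(** What remains of the matching once leaves and link paths are accounted for: every option picks
    either a link or two different coins, and nothing is picked twice. *)
Definition resolvable : Prop :=
  exists ch : Y -> Z + C * C,
    (forall y, allowed y (ch y)) /\
    forall y y', clash (ch y) (ch y') -> y = y'.

Lemma gadget_sound N : good gadget N -> resolvable.
Proof.
move=> [sub dS dT cov loc].
(* A leaf has no neighbour but its coin. *)
have leafN c : N (inr c) (inr (inr c)).
  have [s h] := cov (inr (inr c)); move: (sub _ _ h).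
  by case: s h => [[z|z]|c'] h //= /eqP e; subst c'.
have coinN c y y' : N (inr c) (inl y) -> N (inr c) (inl y') -> y = y'.
  move=> h h'; have := @card_le2_neq _ _ (inr (inr c)) (inl y) (inl y') (dS (inr c)).
  by rewrite !inE leafN h h' => /(_ isT isT isT isT isT) [->].
(* A link that takes two options has no edge left for its first T-node. The second S-node must then
   cover both T-nodes of the link, and these two edges form a V-path component. *)
have linkN z y y' : N (inl (inl z)) (inl y) -> N (inl (inl z)) (inl y') -> y = y'.
  move=> h h'; apply/eqP; apply: contraT => nyy.
  have notz : N (inl (inl z)) (inr (inl (inl z))) = false.
    apply/negP => hz.
    have := @card_le2_neq _ _ (inl y) (inl y') (inr (inl (inl z))) (dS (inl (inl z))).
    rewrite !inE h h' hz (inj_eq inl_inj) nyy.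
    by move=> /(_ isT isT isT isT isT).
  have gz : N (inl (inr z)) (inr (inl (inl z))).
    have [s hs] := cov (inr (inl (inl z))); move: (sub _ _ hs).
    case: s hs => [[z'|z']|c'] hs //= /eqP e; subst z' => //.
    by rewrite notz in hs.
  have gl : N (inl (inr z)) (inr (inl (inr z))).
    have [s hs] := cov (inr (inl (inr z))); move: (sub _ _ hs).
    by case: s hs => [[z'|z']|c'] hs //= /eqP e; subst z'.
  have [//| s' ns /orP [] hs] := loc _ _ _ _ gz gl; move: (sub _ _ hs).
    case: s' ns hs => [[z'|z']|c'] ns hs //= /eqP e; subst z'.
      by rewrite notz in hs.
    by rewrite eqxx in ns.
  case: s' ns hs => [[z'|z']|c'] ns hs //= /eqP e; subst z'.
  by rewrite eqxx in ns.
(* An option entered from a coin needs a second edge, as otherwise the coin, its leaf and the option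
   form a V-path. If the second edge comes from a link, that link is recorded. *)
have choice y : exists v, match v with
    | inl z => N (inl (inl z)) (inl y)
    | inr (c, c') => [&& c != c', N (inr c) (inl y) & N (inr c') (inl y)]
    end.
  have [s hs] := cov (inl y); move: (sub _ _ hs).
  case: s hs => [[z|z]|c] hs //= _; first by exists (inl z).
  have [//|s' ns /orP [] hs'] := loc _ _ _ _ (leafN c) hs; move: (sub _ _ hs').
    by case: s' ns hs' => [[z|z]|c'] ns hs' //= /eqP e; rewrite e eqxx in ns.
  case: s' ns hs' => [[z|z]|c'] ns hs' //= _; first by exists (inl z).
  by exists (inr (c, c')); rewrite hs hs' eq_sym !andbT; apply: contraNneq ns => ->.
have [ch hch] := fin_all_exists choice.
exists ch; split=> [y|y y'].
  move: (hch y); case: (ch y) => [z|[c c']] /=; first by move/sub.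
  by move=> /and3P [-> /sub /= -> /sub /= ->].
move: (hch y) (hch y'); case: (ch y) (ch y') => [z|[c1 c2]] [z'|[c3 c4]] //=.
  by move=> h1 h2 /eqP e; subst z'; apply: linkN h1 h2.
move=> /and3P [_ h1 h2] /and3P [_ h3 h4]; rewrite !inE.
case/orP => /orP [] /eqP e; subst; [exact: coinN h1 h3|exact: coinN h1 h4|exact: coinN h2 h3|exact: coinN h2 h4].
Qed.

Lemma gadget_complete : resolvable -> exists N, good gadget N.
Proof.
move=> [ch [al cl]].
(* All edges at leaves and on link paths are used; only the edges at options depend on [ch]. *)
pose N (s : Z + Z + C) (t : Y + (Z + Z + C)) : bool :=
  match s, t with
  | inl (inl z), inl y => ch y == inl z
  | inr c, inl y => if ch y is inr (c1, c2) then c \in [:: c1; c2] else false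
  | _, _ => gadget s t
  end.
have linkN z y y' : N (inl (inl z)) (inl y) -> N (inl (inl z)) (inl y') -> y = y'.
  by move=> /eqP e /eqP e'; apply: cl; rewrite e e' /= eqxx.
have coinN c y y' : N (inr c) (inl y) -> N (inr c) (inl y') -> y = y'.
  rewrite /=; case e: (ch y) => [//|[c1 c2]]; case e': (ch y') => [//|[c3 c4]].
  move=> h1 h2; apply: cl; rewrite e e' /=.
  by move: h1; rewrite !inE => /orP [] /eqP <-; move: h2; rewrite !inE => ->; rewrite ?orbT.
exists N; split.
- case=> [[z|z]|c] [y|[[z'|z']|c']] //=.
    by move/eqP=> e; have := al y; rewrite e.
  have := al y; case: (ch y) => [//|[c1 c2]] /= /and3P [_ h1 h2].
  by rewrite !inE => /orP [] /eqP ->.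
- case=> [[z|z]|c]; apply: card_le2 => t1 t2 t3; rewrite !inE.
  + case: t1 t2 t3 => [y1|[[z1|z1]|c1]] [y2|[[z2|z2]|c2]] [y3|[[z3|z3]|c3]] //;
      try (by move=> /linkN h1 /h1 -> _; rewrite eqxx);
      try (by move=> /linkN h1 _ /h1 -> _ _; rewrite eqxx);
      try (by move=> _ /linkN h1 /h1 -> _; rewrite eqxx);
      by move=> /= h1 h2 h3; eqs; rewrite ?eqxx.
  + case: t1 t2 t3 => [y1|[[z1|z1]|c1]] [y2|[[z2|z2]|c2]] [y3|[[z3|z3]|c3]] //;
      move=> /= /eqP e1 /eqP e2 /eqP e3; subst; by rewrite ?eqxx.
  + case: t1 t2 t3 => [y1|[[z1|z1]|c1]] [y2|[[z2|z2]|c2]] [y3|[[z3|z3]|c3]] //;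
      try (by move=> /coinN h1 /h1 -> _; rewrite eqxx);
      try (by move=> /coinN h1 _ /h1 -> _ _; rewrite eqxx);
      try (by move=> _ /coinN h1 /h1 -> _; rewrite eqxx);
      by move=> /= h1 h2 h3; eqs; rewrite ?eqxx.
- case=> [y|[[z|z]|c]]; apply: card_le2 => s1 s2 s3; rewrite !inE.
  + case: s1 s2 s3 => [[z1|z1]|c1] [[z2|z2]|c2] [[z3|z3]|c3] //=; case e: (ch y) => [z|[a b]] //=.
      by move=> /eqP [->] /eqP [->]; rewrite eqxx.
    rewrite !inE !(inj_eq inr_inj) => h1 h2 h3.
    case/orP: h1 h2 h3 => /eqP -> /orP [] /eqP -> /orP [] /eqP ->; by rewrite ?eqxx.
  + case: s1 s2 s3 => [[z1|z1]|c1] [[z2|z2]|c2] [[z3|z3]|c3] //=;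
      move=> /eqP e1 /eqP e2 /eqP e3; subst; by rewrite ?eqxx.
  + case: s1 s2 s3 => [[z1|z1]|c1] [[z2|z2]|c2] [[z3|z3]|c3] //=;
      move=> /eqP e1 /eqP e2 /eqP e3; subst; by rewrite ?eqxx.
  + case: s1 s2 s3 => [[z1|z1]|c1] [[z2|z2]|c2] [[z3|z3]|c3] //=.
    by move=> /eqP -> /eqP ->; rewrite eqxx.
- case=> [y|[[z|z]|c]].
  + case e: (ch y) => [z|[a b]]; first by exists (inl (inl z)); rewrite /= e.
    by exists (inr a); rewrite /= e !inE eqxx.
  + by exists (inl (inl z)); rewrite /= eqxx.
  + by exists (inl (inr z)); rewrite /= eqxx.
  + by exists (inr c); rewrite /= eqxx.
- case=> [[z|z]|c] t1 t2 nt h1 h2.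
  (* The T-node between the two S-nodes of a link has matching degree 2, so each of these S-nodes is
     the witness for the other. *)
  + exists (inl (inr z)) => //.
    case: t1 t2 nt h1 h2 => [y1|[[z1|z1]|c1]] [y2|[[z2|z2]|c2]] // nt h1 h2.
    * by rewrite (linkN _ _ _ h1 h2) eqxx in nt.
    * by rewrite /= in h1 h2 *; eqs; rewrite ?eqxx ?orbT // in nt *.
    * by rewrite /= in h1 h2 *; eqs; rewrite ?eqxx ?orbT // in nt *.
  + exists (inl (inl z)) => //.
    case: t1 t2 nt h1 h2 => [y1|[[z1|z1]|c1]] [y2|[[z2|z2]|c2]] //= nt /eqP e1 /eqP e2;
      subst; by rewrite eqxx in nt || rewrite !eqxx ?orbT.
  + suff h y : N (inr c) (inl y) -> exists2 s', s' != inr c & N s' (inl y).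
      case: t1 t2 nt h1 h2 => [y1|[[z1|z1]|c1]] [y2|[[z2|z2]|c2]] // nt h1 h2.
      * by rewrite (coinN _ _ _ h1 h2) eqxx in nt.
      * by have [s' n1 n2] := h _ h1; exists s' => //; rewrite n2.
      * by have [s' n1 n2] := h _ h2; exists s' => //; rewrite n2 orbT.
      * by move: nt h1 h2 => /= nt /eqP e1 /eqP e2; subst; rewrite eqxx in nt.
    have := al y; rewrite /=; case e: (ch y) => [//|[c1 c2]] /= /and3P [nc _ _].
    rewrite !inE => /orP [] /eqP ->.
      by exists (inr c2); rewrite /= ?e ?inE ?eqxx ?orbT // (inj_eq inr_inj) eq_sym.
    by exists (inr c1); rewrite /= ?e ?inE ?eqxx ?orbT // (inj_eq inr_inj).
Qed.

End Gadget.

(** * Tilings as matchings *)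

Section Rank.
Variables (T : finType) (x0 : T).

Definition rk (x : T) : nat := index x (enum T).
Definition unrk (k : nat) : T := nth x0 (enum T) k.

Lemma rk_lt x : rk x < #|T|.
Proof. by rewrite cardE index_mem mem_enum. Qed.

Lemma unrkK x : unrk (rk x) = x.
Proof. by rewrite /unrk nth_index // mem_enum. Qed.

Lemma rkK k : k < #|T| -> rk (unrk k) = k.
Proof. by move=> h; rewrite /rk index_uniq ?enum_uniq // -cardE. Qed.

Lemma rk_inj : injective rk.
Proof.
move=> x y e; have y0 : y \in enum T by rewrite mem_enum.
by rewrite -(nth_index y (s := enum T) (x := x)) ?mem_enum // -/(rk x) e nth_index.
Qed.
End Rank.

Section Template.
Variables (X Tile : finType).
Variable U : bool -> bool -> X -> X -> Tile -> bool.
Variable R : bool -> Tile -> Tile -> bool.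

(* Copies of a tile: [(d, true, r)] faces the tile [r] in the next cell in
   direction [d] (true: horizontal), [(d, false, r)] faces the previous one. *)
Definition port : finType := (bool * bool * Tile)%type.
(** [inl s] selects tile [s] in the cell. For each port [o] of [s] a pair of options shares one
    link: [(s, o, true)] is the copy proper, which has to take its coins when [s] is selected, and
    [(s, o, false)] is an intermediate option that passes the selection on from the previous
    copy. *)
Definition optK : finType := (Tile + Tile * port * bool)%type.
Definition linkK : finType := (Tile + Tile * port)%type.
(** [inl (s, true)] is usable only where [U] admits [s]. [inl (s, false)] joins the selection to the
    first intermediate option, and [(s, o, None)] joins the copy at [o] to the next intermediate
    one. [(s, o, Some false)] is private to an intermediate option; [(s, o, Some true)] is the coin
    through which facing copies conflict. *)
Definition coinK : finType := (Tile * bool + Tile * port * option bool)%type.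

Definition same (di dj : option bool) := (di == Some false) && (dj == Some false).
Definition nextto (d : bool) (di dj : option bool) :=
  (di == Some (~~ d)) && (dj == Some d).

Definition incK (z : linkK) (y : optK) : bool :=
  match z, y with
  | inl s, inl s' =>
    ((rk s).+1 < #|Tile|) && ((rk s' == rk s) || (rk s' == (rk s).+1))
  | inr (s, o), inr (s', o', _) => (s == s') && (o == o')
  | _, _ => false
  end.

Definition cadK (fi fj : bool) (xi xj : X) (di dj : option bool)
    (c : coinK) (y : optK) : bool :=
  match c, y with
  | inl (s, true), inl s' => [&& same di dj, s == s' & U fi fj xi xj s]
  | inl (s, false), inl s' => same di dj && (s == s')
  | inl (s, false), inr (s', o, false) => [&& same di dj, s == s' & rk o == 0]
  | inr (s, o, None), inr (s', o', true) => [&& same di dj, s == s' & o == o']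
  | inr (s, o, None), inr (s', o', false) =>
    [&& same di dj, s == s' & rk o' == (rk o).+1]
  | inr (s, o, Some false), inr (s', o', false) =>
    [&& same di dj, s == s' & o == o']
  | inr (s, (d, true, r), Some true), inr (s', o', true) =>
    [&& same di dj, s == s' & (d, true, r) == o'] ||
    [&& nextto d di dj, o' == (d, false, s), r == s' & ~~ R d s s']
  | inr (s, (d, false, r), Some true), inr (s', o', true) =>
    [&& same di dj, s == s', (d, false, r) == o' &
        (if d then fj else fi) || R d r s]
  | _, _ => false
  end.

Definition snode : finType := (linkK + linkK + coinK)%type.
Definition tnode : finType := (optK + (linkK + linkK + coinK))%type.

Definition adjK (fi fj : bool) (xi xj : X) (di dj : option bool)
    (s : snode) (t : tnode) : bool :=
  match s, t with
  | inr c, inl y => cadK fi fj xi xj di dj c y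
  | _, _ => same di dj && gadget incK (fun _ _ => false) s t
  end.

Definition offset (m n : nat) : option bool :=
  if n == m then Some false else if n == m.+1 then Some true else None.

Lemma offset_eqE m n b : (offset m n == Some b) = (n == b + m).
Proof.
rewrite /offset; case: b => /=; rewrite ?add0n ?add1n.
  case: (eqVneq n m) => [->|_]; last by case: (n == m.+1).
  by rewrite -[RHS]/(m == m.+1) eqn_leq ltnn andbF.
by case: (eqVneq n m) => // _; case: (n == m.+1).
Qed.

Variables (t0 : Tile) (x0 : X) (u : seq X).
Let W := size u.
Let cell : finType := ('I_W * 'I_W)%type.

Definition tiling : Prop :=
  exists t : 'I_W -> 'I_W -> Tile,
  [/\ forall i j : 'I_W, U (val i == 0) (val j == 0) (nth x0 u i) (nth x0 u j) (t i j),
      forall i j j' : 'I_W, val j' = j.+1 -> R true (t i j) (t i j') &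
      forall i i' j : 'I_W, val i' = i.+1 -> R false (t i j) (t i' j)].

Definition inc (z : cell * linkK) (y : cell * optK) : bool :=
  (z.1 == y.1) && incK z.2 y.2.

Definition cad (c : cell * coinK) (y : cell * optK) : bool :=
  cadK (val c.1.1 == 0) (val c.1.2 == 0) (nth x0 u c.1.1) (nth x0 u c.1.2)
    (offset c.1.1 y.1.1) (offset c.1.2 y.1.2) c.2 y.2.

Lemma sameE (a b : cell) :
  same (offset a.1 b.1) (offset a.2 b.2) = (a == b).
Proof.
case: a b => [i j] [k l].
rewrite /same !offset_eqE !add0n xpair_eqE -!val_eqE /=; congr andb; exact: eq_sym.
Qed.

(** At the border the default is the cell itself; the value matters only for cells related by
    [nextto], where [nextE] applies. *)
Definition next_cell (d : bool) (a : cell) : cell :=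
  if d then (a.1, insubd a.2 a.2.+1) else (insubd a.1 a.1.+1, a.2).
Definition prev_cell (d : bool) (a : cell) : cell :=
  if d then (a.1, insubd a.2 a.2.-1) else (insubd a.1 a.1.-1, a.2).

Lemma nextE d (a b : cell) :
  nextto d (offset a.1 b.1) (offset a.2 b.2) ->
  [/\ b = next_cell d a, a = prev_cell d b & (if d then val b.2 else val b.1) != 0].
Proof.
case: a b => [i j] [k l]; rewrite /nextto !offset_eqE.
case: d => /= /andP [] /eqP e1 /eqP e2; rewrite /next_cell /prev_cell /=.
  have {e1} -> : k = i by apply: val_inj; rewrite /= e1.
  rewrite e2 add1n; split=> //; congr pair; apply: val_inj; rewrite val_insubd ?ltn_ord //=.
  by rewrite -[j.+1]add1n -e2 ltn_ord.
have {e2} -> : l = j by apply: val_inj; rewrite /= e2.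
rewrite e1 add1n; split=> //; congr pair; apply: val_inj; rewrite val_insubd ?ltn_ord //=.
by rewrite -[i.+1]add1n -e1 ltn_ord.
Qed.

Lemma next_pred d (b : cell) : (if d then val b.2 else val b.1) != 0 ->
  nextto d (offset (prev_cell d b).1 b.1) (offset (prev_cell d b).2 b.2).
Proof.
case: b => i j; rewrite /nextto !offset_eqE /prev_cell; case: d => /= h;
  rewrite val_insubd (leq_ltn_trans (leq_pred _) (ltn_ord _)) eqxx ?andbT;
  by rewrite -lt0n in h; rewrite /= add1n prednK.
Qed.

Let o0 : port := (true, true, t0).
Let prevp (o : port) : port := unrk o0 (rk o).-1.
Let nextp (o : port) : port := unrk o0 (rk o).+1.
Let prevt (s : Tile) : Tile := unrk t0 (rk s).-1.
Let nextt (s : Tile) : Tile := unrk t0 (rk s).+1.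

Definition edge (d : bool) (a : cell) : bool :=
  if d then val a.2 == 0 else val a.1 == 0.

(** [coins], [owners], [links] and [ends] list candidates for neighbours; incidence implies
    membership. This gives the degree bound and, for an option that takes two coins, tells which
    coins they are. *)
Definition coins (y : cell * optK) : (cell * coinK) * (cell * coinK) :=
  let: (a, y) := y in
  match y with
  | inl s => ((a, inl (s, true)), (a, inl (s, false)))
  | inr (s, o, false) =>
    ((a, if rk o == 0 then inl (s, false) else inr (s, prevp o, None)),
     (a, inr (s, o, Some false)))
  | inr (s, (d, role, r) as o, true) =>
    ((a, inr (s, o, None)),
     if [|| role, edge d a | R d r s] then (a, inr (s, o, Some true))
     else (prev_cell d a, inr (r, (d, true, s), Some true)))
  end.

Definition owners (c : cell * coinK) : (cell * optK) * (cell * optK) :=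
  let: (a, c) := c in
  match c with
  | inl (s, true) => ((a, inl s), (a, inl s))
  | inl (s, false) => ((a, inl s), (a, inr (s, unrk o0 0, false)))
  | inr (s, o, None) => ((a, inr (s, o, true)), (a, inr (s, nextp o, false)))
  | inr (s, o, Some false) => ((a, inr (s, o, false)), (a, inr (s, o, false)))
  | inr (s, (d, role, r) as o, Some true) =>
    ((a, inr (s, o, true)),
     if role then (next_cell d a, inr (r, (d, false, s), true))
     else (a, inr (s, o, true)))
  end.

Definition links (y : cell * optK) : (cell * linkK) * (cell * linkK) :=
  let: (a, y) := y in
  match y with
  | inl s => ((a, inl s), (a, inl (prevt s)))
  | inr (s, o, _) => ((a, inr (s, o)), (a, inr (s, o)))
  end.

Definition ends (z : cell * linkK) : (cell * optK) * (cell * optK) :=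
  let: (a, z) := z in
  match z with
  | inl s => ((a, inl s), (a, inl (nextt s)))
  | inr (s, o) => ((a, inr (s, o, false)), (a, inr (s, o, true)))
  end.

Lemma inc_ends z y : inc z y -> y = (ends z).1 \/ y = (ends z).2.
Proof.
case: z y => [a z] [b y]; rewrite /inc /= => /andP [/eqP <-].
case: z y => [s|[s o]] [s'|[[s' o'] b']] //=.
  move=> /andP [h /orP [] /eqP e]; [left|right]; congr (_, inl _).
    exact: rk_inj.
  by rewrite /nextt -e unrkK.
by move=> /andP [/eqP <- /eqP <-]; case: b'; [right|left].
Qed.

Lemma inc_links z y : inc z y -> z = (links y).1 \/ z = (links y).2.
Proof.
case: z y => [a z] [b y]; rewrite /inc /= => /andP [/eqP <-].
case: z y => [s|[s o]] [s'|[[s' o'] b']] //=.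
  move=> /andP [h /orP [] /eqP e]; [left|right]; congr (_, inl _).
    exact: rk_inj.
  by rewrite /prevt e unrkK.
by move=> /andP [/eqP <- /eqP <-]; left.
Qed.

Lemma cad_owners c y : cad c y -> y = (owners c).1 \/ y = (owners c).2.
Proof.
case: c y => [a c] [b y]; rewrite /cad /=.
case: c => [[s []]|[[s [[d []] r]] [[]|]]]; case: y => [s'|[[s' o'] []]] //=; rewrite ?sameE.
- by move=> /and3P [/eqP <- /eqP <- _]; left.
- by move=> /andP [/eqP <- /eqP <-]; left.
- move=> /and3P [/eqP <- /eqP <- /eqP e]; right; congr (_, inr (_, _, _)).
  by rewrite -e unrkK.
- case/orP => [/and3P [/eqP <- /eqP <- /eqP <-]|]; first by left.
  by move=> /and4P [/nextE [-> _ _] /eqP -> /eqP <- _]; right.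
- by move=> /and3P [/eqP <- /eqP <- /eqP <-]; left.
- by move=> /and3P [/eqP <- /eqP <- /eqP <-]; left.
- move=> /and3P [/eqP <- /eqP <- /eqP e]; right; congr (_, inr (_, _, _)).
  by rewrite /nextp -e unrkK.
- by move=> /and4P [/eqP <- /eqP <- /eqP <- _]; left.
- by move=> /and3P [/eqP <- /eqP <- /eqP <-]; left.
- by move=> /and3P [/eqP <- /eqP <- /eqP <-]; left.
- move=> /and3P [/eqP <- /eqP <- /eqP e]; right; congr (_, inr (_, _, _)).
  by rewrite /nextp -e unrkK.
Qed.

Lemma cad_coins c y : cad c y -> c = (coins y).1 \/ c = (coins y).2.
Proof.
case: c y => [a c] [b y]; rewrite /cad /=.
case: c => [[s []]|[[s [[d []] r]] [[]|]]]; case: y => [s'|[[s' [[d' ro'] r']] []]] //=; rewrite ?sameE.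
- by move=> /and3P [/eqP <- /eqP <- _]; left.
- by move=> /andP [/eqP <- /eqP <-]; right.
- by move=> /and3P [/eqP <- /eqP <- h]; left; rewrite h.
- case/orP => [/and3P [/eqP <- /eqP <- /eqP [<- <- <-]]|]; first by right.
  case/and4P => /nextE [e1 -> n] /eqP [-> -> ->] /eqP <- nR; right.
  by rewrite (negPf nR) orbF /edge; case: (d) n => /negPf ->.
- by move=> /and3P [/eqP <- /eqP <- /eqP [<- <- <-]]; right.
- by move=> /and3P [/eqP <- /eqP <- /eqP [<- <- <-]]; left.
- move=> /and3P [/eqP <- /eqP <- /eqP e]; left; rewrite e /=; congr (_, inr (_, _, _)).
  by rewrite /prevp e /= unrkK.
- by move=> /and4P [/eqP <- /eqP <- /eqP [<- <- <-]]; rewrite /edge => h; right; rewrite orFb h.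
- by move=> /and3P [/eqP <- /eqP <- /eqP [<- <- <-]]; right.
- by move=> /and3P [/eqP <- /eqP <- /eqP [<- <- <-]]; left.
- move=> /and3P [/eqP <- /eqP <- /eqP e]; left; rewrite e /=; congr (_, inr (_, _, _)).
  by rewrite /prevp e /= unrkK.
Qed.

Lemma coins_neq y : (coins y).1 != (coins y).2.
Proof.
case: y => a [s|[[s [[d role] r]] []]] /=.
- by apply/eqP.
- by case: ifP => _; apply/eqP.
- by case: ifP => _; apply/eqP.
Qed.

Lemma coins_x a s o : coins (a, inr (s, o, false)) =
  ((a, if rk o == 0 then inl (s, false) else inr (s, prevp o, None)),
   (a, inr (s, o, Some false))).
Proof. by case: o => -[]. Qed.

Lemma coins_y1 a s o : (coins (a, inr (s, o, true))).1 = (a, inr (s, o, None)).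
Proof. by case: o => -[]. Qed.

Lemma owners_K a s o : owners (a, inr (s, o, None)) =
  ((a, inr (s, o, true)), (a, inr (s, nextp o, false))).
Proof. by case: o => -[]. Qed.

Lemma owners_P a s o : owners (a, inr (s, o, Some false)) =
  ((a, inr (s, o, false)), (a, inr (s, o, false))).
Proof. by case: o => -[]. Qed.

Lemma prevpK o : rk o != 0 -> (rk (prevp o)).+1 = rk o.
Proof.
rewrite -lt0n => h; rewrite /prevp rkK ?prednK //; exact: ltnW (rk_lt o).
Qed.

(** Listed coins are really incident, except that the first coin of a selection option is subject to
    [U]. *)
Lemma cad_coins1 y : cad (coins y).1 y =
  if y.2 is inl s then U (val y.1.1 == 0) (val y.1.2 == 0) (nth x0 u y.1.1) (nth x0 u y.1.2) s
  else true.
Proof.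
case: y => a [s|[[s [[d role] r]] []]] /=; rewrite /cad /= ?sameE ?eqxx //.
  by case: role.
case: ifP => h /=; rewrite ?sameE ?eqxx ?h //=.
have := prevpK (negbT h); case: (prevp _) => -[d1 []] r1 /= ->;
  by rewrite ?sameE ?eqxx.
Qed.

Lemma cad_coins2 y : cad (coins y).2 y.
Proof.
case: y => a [s|[[s [[d role] r]] []]] /=; rewrite /cad /= ?sameE ?eqxx //.
  case: ifP => h /=.
    by case: role h => /= h; rewrite sameE !eqxx.
  move: h => /norP [nr /norP [ne nR]]; rewrite (negPf nr) !eqxx nR next_pred ?orbT //.
  by move: ne; rewrite /edge; case: (d).
by case: role.
Qed.

Lemma nextto_edge d (a b : cell) :
  nextto d (offset a.1 b.1) (offset a.2 b.2) -> edge d b = false.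
Proof. by move=> /nextE [_ _]; rewrite /edge; case: d => /negPf. Qed.

Lemma tiling_of_resolvable : resolvable inc cad -> tiling.
Proof.
move=> [ch [al cl]].
pose tk y c := if ch y is inr (c1, c2) then c \in [:: c1; c2] else false.
pose sel y := if ch y is inr _ then true else false.
have tk_inj y y' c : tk y c -> tk y' c -> y = y'.
  rewrite /tk; case e: (ch y) => [//|[c1 c2]]; case e': (ch y') => [//|[c3 c4]].
  move=> h1 h2; apply: cl; rewrite e e' /=.
  by move: h1; rewrite !inE => /orP [] /eqP <-; move: h2; rewrite !inE => ->; rewrite ?orbT.
have sel_tk y : sel y -> [/\ tk y (coins y).1, tk y (coins y).2 & cad (coins y).1 y].
  rewrite /sel /tk; have := al y; case: (ch y) => [//|[c c']] /= /and3P [nc h h'] _.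
  have := cad_coins h; have := cad_coins h'; rewrite !inE.
  case=> e' [] e; subst; rewrite ?eqxx ?orbT in nc *; split=> //.
have unsel y : ~~ sel y -> exists2 z, ch y = inl z & inc z y.
  by rewrite /sel; have := al y; case: (ch y) => // z h _; exists z.
have selsome a : exists s, sel (a, inl s).
  case: (pickP (fun s => sel (a, inl s))) => [s h|no]; first by exists s.
  (* If no option took coins, the one of rank 0 would need the link of its own rank, and so would
     each later one, the link below it being taken. But the last option has no link of its own
     rank. *)
  have ind k : forall s, rk s = k -> ch (a, inl s) = inl (a, inl s).
    elim: k => [|k IH] s e; have /negbT/unsel [z ez /inc_links [] zE] := no s; rewrite ez zE //=.
      by rewrite /prevt e /= -e unrkK.
    have ps : rk (prevt s) = k by rewrite /prevt e /= rkK // -ltnS -e ltnW // ltnS rk_lt.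
    have := cl (a, inl s) (a, inl (prevt s)); rewrite ez zE (IH _ ps) /= eqxx.
    by move=> /(_ isT) [es]; move: e; rewrite es ps => /n_Sn.
  have m0 : 0 < #|Tile| by apply/card_gt0P; exists t0.
  have [z ez iz] := unsel _ (negbT (no (unrk t0 #|Tile|.-1))).
  move: ez iz; rewrite (ind _ _ erefl) => -[<-].
  by rewrite /inc /= rkK prednK // ltnn andbF.
have [t ht] := fin_all_exists selsome.
have chain a s : sel (a, inl s) -> forall o, sel (a, inr (s, o, true)).
  move=> sels o; have [k] := ubnP (rk o); elim: k o => // k IH o ok.
  pose x : cell * optK := (a, inr (s, o, false)).
  (* The first coin of the intermediate option is held by the selection or by the previous copy.
     This leaves it only the link that it shares with copy [o], which must therefore take its
     coins. *)
  have takenx : ~~ sel x.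
    have [y ny ty] : exists2 y, y != x & tk y (coins x).1.
      rewrite /x coins_x /=; case: ifP => ro.
        exists (a, inl s); first by apply/eqP => -[].
        by have [_ + _] := sel_tk _ sels.
      exists (a, inr (s, prevp o, true)); first by apply/eqP => -[].
      have [|+ _ _] := sel_tk (a, inr (s, prevp o, true)); last by rewrite coins_y1.
      by apply: IH; rewrite -ltnS prevpK // ro.
    apply: contraNN ny => selx; have [tx _ _] := sel_tk _ selx.
    by apply/eqP; apply: tk_inj ty tx.
  apply: contraT => /unsel [z ez /inc_links zE].
  have [z' ez' /inc_links zE'] := unsel _ takenx.
  have : (a, inr (s, o, true)) = x by apply: cl; rewrite ez ez' /=; case: zE zE' => -> [] ->.
  by [].
(* If [R] failed, the two copies facing each other would hold the same second coin. *)
have constr d (a b : cell) : nextto d (offset a.1 b.1) (offset a.2 b.2) -> R d (t a) (t b).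
  move=> nx; apply: contraT => nR.
  have [_ t1 _] := sel_tk _ (chain _ _ (ht a) (d, true, t b)).
  have [_ t2 _] := sel_tk _ (chain _ _ (ht b) (d, false, t a)).
  have := tk_inj _ _ _ t1; move=> /(_ (b, inr (t b, (d, false, t a), true))).
  suff -> : (coins (a, inr (t a, (d, true, t b), true))).2 =
            (coins (b, inr (t b, (d, false, t a), true))).2 by move=> /(_ t2).
  by rewrite /= (negPf nR) (nextto_edge nx); have [_ <- _] := nextE nx.
exists (fun i j => t (i, j)); split.
- by move=> i j; have [_ _] := sel_tk _ (ht (i, j)); rewrite cad_coins1.
- move=> i j j' e; apply: (constr true (i, j) (i, j')).
  by rewrite /nextto !offset_eqE; apply/andP; split; apply/eqP; rewrite /= ?e.
- move=> i i' j e; apply: (constr false (i, j) (i', j)).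
  by rewrite /nextto !offset_eqE; apply/andP; split; apply/eqP; rewrite /= ?e.
Qed.

Lemma resolvable_of_tiling : tiling -> resolvable inc cad.
Proof.
move=> [t' [hU hH hV]]; pose t (a : cell) := t' a.1 a.2.
have constr d (a b : cell) : nextto d (offset a.1 b.1) (offset a.2 b.2) -> R d (t a) (t b).
  case: a b => [i j] [k l]; rewrite /nextto !offset_eqE.
  case: d => /= /andP [/eqP e1 /eqP e2]; rewrite /t /=.
    by rewrite (val_inj (e1 : val k = val i)); apply: hH.
  by rewrite (val_inj (e2 : val l = val j)); apply: hV.
(* Below the selected tile every option takes the link to the next rank, above it the link to the
   previous rank. *)
pose ch (y : cell * optK) : cell * linkK + (cell * coinK) * (cell * coinK) :=
  match y.2 with
  | inl s => if s == t y.1 then inr (coins y)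
             else inl (y.1, inl (if rk s < rk (t y.1) then s else prevt s))
  | inr (s, o, b) => if (s == t y.1) == b then inr (coins y) else inl (y.1, inr (s, o))
  end.
(* [owner] and [ownerl] recover an option from what it holds, so that no coin or link is held
   twice. *)
pose owner (c : cell * coinK) :=
  let s := match c.2 with inl (s, _) | inr (s, _, _) => s end in
  if s == t c.1 then (owners c).1 else (owners c).2.
pose ownerl (z : cell * linkK) :=
  if match z.2 with inl s => rk s < rk (t z.1) | inr (s, _) => s == t z.1 end
  then (ends z).1 else (ends z).2.
have chl y z : ch y = inl z -> inc z y /\ ownerl z = y.
  case: y => a [s|[[s o] b]]; rewrite /ch /=.
    case: eqVneq => // nst [<-]; rewrite /inc /ownerl /= eqxx.
    case: (ltngtP (rk s) (rk (t a))) => [lt|gt|/rk_inj e]; last by case/eqP: nst.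
      by rewrite /= eqxx lt andbT; split=> //; apply: leq_ltn_trans (rk_lt (t a)).
    have ps : (rk (prevt s)).+1 = rk s.
      rewrite /prevt rkK; first by rewrite prednK //; apply: leq_ltn_trans gt.
      by apply: leq_ltn_trans (rk_lt s); rewrite leq_pred.
    rewrite /= ps eqxx orbT rk_lt /= leqNgt gt /=; split=> //.
    by rewrite /nextt ps unrkK.
  case: eqP => // nb [<-]; rewrite /inc /ownerl /= !eqxx; split=> //.
  by move: nb; case: b; case: (s == t a).
have chr1 y p : ch y = inr p ->
    p = coins y /\ match y.2 with inl s => s = t y.1 | inr (s, o, b) => (s == t y.1) = b end.
  rewrite /ch; case: y => a [s|[[s o] b]].
    by case: ifP => // /eqP est [<-].
  by case: ifP => // /eqP nb [<-].
have chr y p : ch y = inr p ->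
    [/\ p = coins y, cad (coins y).1 y, owner (coins y).1 = y & owner (coins y).2 = y].
  move=> /chr1 [-> cond]; split=> //.
  - by rewrite cad_coins1; case: y cond => a [s|[[s o] b]] //= ->; exact: hU.
  - case: y cond => a [s|[[s o] []]] st; simpl in st.
    + by rewrite /owner /= st eqxx.
    + by rewrite coins_y1 /owner owners_K /= st.
    rewrite coins_x /=; case: ifP => ro; rewrite /owner ?owners_K /= st; congr (_, inr (_, _, _)).
      by rewrite -(eqP ro) unrkK.
    by rewrite /nextp prevpK ?ro // unrkK.
  - case: y cond => a [s|[[s o] []]] st; simpl in st.
    + by rewrite /owner /= st eqxx.
    + case: o => -[d role] r /=; case: ifP => h; rewrite /owner /= ?st //.
    move: h => /norP [nr /norP [ne nR]].
    have nx : nextto d (offset (prev_cell d a).1 a.1) (offset (prev_cell d a).2 a.2).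
      by apply: next_pred; move: ne; rewrite /edge; case: (d).
    have [sE _ _] := nextE nx.
    (* The borrowed coin belongs to tile [r] in the previous cell; if [r] were the tile placed
       there, [R] would hold. *)
    case: eqVneq => [er|_].
      by have := constr _ _ _ nx; rewrite -er -(eqP st) (negPf nR).
    by rewrite -sE (negPf nr).
    by rewrite coins_x /owner owners_P /= st.
exists ch; split=> [y|y y'].
  case e: (ch y) => [z|p]; first by have [] := chl _ _ e.
  have [-> h _ _] := chr _ _ e; case cE: (coins y) => [c c'].
  have := coins_neq y; have := cad_coins2 y; rewrite cE /= => -> ->.
  by rewrite cE in h; rewrite h.
case e: (ch y) => [z|[c1 c2]]; case e': (ch y') => [z'|[c3 c4]] //=.
  by move=> /eqP ez; subst z'; have [_ <-] := chl _ _ e; have [_ ->] := chl _ _ e'.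
have [p1 _ o1 o2] := chr _ _ e; have [p2 _ o3 o4] := chr _ _ e'.
rewrite -p1 /= in o1 o2; rewrite -p2 /= in o3 o4.
by rewrite !inE => /orP [] /orP [] /eqP ec; subst; congruence.
Qed.

Lemma card_le_seq (T : finType) (A : {set T}) (l : seq T) :
  (forall x, x \in A -> x \in l) -> #|A| <= size l.
Proof.
by move=> h; apply: leq_trans (card_size l); apply/subset_leq_card/subsetP.
Qed.

Lemma gadget_degS s : #|[set t | gadget inc cad s t]| <= 4.
Proof.
case: s => [[z|z]|c].
- apply: leq_trans (card_le_seq (l := [:: inl (ends z).1; inl (ends z).2; inr (inl (inl z))]) _) _ => //.
  case=> [y|[[z'|z']|c']]; rewrite !inE //=; last by move=> /eqP ->; rewrite eqxx.
  by move=> /inc_ends [] ->; rewrite eqxx ?orbT.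
- apply: leq_trans (card_le_seq (l := [:: inr (inl (inl z)); inr (inl (inr z))]) _) _ => //.
  by case=> [y|[[z'|z']|c']]; rewrite !inE //= => /eqP ->; rewrite eqxx ?orbT.
- apply: leq_trans (card_le_seq (l := [:: inl (owners c).1; inl (owners c).2; inr (inr c)]) _) _ => //.
  case=> [y|[[z'|z']|c']]; rewrite !inE //=; last by move=> /eqP ->; rewrite eqxx.
  by move=> /cad_owners [] ->; rewrite eqxx ?orbT.
Qed.

(** Only options can reach 4, with two links and two coins. *)
Lemma gadget_degT t : #|[set s | gadget inc cad s t]| <= 4.
Proof.
case: t => [y|[[z|z]|c]].
- apply: leq_trans (card_le_seq (l := [:: inl (inl (links y).1); inl (inl (links y).2); inr (coins y).1; inr (coins y).2]) _) _ => //.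
  case=> [[z'|z']|c']; rewrite !inE //=.
    by move=> /inc_links [] ->; rewrite eqxx ?orbT.
  by move=> /cad_coins [] ->; rewrite eqxx ?orbT.
- apply: leq_trans (card_le_seq (l := [:: inl (inl z); inl (inr z)]) _) _ => //.
  by case=> [[z'|z']|c']; rewrite !inE //= => /eqP ->; rewrite eqxx ?orbT.
- apply: leq_trans (card_le_seq (l := [:: inl (inr z)]) _) _ => //.
  by case=> [[z'|z']|c']; rewrite !inE //= => /eqP ->; rewrite eqxx ?orbT.
- apply: leq_trans (card_le_seq (l := [:: inr c]) _) _ => //.
  by case=> [[z'|z']|c']; rewrite !inE //= => /eqP ->; rewrite eqxx ?orbT.
Qed.

(** The gadget lives on sums of node sorts, whereas the matrix is numbered cell by cell; [splitS]
    and [splitT] move the cell inside the sum. *)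
Definition splitS (s : cell * snode) : cell * linkK + cell * linkK + cell * coinK :=
  match s.2 with
  | inl (inl z) => inl (inl (s.1, z))
  | inl (inr z) => inl (inr (s.1, z))
  | inr c => inr (s.1, c)
  end.

Definition splitT (t : cell * tnode) :
    cell * optK + (cell * linkK + cell * linkK + cell * coinK) :=
  match t.2 with
  | inl y => inl (t.1, y)
  | inr (inl (inl z)) => inr (inl (inl (t.1, z)))
  | inr (inl (inr z)) => inr (inl (inr (t.1, z)))
  | inr (inr c) => inr (inr (t.1, c))
  end.

Lemma splitS_bij : bijective splitS.
Proof.
exists (fun s => match s with
  | inl (inl (a, z)) => (a, inl (inl z))
  | inl (inr (a, z)) => (a, inl (inr z))
  | inr (a, c) => (a, inr c)
  end); first by case=> a [[z|z]|c].
by case=> [[[a z]|[a z]]|[a c]].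
Qed.

Lemma splitT_bij : bijective splitT.
Proof.
exists (fun t => match t with
  | inl (a, y) => (a, inl y)
  | inr (inl (inl (a, z))) => (a, inr (inl (inl z)))
  | inr (inl (inr (a, z))) => (a, inr (inl (inr z)))
  | inr (inr (a, c)) => (a, inr (inr c))
  end); first by case=> a [y|[[z|z]|c]].
by case=> [[a y]|[[[a z]|[a z]]|[a c]]].
Qed.

Lemma adjKE (a b : cell) s t :
  adjK (val a.1 == 0) (val a.2 == 0) (nth x0 u a.1) (nth x0 u a.2)
    (offset a.1 b.1) (offset a.2 b.2) s t
  = gadget inc cad (splitS (a, s)) (splitT (b, t)).
Proof.
by case: s t => [[z|z]|c] [y|[[z'|z']|c']]; rewrite /adjK //= ?andbF // sameE.
Qed.

End Template.

(** * A small programming language for multitape machines *)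

Definition dz (m : move) : int :=
  match m with MoveLeft => (- 1)%R | Stay => 0%R | MoveRight => 1%R end.

Definition get (G : Type) (u : seq G) (z : int) : option G :=
  if z is Posz n then nth None (map Some u) n else None.

Arguments get : simpl never.

Section Programs.
Variables (G Q X : finType).

Definition store : Type := (X -> seq G) * (X -> int).
Definition reading (s : store) : {ffun X -> option G} :=
  [ffun x => get (s.1 x) (s.2 x)].
Definition ops : Type := X -> option G * move.

(* Writing only ever appends a letter to the word on a tape. *)
Definition applies (o : ops) (s s' : store) : Prop :=
  forall x, [/\ if (o x).1 is Some a then
                  s.2 x = Posz (size (s.1 x)) /\ s'.1 x = rcons (s.1 x) a
                else s'.1 x = s.1 x
            & s'.2 x = (s.2 x + dz (o x).2)%R].

Inductive prog :=
  | Act of (Q -> {ffun X -> option G} -> Q * ops)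
  | Seq of prog & prog
  | While of (Q -> {ffun X -> option G} -> bool) & prog.

(** Sequencing is free, since the last action of the first program jumps to the entry of the second.
    A loop test is a machine step of its own, in which nothing is written or moved. *)
Inductive exec : prog -> Q * store -> nat -> Q * store -> Prop :=
  | ExecAct f q s s' : applies (f q (reading s)).2 s s' ->
      exec (Act f) (q, s) 1 ((f q (reading s)).1, s')
  | ExecSeq p p' c n c' n' c'' :
      exec p c n c' -> exec p' c' n' c'' -> exec (Seq p p') c (n + n') c''
  | ExecStop (b : Q -> {ffun X -> option G} -> bool) p q s s' : ~~ b q (reading s) ->
      s'.1 =1 s.1 -> s'.2 =1 s.2 -> exec (While b p) (q, s) 1 (q, s')
  | ExecLoop (b : Q -> {ffun X -> option G} -> bool) p q s n c n' c' : b q (reading s) ->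
      exec p (q, s) n c -> exec (While b p) c n' c' ->
      exec (While b p) (q, s) (n + n').+1 c'.

(** Control points; the [None] of a loop is its test. In [option (pos p)], [None] means that [p] has
    ended. *)
Fixpoint pos (p : prog) : finType :=
  match p with
  | Act _ => unit
  | Seq p p' => (pos p + pos p')%type
  | While _ p => option (pos p)
  end.

Fixpoint entry (p : prog) : pos p :=
  match p with
  | Act _ => tt
  | Seq p _ => inl (entry p)
  | While _ _ => None
  end.

Definition idle : ops := fun=> (None, Stay).

Fixpoint trans (p : prog) : pos p -> Q -> {ffun X -> option G} -> option (pos p) * (Q * ops) :=
  match p with
  | Act f => fun _ q r => (None, f q r)
  | Seq p p' => fun l q r =>
    match l with
    | inl a => let: (l', c) := trans a q r in
               (Some (if l' is Some a' then inl a' else inr (entry p')), c)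
    | inr b => let: (l', c) := trans b q r in (omap inr l', c)
    end
  | While b p => fun l q r =>
    match l with
    | None => (if b q r then Some (Some (entry p)) else None, (q, idle))
    | Some a => let: (l', c) := trans a q r in (Some l', c)
    end
  end.

Inductive goes (p : prog) : option (pos p) -> Q * store -> nat ->
    option (pos p) -> Q * store -> Prop :=
  | Goes0 l c : goes l c 0 l c
  | GoesS l q s s' n l' c' :
      applies (trans l q (reading s)).2.2 s s' ->
      goes (trans l q (reading s)).1 ((trans l q (reading s)).2.1, s') n l' c' ->
      goes (Some l) (q, s) n.+1 l' c'.

Lemma goes_trans p (l l' l'' : option (pos p)) c c' c'' n n' :
  goes l c n l' c' -> goes l' c' n' l'' c'' -> goes l c (n + n') l'' c''.
Proof. by elim=> // {}l q s s' m {}l' {}c' ap _ IH h; apply: GoesS ap (IH h). Qed.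

(** Embeds a run of a subprogram in the enclosing program; [f None] is where control continues once
    the subprogram has ended. *)
Lemma goes_map p p' (f : option (pos p) -> option (pos p')) :
  (forall l q r, exists2 a, f (Some l) = Some a &
     trans a q r = (f (trans l q r).1, (trans l q r).2)) ->
  forall l c n l' c', goes l c n l' c' -> goes (f l) c n (f l') c'.
Proof.
move=> hf l c n l' c'; elim=> [*|{}l q s s' m {}l' {}c' ap _ IH]; first exact: Goes0.
have [a -> e] := hf l q (reading s).
by apply: (@GoesS _ _ _ _ s'); rewrite e.
Qed.

Lemma idleP s : applies idle s s.
Proof. by move=> x; split=> //=; rewrite GRing.addr0. Qed.

Lemma exec_goes p c n c' : exec p c n c' -> goes (Some (entry p)) c n None c'.
Proof.
elim=> {p c n c'} [f q s s' ap|p p' c n c' n' c'' _ IH _ IH'|b p q s s' nb e1 e2|b p q s n c n' c' hb _ IH _ IH'].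
- by apply: (@GoesS (Act f) tt) => //=; exact: Goes0.
- pose f (l : option (pos p)) : option (pos (Seq p p')) :=
    Some (if l is Some a then inl a else inr (entry p')).
  have fP l q r : exists2 a, f (Some l) = Some a &
      trans a q r = (f (trans l q r).1, (trans l q r).2).
    by exists (inl l) => //=; case: (trans l q r).
  pose g (l : option (pos p')) : option (pos (Seq p p')) := omap inr l.
  have gP l q r : exists2 a, g (Some l) = Some a &
      trans a q r = (g (trans l q r).1, (trans l q r).2).
    by exists (inr l) => //=; case: (trans l q r).
  exact: goes_trans (goes_map fP IH) (goes_map gP IH').
- apply: (@GoesS (While b p) None _ _ s').
    by move=> x; rewrite /= GRing.addr0.
  by rewrite /= (negPf nb); exact: Goes0.
- apply: (@GoesS (While b p) None _ _ s); first exact: idleP.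
  rewrite /= hb.
  pose f (l : option (pos p)) : option (pos (While b p)) := Some l.
  have fP l q' r : exists2 a, f (Some l) = Some a &
      trans a q' r = (f (trans l q' r).1, (trans l q' r).2).
    by exists (Some l) => //=; case: (trans l q' r).
  exact: goes_trans (goes_map fP IH) IH'.
Qed.

End Programs.

Lemma run_stable (M : machine) w n m :
  halting (@run M w n).1 -> n <= m -> run w m = run w n.
Proof.
move=> h /subnK <-; rewrite /run iterD.
by elim: (m - n) => //= k ->; rewrite /step h.
Qed.

(** * Compilation of programs to multitape machines *)

Section Simulation.
Variables (G Q X : finType) (k : nat) (enc : X -> 'I_k.+1) (dec : 'I_k.+1 -> X).
Hypothesis encK : cancel enc dec.
Variables (p : prog G Q X) (q0 : Q) (acc : pred Q).

Definition compile : machine :=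
  @Machine k (option G) None (Q * option (pos p))%type (q0, Some (entry p))
    (fun c => c.2 == None) (fun c => acc c.1)
    (fun c r =>
       if c.2 is Some l then
         let t := trans l c.1 [ffun x => r (enc x)] in
         (((t.2.1, t.1)),
          [ffun i => if (t.2.2 (dec i)).1 is Some a then Some a else r i],
          fun i => (t.2.2 (dec i)).2)
       else (c, r, fun=> Stay)).

(** Blanks may or may not be listed on a half tape, so letters are compared position by position and
    not as lists. *)
Definition represents (t : tape compile) (u : seq G) (z : int) : Prop :=
  (forall n : nat, nth None t.2 n = get u (z + n%:Z)%R) /\
  (forall n : nat, nth None t.1 n = get u (z - n.+1%:Z)%R).

Lemma represents_shift t u z m : represents t u z ->
  represents (shift m t) u (z + dz m)%R.
Proof.
move=> [hr hl]; case: t hr hl => l r /= hr hl; case: m; split=> n /=.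
- by case: n => [|n] /=; rewrite -?nth0 ?hl ?hr; congr get; lia.
- by rewrite nth_behead hl; congr get; lia.
- by rewrite hr; congr get; lia.
- by rewrite hl; congr get; lia.
- by rewrite nth_behead hr; congr get; lia.
- by case: n => [|n] /=; rewrite /read -?nth0 ?hl ?hr; congr get; lia.
Qed.

Lemma get_rcons (u : seq G) a z :
  get (rcons u a) z = if z == size u then Some a else get u z.
Proof.
rewrite /get; case: z => //= n; rewrite map_rcons nth_rcons size_map.
case: (ltngtP n (size u)) => h; last by rewrite h eqxx.
  by rewrite (_ : (_ == _) = false) //; lia.
by rewrite (_ : (_ == _) = false) ?nth_default ?size_map //; lia.
Qed.

Lemma represents_write t u (a : G) : represents t u (size u) ->
  represents (write (Some a : symbol compile) t) (rcons u a) (size u).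
Proof.
move=> [hr hl]; split=> n /=; rewrite get_rcons.
  case: n => [|n] /=; first by rewrite GRing.addr0 eqxx.
  by rewrite nth_behead hr ifF //; lia.
by rewrite hl ifF //; lia.
Qed.

Lemma represents_rewrite t u z : represents t u z ->
  represents (write (read t) t) u z.
Proof.
move=> [hr hl]; split=> n /=; last exact: hl.
by rewrite -hr; case: n => [|n] /=; rewrite /read ?nth_behead // -nth0.
Qed.

Definition mirrors (c : config compile) (l : option (pos p)) (d : Q * store G X) : Prop :=
  c.1 = (d.1, l) /\ forall x, represents (c.2 (enc x)) (d.2.1 x) (d.2.2 x).

Lemma goes_run l d n l' d' c : goes l d n l' d' -> mirrors c l d ->
  mirrors (iter n (@step compile) c) l' d'.
Proof.
move=> h; elim: h c => [//|{}l q s s' i {}l' {}d' ap _ IH] c [cE cr].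
rewrite iterSr; apply: IH.
have rE : [ffun x => [ffun i => read (c.2 i)] (enc x)] = reading s.
  apply/ffunP => x; rewrite !ffunE; have [hr _] := cr x.
  by rewrite -[s.2 x]GRing.addr0 -hr /read -nth0.
rewrite /step cE /= rE; split=> //= x; have [] := ap x.
rewrite encK ffunE encK; case: (trans l q _).2.2 => -[a|] m /=.
  move=> [e ->] ->; apply: represents_shift; rewrite e.
  by apply: represents_write; rewrite -e.
by move=> -> ->; apply: represents_shift; rewrite ffunE; apply: represents_rewrite.
Qed.

Lemma exec_run (tin : X) w n q' s' m : enc tin = ord0 ->
  exec p (q0, (fun x => if x == tin then w else [::], fun=> 0%R)) n (q', s') ->
  n <= m ->
  let c := run (M := compile) (map Some w) m in
  [/\ halting c.1, accepting c.1 = acc q' &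
      forall x, represents (c.2 (enc x)) (s'.1 x) (s'.2 x)].
Proof.
move=> e0 /exec_goes h nm.
have m0 : mirrors (init (map Some w : seq (symbol compile))) (Some (entry p))
    (q0, (fun x => if x == tin then w else [::], fun=> 0%R)).
  split=> // x; rewrite /= -e0 (can_eq encK); case: eqP => _; split=> i /=;
  by rewrite /get GRing.add0r /= ?nth_nil.
have [cE cr] := goes_run h m0.
have hn : halting (run (M := compile) (map Some w) n).1 by rewrite cE.
by rewrite /= (run_stable hn nm) cE.
Qed.

Lemma represents_outputs B (code : B -> G) (v : seq B) (c : config compile) y :
  enc y = ord_max -> represents (c.2 (enc y)) (map code v) 0 ->
  outputs (fun b => Some (code b) : symbol compile) c v.
Proof.
move=> ey [hr _]; rewrite /outputs -ey; set r := (c.2 _).2 in hr *.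
(* The listed part cannot stop inside [v]: a blank would be read there, and [v] contains none. *)
have sr : size v <= size r.
  rewrite leqNgt; apply/negP => lt; have := hr (size r).
  rewrite nth_default // GRing.add0r /get => e.
  have : nth None (map Some (map code v)) (size r) \in map Some (map code v).
    by rewrite mem_nth // !size_map.
  by rewrite -e => /mapP [].
exists (drop (size v) r).
  rewrite -[LHS](cat_take_drop (size v)); congr (_ ++ _).
  apply: (@eq_from_nth _ None); rewrite size_takel ?size_map // => i iv.
  rewrite nth_take // hr GRing.add0r /get.
  by rewrite -map_comp.
by rewrite -nth0 nth_drop addn0 hr GRing.add0r /get nth_default // !size_map.
Qed.

End Simulation.

(** * Loops, emission and rewinding, with time bounds *)

Section Combinators.
Variables (G Q X : finType).
Implicit Types (s : store G X) (p : prog G Q X) (O : pred X) (d : X -> move).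

(** Stores are pairs of functions, so runs are compared up to pointwise equality; [exec_extl] and
    [exec_extr] show that [exec] respects it. *)
Definition same_store s s' : Prop := s.1 =1 s'.1 /\ s.2 =1 s'.2.

Lemma reading_ext s s' : same_store s s' -> reading s = reading s'.
Proof. by move=> [e1 e2]; apply/ffunP => x; rewrite !ffunE e1 e2. Qed.

Lemma exec_extr p c n q s s' : exec p c n (q, s) -> same_store s s' ->
  exec p c n (q, s').
Proof.
move=> h; move: {1 2}(q, s) h (erefl (q, s)) => c' h; elim: h q s s' => {p c n c'}.
- move=> f q s s' ap q2 s2 s3 [<- <-] [e1 e2]; apply: ExecAct => x.
  by have := ap x; rewrite -e1 -e2.
- by move=> p p' c n c' n' c'' h _ _ IH q s s' e1 e2; apply: ExecSeq h (IH _ _ _ e1 e2).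
- move=> b p q s s' nb e1 e2 q2 s2 s3 [<- <-] [e3 e4].
  by apply: ExecStop => // x; rewrite -?e3 -?e4.
- by move=> b p q s n c n' c' hb h _ _ IH q2 s2 s3 e1 e2; apply: ExecLoop hb h (IH _ _ _ e1 e2).
Qed.

Lemma exec_extl p q s s' n c : exec p (q, s) n c -> same_store s s' ->
  exec p (q, s') n c.
Proof.
move=> h; move: {1 2}(q, s) h (erefl (q, s)) => c' h; elim: h q s s' => {p c n c'}.
- move=> f q s s' ap q2 s2 s3 [qe es] ee; subst q2 s2.
  rewrite (reading_ext ee) in ap *; apply: ExecAct => x.
  by have := ap x; rewrite (ee.1 x) (ee.2 x).
- by move=> p p' c n c' n' c'' _ IH h _ q s s' e1 e2; apply: ExecSeq (IH _ _ _ e1 e2) h.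
- move=> b p q s s' nb e1 e2 q2 s2 s3 [qe es] ee; subst q2 s2.
  apply: ExecStop; first by rewrite -(reading_ext ee).
    by move=> x; rewrite e1 (ee.1 x).
  by move=> x; rewrite e2 (ee.2 x).
- move=> b p q s n c n' c' hb _ IH h _ q2 s2 s3 [qe es] ee; subst q2 s2.
  by apply: ExecLoop (IH _ _ _ erefl ee) h; rewrite -(reading_ext ee).
Qed.

Definition runs p (c : Q * store G X) (B : nat) (c' : Q * store G X) : Prop :=
  exists2 n, n <= B & exec p c n c'.

Lemma runs_ext p q s B q' s' t t' : runs p (q, s) B (q', s') ->
  same_store s t -> same_store s' t' -> runs p (q, t) B (q', t').
Proof.
by move=> [n nB h] e e'; exists n => //; apply: exec_extl e; apply: exec_extr h e'.
Qed.

Lemma runs_extr p c B q' s' t' : runs p c B (q', s') ->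
  same_store s' t' -> runs p c B (q', t').
Proof. by case: c => q s h e; apply: runs_ext h _ e. Qed.

Lemma runs_le p c B B' c' : runs p c B c' -> B <= B' -> runs p c B' c'.
Proof. by move=> [n nB h] BB; exists n => //; apply: leq_trans BB. Qed.

Lemma runs_act f q s q' s' : (f q (reading s)).1 = q' ->
  applies (f q (reading s)).2 s s' -> runs (Act f) (q, s) 1 (q', s').
Proof. by move=> <- h; exists 1%N => //; apply: ExecAct. Qed.

Lemma runs_seq p p' c c' c'' B B' : runs p c B c' -> runs p' c' B' c'' ->
  runs (Seq p p') c (B + B') c''.
Proof.
by move=> [n nB h] [n' nB' h']; exists (n + n'); [exact: leq_add|exact: ExecSeq h h'].
Qed.

Lemma runs_stop (b : Q -> {ffun X -> option G} -> bool) p q s :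
  ~~ b q (reading s) -> runs (While b p) (q, s) 1 (q, s).
Proof. by move=> h; exists 1%N => //; apply: ExecStop. Qed.

Lemma runs_loop (b : Q -> {ffun X -> option G} -> bool) p q s c c' B B' :
  b q (reading s) -> runs p (q, s) B c -> runs (While b p) c B' c' ->
  runs (While b p) (q, s) (B + B').+1 c'.
Proof.
move=> hb [n nB h] [n' nB' h']; exists (n + n').+1; last exact: ExecLoop hb h h'.
by rewrite ltnS leq_add.
Qed.

(** [k] is an integer because rewinding overshoots to position -1. *)
Definition mvs d (k : int) s : store G X := (s.1, fun x => (s.2 x + k * dz (d x))%R).

Lemma mvs_store (V : X -> seq G) (h h' : X -> int) d k :
  (forall x, h' x = (h x + k * dz (d x))%R) -> same_store (V, h') (mvs d k (V, h)).
Proof. by []. Qed.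

Definition app O (v : seq G) s : store G X :=
  (fun x => if O x then s.1 x ++ v else s.1 x,
   fun x => if O x then (s.2 x + (size v)%:Z)%R else s.2 x).

(** Quantifying over the text [v0] already written makes emission composable: apart from appending
    [v], the program restores control state, words and heads. *)
Definition Emits q p s O v B : Prop :=
  forall v0, runs p (q, app O v0 s) B (q, app O (v0 ++ v) s).

Definition at_end O s : Prop := forall x, O x -> s.2 x = size (s.1 x).

Definition Move d : prog G Q X := Act (fun q _ => (q, fun x => (None, d x))).

Definition Emit O (g : {ffun X -> option G} -> G) : prog G Q X :=
  Act (fun q r => (q, fun x => if O x then (Some (g r), MoveRight) else (None, Stay))).

Definition seqs (l : seq (prog G Q X)) : prog G Q X :=
  foldr (@Seq G Q X) (Move (fun=> Stay)) l.

Definition back (m : move) :=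
  match m with MoveLeft => MoveRight | Stay => Stay | MoveRight => MoveLeft end.

Definition on (t : X) (_ : Q) (r : {ffun X -> option G}) : bool := r t != None.

(** The way back is measured on [t] alone: one step back from the end, on to the blank before the
    word, and one step forward. The other heads of [d] move in parallel and so return as well, even
    if they have left their words. *)
Definition For t d p : prog G Q X :=
  Seq (While (on t) (Seq p (Move d)))
    (Seq (Move (back \o d)) (Seq (While (on t) (Move (back \o d))) (Move d))).

Definition only t (m : move) : X -> move := fun x => if x == t then m else Stay.

Definition Rewind t : prog G Q X :=
  let d := only t MoveRight in
  Seq (Move (back \o d)) (Seq (While (on t) (Move (back \o d))) (Move d)).

Lemma dz_back m : dz (back m) = (- dz m)%R.
Proof. by case: m. Qed.

Lemma get_in (u : seq G) (k : nat) : (get u k != None) = (k < size u).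
Proof.
rewrite /get; case: (ltnP k (size u)) => h; last by rewrite nth_default ?size_map.
have : nth None (map Some u) k \in map Some u by rewrite mem_nth // size_map.
by case/mapP => x _ ->.
Qed.

Lemma get_neg (u : seq G) : get u (- 1)%R = None.
Proof. by []. Qed.

Lemma runs_move d q s s' : s.1 =1 s'.1 ->
  (forall x, s'.2 x = (s.2 x + dz (d x))%R) -> runs (Move d) (q, s) 1 (q, s').
Proof. by move=> e1 e2; apply: runs_act => // x; rewrite /= e1 e2. Qed.

(** A head at the end of its word reads a blank whatever the word is, so the text emitted so far
    cannot influence the run. *)
Lemma reading_app O v s : at_end O s -> reading (app O v s) = reading s.
Proof.
move=> h; apply/ffunP => x; rewrite !ffunE /=; case: ifP => // Ox; rewrite (h x Ox).
have e1 : get (s.1 x) (size (s.1 x)) = None by apply/eqP; have := get_in (s.1 x) (size (s.1 x)); rewrite ltnn => /negbFE.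
rewrite e1; apply/eqP; have := get_in (s.1 x ++ v) (size (s.1 x ++ v)).
by rewrite ltnn size_cat => /negbFE; rewrite PoszD.
Qed.

Lemma Emits_emit q O g s : at_end O s -> Emits q (Emit O g) s O [:: g (reading s)] 1.
Proof.
move=> h v0; apply: runs_act => // x; rewrite (reading_app _ h) /=.
case: ifP => /= Ox; last by rewrite GRing.addr0.
by rewrite -cats1 -catA !size_cat (h x Ox) /=; split; [split=> //|]; lia.
Qed.

Lemma Emits_seq q p p' s O v v' B B' : Emits q p s O v B -> Emits q p' s O v' B' ->
  Emits q (Seq p p') s O (v ++ v') (B + B').
Proof. by move=> h h' v0; apply: runs_seq (h v0) _; rewrite catA; exact: h'. Qed.

Lemma Emits_seqs (I : eqType) q (f : I -> prog G Q X) s O (F : I -> seq G) B (l : seq I) :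
  (forall i, i \in l -> Emits q (f i) s O (F i) B) ->
  Emits q (seqs (map f l)) s O (flatten (map F l)) (size l * B + 1).
Proof.
elim: l => [|i l IH] h.
  move=> v0; rewrite cats0; apply: runs_move => // x; by rewrite /= GRing.addr0.
rewrite [size _ * _ + _]/= mulSn -addnA; apply: Emits_seq; first by apply: h; rewrite mem_head.
by apply: IH => j jl; apply: h; rewrite inE jl orbT.
Qed.

Lemma runs_back t d q s k (W := size (s.1 t)) : s.2 t = 0%R -> d t = MoveRight ->
  k <= W ->
  runs (While (on t) (Move (back \o d))) (q, mvs d (k%:Z - 1)%R s) (k * 2 + 1)
       (q, mvs d (- 1)%R s).
Proof.
move=> s0 dt; elim: k => [|k IH] kW.
  by rewrite GRing.sub0r; apply: runs_stop; rewrite /on ffunE /= s0 dt get_neg.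
rewrite (_ : k.+1 * 2 + 1 = (1 + (k * 2 + 1)).+1); last by lia.
apply: runs_loop (IH (ltnW kW)).
  rewrite /on ffunE /= s0 dt /= (_ : (_ + _)%R = Posz k); last by lia.
  by rewrite get_in.
apply: runs_move => // x /=; rewrite dz_back; lia.
Qed.

(** Each letter costs [B], a test and a move on the way out, a test and a move on the way back. The
    final 4 consists of the two failing tests and the two single moves that follow them. *)
Lemma Emits_For q t d p s O (F : nat -> seq G) B (W := size (s.1 t)) :
  s.2 t = 0%R -> d t = MoveRight -> (forall x, O x -> d x = Stay) ->
  (forall k, k < W -> Emits q p (mvs d k s) O (F k) B) ->
  Emits q (For t d p) s O (flatten (map F (iota 0 W))) (W * (B + 4) + 4).
Proof.
move=> s0 dt dO body v0.
have nOt : O t = false by apply/negP => /dO; rewrite dt.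
have appm v k : same_store (app O v (mvs d k s)) (mvs d k (app O v s)).
  split=> x //=; case: ifP => // Ox; rewrite (dO x Ox) /=; lia.
(* [k] counts the letters still ahead, so the head stands at [W - k]. *)
have loop k : k <= W -> forall v, runs (While (on t) (Seq p (Move d)))
   (q, app O v (mvs d (Posz (W - k)) s)) (k * (B + 2) + 1)
   (q, app O (v ++ flatten (map F (iota (W - k) k))) (mvs d W s)).
  elim: k => [|k IH] kW v.
    rewrite subn0 cats0; apply: runs_stop.
    rewrite /on ffunE /= nOt s0 dt /= (_ : (_ + _)%R = Posz W); last by lia.
    by rewrite get_in ltnn.
  rewrite (_ : k.+1 * (B + 2) + 1 = ((B + 1) + (k * (B + 2) + 1)).+1); last by lia.
  have ik : iota (W - k.+1) k.+1 = (W - k.+1) :: iota (W - k) k.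
    by rewrite /= subnSK.
  rewrite ik /= catA; apply: runs_loop (IH (ltnW kW) _).
    rewrite /on ffunE /= nOt s0 dt /= (_ : (_ + _)%R = Posz (W - k.+1)); last by lia.
    by rewrite get_in /W; lia.
  apply: runs_seq; first by apply: body; lia.
  apply: runs_move => // x /=; case: ifP => [Ox|_]; first by rewrite (dO x Ox) /=; lia.
  by case: (d x) => /=; lia.
set v := v0 ++ _.
rewrite (_ : W * (B + 4) + 4 = (W * (B + 2) + 1) + (1 + ((W * 2 + 1) + 1))); last by lia.
apply: runs_seq.
  have := loop W (leqnn _) v0; rewrite subnn => h; apply: runs_ext h _ _.
    by split=> x //=; case: ifP; rewrite ?GRing.mul0r ?GRing.addr0.
  by split.
set s1 := app O v s.
have h1 : s1.2 t = 0%R by rewrite /= nOt.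
have h2 : size (s1.1 t) = W by rewrite /= nOt.
apply: (@runs_seq _ _ _ (q, mvs d (W%:Z - 1)%R s1)).
  apply: runs_move => x /=; first by [].
  rewrite dz_back; case: ifP => [Ox|_]; first by rewrite (dO x Ox) /=; rewrite -/v; lia.
  by case: (d x) => /=; lia.
apply: (@runs_seq _ _ _ (q, mvs d (- 1)%R s1)).
  by have := @runs_back t d q s1 W h1 dt; rewrite h2; apply.
by apply: runs_move => x //=; case: (d x) => /=; lia.
Qed.

Lemma runs_Rewind t q s s' : (0 <= s.2 t <= (size (s.1 t))%:Z)%R ->
  s.1 =1 s'.1 -> (forall x, s'.2 x = if x == t then 0%R else s.2 x) ->
  runs (Rewind t) (q, s) (size (s.1 t) * 2 + 3) (q, s').
Proof.
case: s => u h /=; case e: (h t) => [k|//] kW e1 e2.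
pose s0 : store G X := (u, fun x => if x == t then 0%R else h x).
rewrite /Rewind; set d := only t MoveRight.
have dd x : dz (d x) = if x == t then 1%R else 0%R by rewrite /d /only; case: eqP.
apply: (@runs_le _ _ (1 + ((k * 2 + 1) + 1))); last by lia.
apply: (@runs_seq _ _ _ (q, mvs d (k%:Z - 1)%R s0)).
  apply: runs_move => x //=; rewrite dz_back dd; case: eqP => [->|_]; rewrite ?e; lia.
apply: (@runs_seq _ _ _ (q, mvs d (- 1)%R s0)).
  by apply: runs_back; rewrite /= ?eqxx // /d /only eqxx.
apply: runs_move => x /=; first by rewrite -e1.
by rewrite e2 dd; case: eqP => _; lia.
Qed.

End Combinators.

(** * Closure properties of polynomial bounds *)

Definition polyb (f : nat -> nat) : Prop :=
  exists a d, forall n, f n <= poly_bound a d n.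

(** The factor 2 is for [n = 0], where raising the exponent from 0 turns [0 ^ 0 = 1] into 0. *)
Lemma poly_bound_mono a a' d d' n : a <= a' -> d <= d' -> 
  poly_bound a d n <= 2 * poly_bound a' d' n.
Proof.
move=> aa dd; rewrite /poly_bound.
case: n => [|n].
  have h0 : 0 ^ d <= 1 by case: (d) => // d0; rewrite exp0n.
  by have := leq_mul (leqnn a) h0; lia.
have h1 : n.+1 ^ d <= n.+1 ^ d' by rewrite leq_pexp2l.
have : a * n.+1 ^ d <= a' * n.+1 ^ d' by exact: leq_mul.
by lia.
Qed.

Lemma polyb_le f g : polyb g -> (forall n, f n <= g n) -> polyb f.
Proof. by move=> [a [d h]] le; exists a, d => n; apply: leq_trans (le n) (h n). Qed.

Lemma polyb_const c : polyb (fun=> c).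
Proof. by exists c, 0 => n; rewrite /poly_bound; lia. Qed.

Lemma polyb_id : polyb id.
Proof. by exists 1, 1 => n; rewrite /poly_bound; lia. Qed.

Lemma polyb_add f g : polyb f -> polyb g -> polyb (fun n => f n + g n).
Proof.
move=> [a [d hf]] [b [e hg]]; exists (4 * (a + b)), (d + e) => n.
have := poly_bound_mono (a := a) (a' := a + b) (d := d) (d' := d + e) n (leq_addr _ _) (leq_addr _ _).
have := poly_bound_mono (a := b) (a' := a + b) (d := e) (d' := d + e) n (leq_addl _ _) (leq_addl _ _).
move: (hf n) (hg n); set x := poly_bound a d n; set y := poly_bound b e n.
rewrite /poly_bound -mulnA; set z := (a + b) * _; lia.
Qed.

Lemma polyb_mul f g : polyb f -> polyb g -> polyb (fun n => f n * g n).
Proof.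
move=> [a [d hf]] [b [e hg]].
apply: (@polyb_le _ (fun n => poly_bound a d n * poly_bound b e n)); last by move=> n; apply: leq_mul.
apply: (@polyb_le _ (fun n => (poly_bound (a * b) (d + e) n + poly_bound (a * b) d n) + poly_bound (a * b) e n)).
  have pb a' d' : polyb (fun n => poly_bound a' d' n) by exists a', d'.
  by apply: polyb_add; [apply: polyb_add|].
by move=> n; rewrite /poly_bound expnD; move: (n ^ d) (n ^ e) => x y; nia.
Qed.

Lemma polyb_exp f k : polyb f -> polyb (fun n => f n ^ k).
Proof.
move=> h; elim: k => [|k IH]; first exact: polyb_const.
apply: (@polyb_le _ (fun n => f n * f n ^ k)); first exact: polyb_mul.
by move=> n; rewrite expnS.
Qed.

(** * Filling tapes with words of polynomial length *)

Section Fill.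
Variables (G Q X : finType) (q : Q).
Implicit Types (U : X -> seq G) (p : prog G Q X).

Definition rest U : store G X := (U, fun=> 0%R).

Definition Fill (l : seq X) p : prog G Q X := Seq p (seqs (map (@Rewind G Q X) l)).

Definition filled (l : seq X) (v : seq G) U : X -> seq G :=
  fun x => if x \in l then v else U x.

Lemma runs_rewinds (l : seq X) s B : 
  (forall x, x \in l -> (0 <= s.2 x <= (size (s.1 x))%:Z)%R) ->
  (forall x, x \in l -> size (s.1 x) <= B) ->
  runs (seqs (map (@Rewind G Q X) l)) (q, s) (size l * (B * 2 + 3) + 1)
    (q, (s.1, fun x => if x \in l then 0%R else s.2 x)).
Proof.
elim: l s => [|t l IH] s h1 h2.
  by apply: runs_move => // x; rewrite /= GRing.addr0.
rewrite [size _ * _ + _]/= mulSn -addnA.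
pose s1 : store G X := (s.1, fun x => if x == t then 0%R else s.2 x).
apply: (@runs_seq _ _ _ _ _ _ (q, s1)).
  apply: runs_le (runs_Rewind (t := t) _ _ _ _) _ => //; first by apply: h1; rewrite mem_head.
  by rewrite leq_add2r leq_mul2r h2 ?mem_head.
apply: runs_extr (IH s1 _ _) _.
- by move=> x xl /=; case: eqP => // _; apply: h1; rewrite inE xl orbT.
- by move=> x xl /=; apply: h2; rewrite inE xl orbT.
by split=> // x /=; rewrite inE; case: eqP => //=; case: (x \in l).
Qed.

Lemma runs_Fill l p U v B :
  (forall x, x \in l -> U x = [::]) ->
  Emits q p (rest U) (mem l) v B ->
  runs (Fill l p) (q, rest U) (B + (size l * (size v * 2 + 3) + 1))
    (q, rest (filled l v U)).
Proof.
move=> hU hp; apply: runs_seq.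
  apply: runs_ext (hp [::]) _ _; last by split.
  by split=> x //=; case: ifP => //; rewrite cats0.
apply: runs_extr (runs_rewinds (B := size v) _ _) _.
- by move=> x xl /=; rewrite xl hU //=; lia.
- by move=> x xl /=; rewrite xl hU.
split=> x /=; rewrite /filled; last by case xl: (x \in l).
by case: ifP => // xl; rewrite hU.
Qed.

Lemma Emits_ext p s s' O v B : Emits q p s O v B -> same_store s s' -> Emits q p s' O v B.
Proof.
move=> h [e1 e2] v0; apply: runs_ext (h v0) _ _.
  by split=> x /=; rewrite ?e1 ?e2.
by split=> x /=; rewrite ?e1 ?e2.
Qed.

Lemma at_end_empty (l : seq X) U : (forall x, x \in l -> U x = [::]) -> at_end (mem l) (rest U).
Proof. by move=> h x /= xl; rewrite h. Qed.

Definition Copy (t : X) (l : seq X) (g0 : G) : prog G Q X :=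
  For t (only t MoveRight) (Emit Q (mem l) (fun r => odflt g0 (r t))).

Lemma Emits_Copy t (l : seq X) g0 U : t \notin l -> (forall x, x \in l -> U x = [::]) ->
  Emits q (Copy t l g0) (rest U) (mem l) (U t) (size (U t) * 5 + 4).
Proof.
move=> tl hU; rewrite -[X in Emits _ _ _ _ X](_ : flatten [seq [:: nth g0 (U t) k] | k <- iota 0 (size (U t))] = _).
  rewrite -[5]/(1 + 4); apply: Emits_For => //=.
  - by rewrite /only eqxx.
  - by move=> x xl; rewrite /only; case: eqP xl tl => // -> ->.
  move=> k kU.
  have ae : at_end (mem l) (mvs (only t MoveRight) k (rest U)).
    move=> x /= xl; rewrite hU // /only; case: eqP xl tl => [-> ->|_ _ _] //=.
    by rewrite GRing.mulr0.
  have := @Emits_emit _ _ _ q _ (fun r => odflt g0 (r t)) _ ae.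
  rewrite ffunE /= /only eqxx /= (_ : (_ + _)%R = Posz k); last by lia.
  by rewrite /get (nth_map g0).
rewrite flatten_map1; exact: mkseq_nth.
Qed.

(** A power computed by iteration: over tapes of length [m], the nested loops execute [p] exactly
    [m ^ size l] times. *)
Definition Nest (l : seq X) p : prog G Q X :=
  foldr (fun t p => For t (only t MoveRight) p) p l.

Definition nest_time (m k : nat) : nat := iter k (fun b => m * (b + 4) + 4) 1.

Lemma Emits_Nest l O g m s : at_end O s ->
  uniq l -> (forall t, t \in l -> [/\ s.2 t = 0%R, size (s.1 t) = m & ~~ O t]) ->
  Emits q (Nest l (Emit Q O (fun=> g))) s O (nseq (m ^ size l) g) (nest_time m (size l)).
Proof.
elim: l s => [|t l IH] s ae ul hl; first exact: Emits_emit ae.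
have [t0 tm nO] := hl t (mem_head _ _).
rewrite -[X in Emits _ _ _ _ X](_ : flatten [seq nseq (m ^ size l) g | k <- iota 0 (size (s.1 t))] = _).
  rewrite [nest_time _ _]/= -tm; apply: Emits_For => //.
  - by rewrite /only eqxx.
  - by move=> x Ox; rewrite /only; case: eqP Ox nO => // -> ->.
  move=> k _; rewrite tm; case/andP: ul => tnl ul.
  apply: IH => //.
    move=> x Ox /=; rewrite ae // /only; case: eqP Ox nO => [-> ->|_ _ _] //=.
    by rewrite GRing.mulr0 GRing.addr0.
  move=> x xl /=; have [] := hl x; first by rewrite inE xl orbT.
  move=> -> h1 h2; split=> //; rewrite /only; case: eqP xl tnl => [-> ->|_ _ _] //=.
  by rewrite GRing.mulr0.
rewrite tm /= expnS; move: (m ^ _) => M; elim: (m) 0 => [|m' IHm] j //=.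
by rewrite mulSn nseqD IHm.
Qed.

Lemma Emits_times n p s O v B : Emits q p s O v B ->
  Emits q (seqs (nseq n p)) s O (flatten (nseq n v)) (n * B + 1).
Proof.
move=> h; elim: n => [|n IH]; last by rewrite mulSn -addnA; exact: Emits_seq h IH.
by move=> v0; rewrite cats0; apply: runs_move => // x; rewrite /= GRing.addr0.
Qed.

End Fill.

(** * The graph of a tiling problem and its encoding *)

Lemma flatten_iota_mul (T : Type) (g : nat -> seq T) a b :
  flatten [seq g k | k <- iota 0 (a * b)] =
  flatten [seq flatten [seq g (x * b + y) | y <- iota 0 b] | x <- iota 0 a].
Proof.
elim: a => [|a IH] //; rewrite mulSn addnC iotaD map_cat flatten_cat IH.
rewrite -[X in _ = flatten (map _ (iota 0 X))]addn1 iotaD map_cat flatten_cat.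
congr (_ ++ _); rewrite /= cats0 !add0n.
by rewrite -[a * b in LHS]addn0 iotaDl -map_comp.
Qed.

Lemma flatten_iota_enum (T : Type) (K : finType) (k0 : K) (g : K -> seq T) :
  flatten [seq g (nth k0 (enum K) y) | y <- iota 0 #|K|] = flatten [seq g k | k <- enum K].
Proof.
have {2}-> : enum K = [seq nth k0 (enum K) y | y <- iota 0 #|K|].
  by rewrite cardE; apply/esym; exact: mkseq_nth.
by rewrite -map_comp.
Qed.

Lemma digits_lt a b x y : x < a -> y < b -> x * b + y < a * b.
Proof.
move=> xa yb; apply: leq_trans (leq_mul xa (leqnn b)).
by rewrite mulSn addnC ltn_add2r.
Qed.

Lemma digits3 n m i j k (s := (i * n + j) * m + k) : j < n -> k < m ->
  [/\ s %/ m %/ n = i, s %/ m %% n = j & s %% m = k].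
Proof.
move=> jn km; have m0 : 0 < m by apply: leq_ltn_trans km.
have n0 : 0 < n by apply: leq_ltn_trans jn.
rewrite /s divnMDl // (divn_small km) addn0 divnMDl // (divn_small jn) addn0.
by rewrite !modnMDl (modn_small jn) (modn_small km).
Qed.

Section Cells.
Variables (W : nat) (K : finType).
Let cell : finType := ('I_W * 'I_W)%type.

Lemma index_lt (a : cell * K) : (a.1.1 * W + a.1.2) * #|K| + rk a.2 < W * W * #|K|.
Proof.
by rewrite !digits_lt ?rk_lt.
Qed.

(** Mixed-radix numbering with digits row, column and kind, so that three nested loops meet the
    nodes in increasing order. *)
Definition cell_index (a : cell * K) : 'I_(W * W * #|K|) := Ordinal (index_lt a).

Lemma cell_index_digits a (s := cell_index a : nat) :
  [/\ s %/ #|K| %/ W = a.1.1, s %/ #|K| %% W = a.1.2 & s %% #|K| = rk a.2].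
Proof.
rewrite /s /=; have kK := rk_lt a.2; have jW := ltn_ord a.1.2.
exact: digits3.
Qed.

Lemma cell_index_bij : bijective cell_index.
Proof.
apply: inj_card_bij; last by rewrite !card_prod !card_ord.
move=> a b e; have [a1 a2 a3] := cell_index_digits a.
have [] := cell_index_digits b; rewrite -e a1 a2 a3.
move: a b {e a1 a2 a3} => [[i j] k] [[i' j'] k'] /= /val_inj -> /val_inj -> /rk_inj -> //.
Qed.

End Cells.

Lemma good_ext (S T : finType) (E E' N : S -> T -> bool) :
  (forall s t, E s t = E' s t) -> good E N -> good E' N.
Proof. by move=> e [h1 h2 h3 h4 h5]; split=> // s t /h1; rewrite e. Qed.

Section Graph.
Variables (L Tile : finType) (x0 : L) (t0 : Tile).
Variable U : bool -> bool -> L -> L -> Tile -> bool.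
Variable R : bool -> Tile -> Tile -> bool.

Let SN := snode Tile.
Let TN := tnode Tile.
Let s0 : SN := inl (inl (inl t0)).
Let n0 : TN := inl (inl t0).

Definition adj (u : seq L) (i j i' j' : nat) (k : SN) (k' : TN) : bool :=
  adjK U R (i == 0) (j == 0) (nth x0 u i) (nth x0 u j) (offset i i') (offset j j') k k'.

Definition entry_at (u : seq L) (s t : nat) : bool :=
  adj u (s %/ #|SN| %/ size u) (s %/ #|SN| %% size u)
        (t %/ #|TN| %/ size u) (t %/ #|TN| %% size u)
        (nth s0 (enum SN) (s %% #|SN|)) (nth n0 (enum TN) (t %% #|TN|)).

Definition graph (u : seq L) : bigraph :=
  @BiGraph (size u * size u * #|SN|) (size u * size u * #|TN|)
    [set e | entry_at u (val e.1) (val e.2)].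

Section Spec.
Variable u : seq L.
Let cell : finType := ('I_(size u) * 'I_(size u))%type.
Let inc := @inc L Tile u.
Let cad := @cad L Tile U R x0 u.

Lemma graph_iso : exists (f : 'I_(nS (graph u)) -> _) (g : 'I_(nT (graph u)) -> _),
  [/\ bijective f, bijective g &
      forall s t, ((s, t) \in edges (graph u)) = gadget inc cad (f s) (g t)].
Proof.
have [f fK Kf] := cell_index_bij (size u) SN.
have [g gK Kg] := cell_index_bij (size u) TN.
exists (fun s => splitS (f s)), (fun t => splitT (g t)); split.
- by apply: bij_comp (splitS_bij Tile u) _; exists (@cell_index (size u) SN).
- by apply: bij_comp (splitT_bij Tile u) _; exists (@cell_index (size u) TN).
move=> s t; rewrite inE /=.
rewrite -[s in LHS]Kf -[t in LHS]Kg; case: (f s) (g t) => [a k] [b k'].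
rewrite /entry_at; have [-> -> ->] := cell_index_digits (a, k).
have [-> -> ->] := cell_index_digits (b, k'); rewrite /= /adj.
rewrite -[nth s0 _ _]/(unrk s0 _) -[nth n0 _ _]/(unrk n0 _) !unrkK.
exact: adjKE.
Qed.

Lemma graph_degree : max_degree (edges (graph u)) <= 4.
Proof.
have [f [g [fb gb e]]] := graph_iso.
apply/bigmax_leqP => -[s|t] _; rewrite ?degree_inl ?degree_inr.
  apply: leq_trans (gadget_degS U R t0 x0 (f s)).
  rewrite -(card_imset _ (bij_inj gb)); apply/subset_leq_card/subsetP => y.
  by case/imsetP => t + ->; rewrite !inE -e inE.
apply: leq_trans (gadget_degT U R t0 x0 (g t)).
rewrite -(card_imset _ (bij_inj fb)); apply/subset_leq_card/subsetP => y.
by case/imsetP => s + ->; rewrite !inE -e inE.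
Qed.

Lemma graph_tiling :
  has_Vfree_2matching_covering_T (graph u) <-> tiling U R x0 u.
Proof.
have [f [g [fb gb e]]] := graph_iso; rewrite has_VfreeP; split.
  move=> [N hN]; apply: (tiling_of_resolvable t0).
  have [f' fK f'K] := fb; have [g' gK g'K] := gb.
  have fb' : bijective f' by exists f.
  have gb' : bijective g' by exists g.
  apply: gadget_sound (good_ext _ (good_transfer fb' gb' hN)) => s t.
  by rewrite e f'K g'K.
move=> /(resolvable_of_tiling t0)/gadget_complete [N hN].
exists (fun s t => N (f s) (g t)).
by apply: good_ext (good_transfer fb gb hN) => s t; rewrite e.
Qed.

Definition adj_row (i j : nat) (k : SN) : seq (option bool) :=
  flatten [seq flatten [seq flatten [seq [:: Some (adj u i j i' j' k k')]
    | k' <- enum TN] | j' <- iota 0 (size u)] | i' <- iota 0 (size u)].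

Definition ones_word : seq (option bool) :=
  flatten [seq flatten [seq flatten [seq [:: Some true]
    | _ <- enum TN] | _ <- iota 0 (size u)] | _ <- iota 0 (size u)].

Definition adj_word : seq (option bool) :=
  ones_word ++ [:: None] ++
  flatten [seq flatten [seq flatten [seq adj_row i j k ++ [:: None]
    | k <- enum SN] | j <- iota 0 (size u)] | i <- iota 0 (size u)].

(** The loops over matrix positions are regrouped by digits into loops over cells and kinds, the
    shape in which the program emits the word. *)
Lemma encode_graph : encode_bigraph (graph u) = adj_word.
Proof.
have split3 (T : Type) (n m : nat) (F : nat -> seq T) :
    flatten [seq F k | k <- iota 0 (n * n * m)] =
    flatten [seq flatten [seq flatten [seq F ((i * n + j) * m + k) | k <- iota 0 m]
      | j <- iota 0 n] | i <- iota 0 n].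
  by rewrite !flatten_iota_mul.
rewrite /encode_bigraph /adj_word -cats1 -!catA; congr (_ ++ (_ ++ _)).
  rewrite /ones_word -(flatten_iota_enum n0 (fun=> [:: Some true])).
  rewrite -(split3 _ _ _ (fun=> [:: Some true])).
  by rewrite flatten_map1 /=; elim: (_ * _) 0 => //= N IH k; rewrite -IH.
have rowE (n : nat) (h : nat -> option bool) :
    [seq h (val t) | t <- enum 'I_n] = flatten [seq [:: h t] | t <- iota 0 n].
  by rewrite flatten_map1 (map_comp h val) val_enum_ord.
have -> : [seq rcons [seq Some ((s, t) \in edges (graph u)) | t <- enum 'I_(nT (graph u))] None
          | s <- enum 'I_(nS (graph u))] =
    [seq flatten [seq [:: Some (entry_at u s t)] | t <- iota 0 (size u * size u * #|TN|)] ++ [:: None]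
          | s <- iota 0 (size u * size u * #|SN|)].
  rewrite -(val_enum_ord (size u * size u * #|SN|)) -map_comp; apply: eq_map => s /=.
  rewrite -cats1 -rowE; congr (_ ++ _); apply: eq_map => t.
  by rewrite inE.
rewrite split3; congr flatten; apply/eq_in_map => i; rewrite mem_iota => /andP [_ iW].
congr flatten; apply/eq_in_map => j; rewrite mem_iota => /andP [_ jW].
rewrite -(flatten_iota_enum s0); congr flatten; apply/eq_in_map => k.
rewrite mem_iota => /andP [_ kK]; congr (_ ++ _).
rewrite split3; congr flatten; apply/eq_in_map => i'; rewrite mem_iota => /andP [_ iW'].
congr flatten; apply/eq_in_map => j'; rewrite mem_iota => /andP [_ jW'].
rewrite -(flatten_iota_enum n0); congr flatten; apply/eq_in_map => k'.
rewrite mem_iota => /andP [_ kK']; rewrite /entry_at.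
by have [-> -> ->] := digits3 i jW kK; have [-> -> ->] := digits3 i' jW' kK'.
Qed.

End Spec.
End Graph.

(** * A machine that writes the graph *)

Lemma polyb_succ f : polyb f -> polyb (fun n => (f n).+1).
Proof.
move=> h; apply: (@polyb_le _ (fun n => f n + 1)); last by move=> n; rewrite addn1.
by apply: polyb_add => //; exact: polyb_const.
Qed.

Lemma polyb_nest_time f k : polyb f -> polyb (fun n => nest_time (f n) k).
Proof.
move=> h; elim: k => [|k IH]; first exact: polyb_const.
apply: (@polyb_add (fun n => f n * (nest_time (f n) k + 4)) (fun=> 4)); last exact: polyb_const.
by apply: polyb_mul => //; apply: polyb_add => //; exact: polyb_const.
Qed.

Ltac prove_polyb := match goal with
  | |- polyb (fun _ => ?c) => exact (polyb_const c)
  | |- polyb (fun n => n) => exact polyb_id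
  | |- polyb (fun n => @?f n + @?g n) => apply (@polyb_add f g); prove_polyb
  | |- polyb (fun n => @?f n * @?g n) => apply (@polyb_mul f g); prove_polyb
  | |- polyb (fun n => (@?f n) ^ ?k) => apply (@polyb_exp f k); prove_polyb
  | |- polyb (fun n => nest_time (@?f n) ?k) => apply (@polyb_nest_time f k); prove_polyb
  | |- polyb (fun n => (@?f n).+1) => apply (@polyb_succ f); prove_polyb
  end.

(** The input is prescribed to be on the first tape and the output on the last; the tapes [Y] are
    numbered in between. As [enc] is injective between types of equal size, [dec] exists. *)
Lemma tape_names (Y : finType) :
  exists (enc : option (option Y) -> 'I_#|Y|.+2) (dec : 'I_#|Y|.+2 -> option (option Y)),
  [/\ cancel enc dec, enc None = ord0 & enc (Some None) = ord_max].
Proof.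
pose enc (x : option (option Y)) : 'I_#|Y|.+2 :=
  match x with
  | None => ord0
  | Some None => ord_max
  | Some (Some y) => inord (enum_rank y).+1
  end.
have encS y : val (enc (Some (Some y))) = (enum_rank y).+1.
  by rewrite /= inordK // !ltnS ltnW.
have inj : injective enc.
  move=> [[x|]|] [[y|]|] // /(congr1 val); rewrite ?encS //=.
  - by move=> [] /val_inj /enum_rank_inj ->.
  - by move=> [] e; have := ltn_ord (enum_rank x); rewrite e ltnn.
  - by move=> [] e; have := ltn_ord (enum_rank y); rewrite -e ltnn.
have [dec h _] : bijective enc.
  by apply: inj_card_bij => //; rewrite !card_option card_ord.
by exists enc, dec; split.
Qed.

Section Profile.
Variables (A : finType) (a d a' d' : nat).
(** [inl] is an input letter; [(false, false)] is the separator, [(false, true)] a cell free for the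
    certificate, [(true, false)] a blank cell, [(true, true)] the end marker. *)
Definition letter : finType := (A + bool * bool)%type.
Implicit Types w : seq A.

Definition size1 (n : nat) : nat := n + (poly_bound a d n).+1.
(** [size1] bounds the length of the verifier's input, so the second summand bounds its running time
    and the cells it can newly reach; the last 1 is the end marker. *)
Definition width (n : nat) : nat := size1 n + (poly_bound a' d' (size1 n) + 1).

(* The shape of the first row of the computation tableau: the input, the
   separator, room for the certificate, blank cells, and a right end marker. *)
Definition profile1 w : seq letter :=
  map inl w ++ inr (false, false) :: nseq (poly_bound a d (size w)) (inr (false, true)).

Definition profile w : seq letter :=
  profile1 w ++ nseq (poly_bound a' d' (size (profile1 w))) (inr (true, false))
    ++ [:: inr (true, true)].

Lemma size_profile1 w : size (profile1 w) = size1 (size w).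
Proof. by rewrite size_cat /= size_map size_nseq. Qed.

Lemma size_profile w : size (profile w) = width (size w).
Proof. by rewrite /profile size_cat [size (nseq _ _ ++ _)]size_cat size_nseq !size_profile1. Qed.

End Profile.

Section Generator.
Variables (A Tile : finType) (t0 : Tile) (a d a' d' : nat).
Let L := letter A.
Variable U : bool -> bool -> L -> L -> Tile -> bool.
Variable R : bool -> Tile -> Tile -> bool.
Let x0 : L := inr (true, true).
Let SN := snode Tile.
Let TN := tnode Tile.

Let G : finType := (L + bool + option bool)%type.
Let lp (l : L) : G := inl (inl l).
Let bb (b : bool) : G := inl (inr b).
Let ob (o : option bool) : G := inr o.
Let g0 : G := ob None.

(** The [d] and [d'] tapes carry the words over which powers are computed. The other nine hold the
    first part of the profile, four copies of the whole as loop counters and sources of letters, two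
    markers of index 0, and two words for index differences. *)
Definition tapeK : finType := option (option ('I_d + 'I_d' + 'I_9)).
Let tin : tapeK := None.
Let tout : tapeK := Some None.
Let cs : seq tapeK := [seq Some (Some (inl (inl i))) | i <- enum 'I_d].
Let es : seq tapeK := [seq Some (Some (inl (inr i))) | i <- enum 'I_d'].
Let tm (k : 'I_9) : tapeK := Some (Some (inr k)).
Let prof := tm (@Ordinal 9 0 isT).
Let TI := tm (@Ordinal 9 1 isT).
Let TI' := tm (@Ordinal 9 2 isT).
Let TJ := tm (@Ordinal 9 3 isT).
Let TJ' := tm (@Ordinal 9 4 isT).
Let ZI := tm (@Ordinal 9 5 isT).
Let ZJ := tm (@Ordinal 9 6 isT).
Let DI := tm (@Ordinal 9 7 isT).
Let DJ := tm (@Ordinal 9 8 isT).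

(* During the loops over i, j, i', j' the head positions are these indices on TI,
   TJ, TI', TJ' and the differences i' - i, j' - j on DI, DJ, whose word
   [false; true] thus tells whether the difference is 0 or 1; on ZI, ZJ, whose
   word is a single letter, a letter is scanned exactly when i = 0, j = 0. *)
Let dI (x : tapeK) : move :=
  if (x == TI) || (x == ZI) then MoveRight else if x == DI then MoveLeft else Stay.
Let dJ (x : tapeK) : move :=
  if (x == TJ) || (x == ZJ) then MoveRight else if x == DJ then MoveLeft else Stay.
Let dI' (x : tapeK) : move := if (x == TI') || (x == DI) then MoveRight else Stay.
Let dJ' (x : tapeK) : move := if (x == TJ') || (x == DJ) then MoveRight else Stay.

Let emit (l : seq tapeK) (x : G) : prog G unit tapeK := Emit unit (mem l) (fun=> x).
Let ins := [:: TI; TI'; TJ; TJ'].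

Let letter_of (o : option G) : L := if o is Some (inl (inl l)) then l else x0.
Let bool_of (o : option G) : option bool := if o is Some (inl (inr b)) then Some b else None.

Let cell_prog (k : SN) (k' : TN) : prog G unit tapeK :=
  Emit unit (mem [:: tout]) (fun r => ob (Some (adjK U R (r ZI != None) (r ZJ != None)
    (letter_of (r TI)) (letter_of (r TJ)) (bool_of (r DI)) (bool_of (r DJ)) k k'))).

Let matrix_prog : prog G unit tapeK :=
  Seq (For TI' dI' (For TJ' dJ' (seqs [seq emit [:: tout] (ob (Some true)) | _ <- enum TN])))
  (Seq (emit [:: tout] (ob None))
  (For TI dI (For TJ dJ (seqs [seq
     Seq (For TI' dI' (For TJ' dJ' (seqs [seq cell_prog k k' | k' <- enum TN])))
         (emit [:: tout] (ob None)) | k <- enum SN])))).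

Let fill1 := Fill cs (Copy unit tin cs g0).
(** The [poly_bound a d n] free cells come from [a] rounds of [d] nested loops over words of length
    [n], plus [a] single letters. *)
Let fill2 := Fill [:: prof]
  (Seq (Copy unit tin [:: prof] g0)
  (Seq (emit [:: prof] (lp (inr (false, false))))
  (Seq (seqs (nseq a (Nest cs (emit [:: prof] (lp (inr (false, true)))))))
       (seqs (nseq a (emit [:: prof] (lp (inr (false, true))))))))).
Let fill3 := Fill es (Copy unit prof es g0).
Let fill4 := Fill ins
  (Seq (Copy unit prof ins g0)
  (Seq (seqs (nseq a' (Nest es (emit ins (lp (inr (true, false)))))))
  (Seq (seqs (nseq a' (emit ins (lp (inr (true, false))))))
       (emit ins (lp (inr (true, true))))))).
Let fill5 := Fill [:: ZI; ZJ] (emit [:: ZI; ZJ] (bb true)).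
Let fill6 := Fill [:: DI; DJ] (Seq (emit [:: DI; DJ] (bb false)) (emit [:: DI; DJ] (bb true))).
Let fill7 := Fill [:: tout] matrix_prog.

Let generator := Seq fill1 (Seq fill2 (Seq fill3 (Seq fill4 (Seq fill5 (Seq fill6 fill7))))).

Section Run.
Variable w : seq A.
Let n := size w.
Let u := profile a d a' d' w.
Let U0 (x : tapeK) : seq G := if x == tin then map (lp \o inl) w else [::].
Let U1 := filled cs (map (lp \o inl) w) U0.
Let U2 := filled [:: prof] (map lp (profile1 a d w)) U1.
Let U3 := filled es (map lp (profile1 a d w)) U2.
Let U4 := filled ins (map lp u) U3.
Let U5 := filled [:: ZI; ZJ] [:: bb true] U4.
Let U6 := filled [:: DI; DJ] [:: bb false; bb true] U5.
Let U7 := filled [:: tout] (map ob (adj_word x0 U R u)) U6.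

Lemma mem_cs x : (x \in cs) = if x is Some (Some (inl (inl _))) then true else false.
Proof.
apply/mapP/idP => [[i _ ->] //|]; case: x => [[[[i|]|]|]|] // _.
by exists i; rewrite ?mem_enum.
Qed.

Lemma mem_es x : (x \in es) = if x is Some (Some (inl (inr _))) then true else false.
Proof.
apply/mapP/idP => [[i _ ->] //|]; case: x => [[[[|i]|]|]|] // _.
by exists i; rewrite ?mem_enum.
Qed.

Lemma uniq_cs : uniq cs.
Proof. by rewrite map_inj_uniq ?enum_uniq // => i j [->]. Qed.

Lemma uniq_es : uniq es.
Proof. by rewrite map_inj_uniq ?enum_uniq // => i j [->]. Qed.

Lemma size_cs : size cs = d.
Proof. by rewrite size_map size_enum_ord. Qed.

Lemma size_es : size es = d'.
Proof. by rewrite size_map size_enum_ord. Qed.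

Lemma flatten_nseq2 (T : Type) (k m : nat) (x : T) :
  flatten (nseq k (nseq m x)) = nseq (k * m) x.
Proof. by elim: k => //= k ->; rewrite mulSn nseqD. Qed.

Let time1 (m : nat) := m * 5 + 4 + (d * (m * 2 + 3) + 1).
Let time2 (m : nat) := m * 5 + 4 + (1 + (a * nest_time m d + 1 + (a * 1 + 1))) +
  (1 * (size1 a d m * 2 + 3) + 1).
Let time3 (m : nat) := size1 a d m * 5 + 4 + (d' * (size1 a d m * 2 + 3) + 1).
Let time4 (m : nat) := size1 a d m * 5 + 4 +
  (a' * nest_time (size1 a d m) d' + 1 + (a' * 1 + 1 + 1)) +
  (4 * (width a d a' d' m * 2 + 3) + 1).
Let time5 := 1 + (2 * (1 * 2 + 3) + 1).
Let time6 := 1 + 1 + (2 * (2 * 2 + 3) + 1).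
Let inner (W : nat) := W * (W * (#|TN| * 1 + 1 + 4) + 4 + 4) + 4.
(** The last summand rewinds the output tape, whose length is that of the encoded matrix. *)
Let time7 (W : nat) :=
  inner W + (1 + (W * (W * (#|SN| * (inner W + 1) + 1 + 4) + 4 + 4) + 4)) +
  (1 * ((W * W * #|TN|).+1 * (W * W * #|SN|).+1 * 2 + 3) + 1).

Lemma run_fill1 : runs fill1 (tt, rest U0) (time1 n) (tt, rest U1).
Proof.
have h := @runs_Fill G unit tapeK tt cs (Copy unit tin cs g0) U0 (map (lp \o inl) w).
rewrite size_map size_cs in h; apply: h.
  by move=> x; rewrite mem_cs /U0; case: x => [[[[i|]|]|]|].
have := @Emits_Copy G unit tapeK tt tin cs g0 U0.
rewrite {2 3}/U0 eqxx size_map; apply; first by rewrite mem_cs.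
by move=> x; rewrite mem_cs /U0; case: x => [[[[i|]|]|]|].
Qed.

Lemma run_fill2 : runs fill2 (tt, rest U1) (time2 n) (tt, rest U2).
Proof.
have e x : x \in [:: prof] -> U1 x = [::].
  by rewrite inE => /eqP ->; rewrite /U1 /filled mem_cs.
have := @runs_Fill G unit tapeK tt [:: prof] _ U1 (map lp (profile1 a d w)) _ e.
rewrite size_map size_profile1; apply.
have -> : map lp (profile1 a d w) = U1 tin ++ [:: lp (inr (false, false))] ++
    flatten (nseq a (nseq (n ^ size cs) (lp (inr (false, true))))) ++
    flatten (nseq a (nseq 1 (lp (inr (false, true))))).
  rewrite !flatten_nseq2 size_cs muln1 -nseqD /U1 /filled mem_cs /= /U0 eqxx.
  by rewrite /profile1 map_cat -map_comp /= map_nseq.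
apply: Emits_seq.
  have -> : n = size (U1 tin) by rewrite /U1 /filled mem_cs /U0 eqxx size_map.
  exact: Emits_Copy.
have ae := at_end_empty e.
apply: Emits_seq; first exact: Emits_emit ae.
apply: Emits_seq; apply: Emits_times; last exact: Emits_emit ae.
rewrite -size_cs; apply: Emits_Nest => // [|t]; first exact: uniq_cs.
rewrite mem_cs => tc; split=> //=.
  by rewrite /U1 /filled mem_cs tc size_map.
by case: t tc => [[[[i|]|]|]|].
Qed.

Lemma run_fill3 : runs fill3 (tt, rest U2) (time3 n) (tt, rest U3).
Proof.
have e x : x \in es -> U2 x = [::].
  by rewrite mem_es /U2 /U1 /filled mem_cs inE; case: x => [[[[i|i]|]|]|].
have U2p : U2 prof = map lp (profile1 a d w) by rewrite /U2 /filled mem_head.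
have := @runs_Fill G unit tapeK tt es _ U2 (map lp (profile1 a d w)) _ e.
rewrite size_es size_map size_profile1; apply.
have := @Emits_Copy G unit tapeK tt prof es g0 U2.
by rewrite U2p size_map size_profile1 mem_es; apply.
Qed.

Lemma run_fill4 : runs fill4 (tt, rest U3) (time4 n) (tt, rest U4).
Proof.
have e x : x \in ins -> U3 x = [::].
  by rewrite !inE => /or4P [] /eqP ->; rewrite /U3 /U2 /U1 /filled mem_es mem_cs.
have U3p : U3 prof = map lp (profile1 a d w) by rewrite /U3 /U2 /filled mem_es mem_head.
have := @runs_Fill G unit tapeK tt ins _ U3 (map lp u) _ e.
rewrite size_map size_profile; apply.
set m := size1 a d n.
have -> : map lp u = U3 prof ++
    flatten (nseq a' (nseq (m ^ size es) (lp (inr (true, false))))) ++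
    flatten (nseq a' (nseq 1 (lp (inr (true, false))))) ++ [:: lp (inr (true, true))].
  rewrite !flatten_nseq2 size_es muln1 U3p /u /profile map_cat; congr (_ ++ _).
  by rewrite map_cat map_nseq size_profile1 /poly_bound nseqD -catA.
apply: Emits_seq.
  have -> : m = size (U3 prof) by rewrite U3p size_map size_profile1.
  exact: Emits_Copy.
have ae := at_end_empty e.
apply: Emits_seq.
  apply: Emits_times; rewrite -size_es; apply: Emits_Nest => // [|t]; first exact: uniq_es.
  rewrite mem_es => tc; split=> //=.
    by rewrite /U3 /filled mem_es tc size_map size_profile1.
  by case: t tc => [[[[i|]|]|]|].
apply: Emits_seq; last exact: Emits_emit ae.
by apply: Emits_times; exact: Emits_emit ae.
Qed.

Lemma run_fill5 : runs fill5 (tt, rest U4) time5 (tt, rest U5).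
Proof.
have e x : x \in [:: ZI; ZJ] -> U4 x = [::].
  by rewrite !inE => /orP [] /eqP ->; rewrite /U4 /U3 /U2 /U1 /filled mem_es mem_cs.
apply: (@runs_Fill G unit tapeK tt [:: ZI; ZJ] _ U4 [:: bb true] 1 e).
by apply: Emits_emit; exact: at_end_empty e.
Qed.

Lemma run_fill6 : runs fill6 (tt, rest U5) time6 (tt, rest U6).
Proof.
have e x : x \in [:: DI; DJ] -> U5 x = [::].
  by rewrite !inE => /orP [] /eqP ->; rewrite /U5 /U4 /U3 /U2 /U1 /filled mem_es mem_cs.
have ae := at_end_empty e.
apply: (@runs_Fill G unit tapeK tt [:: DI; DJ] _ U5 [:: bb false; bb true] (1 + 1) e).
rewrite -[[:: bb false; _]]/([:: bb false] ++ [:: bb true]).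
by apply: Emits_seq; apply: Emits_emit.
Qed.

(** Each loop adds its own displacement, so head positions are linear in the four indices; a head
    moved in opposite directions by two loops shows a difference. *)
Let hd (i j i' j' : nat) (x : tapeK) : int :=
  (i%:Z * dz (dI x) + j%:Z * dz (dJ x) + i'%:Z * dz (dI' x) + j'%:Z * dz (dJ' x))%R.
Let st i j i' j' : store G tapeK := (U6, hd i j i' j').
Let W := size u.

Lemma hd_tapes i j i' j' :
  ([/\ hd i j i' j' TI = i%:Z, hd i j i' j' TJ = j%:Z, hd i j i' j' TI' = i'%:Z
     & hd i j i' j' TJ' = j'%:Z] /\
  [/\ hd i j i' j' ZI = i%:Z, hd i j i' j' ZJ = j%:Z, hd i j i' j' DI = i'%:Z - i%:Z
     & hd i j i' j' DJ = j'%:Z - j%:Z])%R.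
Proof.
split; split; rewrite /hd.
- change (i%:Z * 1 + j%:Z * 0 + i'%:Z * 0 + j'%:Z * 0 = i%:Z)%R; ring.
- change (i%:Z * 0 + j%:Z * 1 + i'%:Z * 0 + j'%:Z * 0 = j%:Z)%R; ring.
- change (i%:Z * 0 + j%:Z * 0 + i'%:Z * 1 + j'%:Z * 0 = i'%:Z)%R; ring.
- change (i%:Z * 0 + j%:Z * 0 + i'%:Z * 0 + j'%:Z * 1 = j'%:Z)%R; ring.
- change (i%:Z * 1 + j%:Z * 0 + i'%:Z * 0 + j'%:Z * 0 = i%:Z)%R; ring.
- change (i%:Z * 0 + j%:Z * 1 + i'%:Z * 0 + j'%:Z * 0 = j%:Z)%R; ring.
- change (i%:Z * (- 1) + j%:Z * 0 + i'%:Z * 1 + j'%:Z * 0 = i'%:Z - i%:Z)%R; ring.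
- change (i%:Z * 0 + j%:Z * (- 1) + i'%:Z * 0 + j'%:Z * 1 = j'%:Z - j%:Z)%R; ring.
Qed.

Lemma U6_tapes : [/\ U6 TI = map lp u, U6 TJ = map lp u, U6 TI' = map lp u &
  U6 TJ' = map lp u] /\ [/\ U6 ZI = [:: bb true], U6 ZJ = [:: bb true],
  U6 DI = [:: bb false; bb true], U6 DJ = [:: bb false; bb true] & U6 tout = [::]].
Proof. by split; split; rewrite // /U6 /U5 /U4 /U3 /U2 /U1 /filled mem_es mem_cs. Qed.

(** Differences other than 0 and 1 carry the head off the two-letter word, where it reads [None]. *)
Lemma offset_bool i i' :
  bool_of (get [:: bb false; bb true] (i'%:Z - i%:Z)%R) = offset i i'.
Proof.
rewrite /offset /get; case: (ltngtP i' i) => h.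
- have [m ->] : exists m, (i'%:Z - i%:Z)%R = Negz m by exists (i - i').-1; lia.
  by rewrite ifF //; lia.
- have -> : (i'%:Z - i%:Z)%R = Posz (i' - i) by lia.
  case e: (i' - i) => [|[|m]]; first by lia.
    by rewrite ifT //; lia.
  by rewrite nth_default // ifF //; lia.
- by rewrite h GRing.subrr.
Qed.

Lemma first_bool i : (get [:: bb true] i%:Z != None) = (i == 0).
Proof. by rewrite /get; case: i => // i; rewrite nth_default. Qed.

Lemma at_end_st i j i' j' : at_end (mem [:: tout]) (st i j i' j').
Proof.
move=> x; rewrite /= inE => /eqP ->; rewrite (_ : U6 tout = [::]); last by case: U6_tapes => _ [].
by rewrite /hd; change (i%:Z * 0 + j%:Z * 0 + i'%:Z * 0 + j'%:Z * 0 = 0%:Z)%R; ring.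
Qed.

Lemma Emits_cell i j i' j' k k' : i < W -> j < W ->
  Emits tt (cell_prog k k') (st i j i' j') (mem [:: tout])
    [:: ob (Some (adj x0 U R u i j i' j' k k'))] 1.
Proof.
move=> iW jW.
rewrite -[X in Emits _ _ _ _ X](_ : [:: ob (Some (adjK U R
  (reading (st i j i' j') ZI != None) (reading (st i j i' j') ZJ != None)
    (letter_of (reading (st i j i' j') TI)) (letter_of (reading (st i j i' j') TJ))
    (bool_of (reading (st i j i' j') DI)) (bool_of (reading (st i j i' j') DJ)) k k'))] = _).
  exact: (@Emits_emit G unit tapeK tt _ _ _ (at_end_st i j i' j')).
congr [:: ob (Some _)]; rewrite !ffunE /=.
have [[h1 h2 _ _] [h5 h6 h7 h8]] := hd_tapes i j i' j'.
have [[-> -> _ _] [-> -> -> -> _]] := U6_tapes.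
rewrite h1 h2 h5 h6 h7 h8 !offset_bool !first_bool /get.
by rewrite -!map_comp !(nth_map x0).
Qed.

Lemma Emits_loops i j p O (F : nat -> nat -> seq G) B :
  (forall x, O x = (x == tout)) ->
  (forall i' j', i' < W -> j' < W -> Emits tt p (st i j i' j') O (F i' j') B) ->
  Emits tt (For TI' dI' (For TJ' dJ' p)) (st i j 0 0) O
    (flatten [seq flatten [seq F i' j' | j' <- iota 0 W] | i' <- iota 0 W])
    (W * (W * (B + 4) + 4 + 4) + 4).
Proof.
move=> hO hp; have [[u1 u2 u3 u4] _] := U6_tapes.
have WI : size (U6 TI') = W by rewrite u3 size_map.
have WJ : size (U6 TJ') = W by rewrite u4 size_map.
rewrite -{2 3}WI; apply: (@Emits_For G unit tapeK tt TI' dI' _ (st i j 0 0)) => //.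
- by case: (hd_tapes i j 0 0) => -[].
- by move=> x; rewrite hO => /eqP ->.
rewrite WI => i' iW; apply: (@Emits_ext _ _ _ _ _ (st i j i' 0)); last first.
  by apply: mvs_store => x; rewrite /hd; move: (dz _) (dz _) (dz _) (dz _) => *; ring.
rewrite -{1 2}WJ; apply: (@Emits_For G unit tapeK tt TJ' dJ' _ (st i j i' 0)) => //.
- by case: (hd_tapes i j i' 0) => -[].
- by move=> x; rewrite hO => /eqP ->.
rewrite WJ => j' jW; apply: (@Emits_ext _ _ _ _ _ (st i j i' j')); last first.
  by apply: mvs_store => x; rewrite /hd; move: (dz _) (dz _) (dz _) (dz _) => *; ring.
exact: hp.
Qed.

Lemma Emits_loops_outer p O (F : nat -> nat -> seq G) B :
  (forall x, O x = (x == tout)) ->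
  (forall i j, i < W -> j < W -> Emits tt p (st i j 0 0) O (F i j) B) ->
  Emits tt (For TI dI (For TJ dJ p)) (st 0 0 0 0) O
    (flatten [seq flatten [seq F i j | j <- iota 0 W] | i <- iota 0 W])
    (W * (W * (B + 4) + 4 + 4) + 4).
Proof.
move=> hO hp; have [[u1 u2 u3 u4] _] := U6_tapes.
have WI : size (U6 TI) = W by rewrite u1 size_map.
have WJ : size (U6 TJ) = W by rewrite u2 size_map.
rewrite -{2 3}WI; apply: (@Emits_For G unit tapeK tt TI dI _ (st 0 0 0 0)) => //.
- by move=> x; rewrite hO => /eqP ->.
rewrite WI => i iW; apply: (@Emits_ext _ _ _ _ _ (st i 0 0 0)); last first.
  by apply: mvs_store => x; rewrite /hd; move: (dz _) (dz _) (dz _) (dz _) => *; ring.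
rewrite -{1 2}WJ; apply: (@Emits_For G unit tapeK tt TJ dJ _ (st i 0 0 0)) => //.
- by case: (hd_tapes i 0 0 0) => -[].
- by move=> x; rewrite hO => /eqP ->.
rewrite WJ => j jW; apply: (@Emits_ext _ _ _ _ _ (st i j 0 0)); last first.
  by apply: mvs_store => x; rewrite /hd; move: (dz _) (dz _) (dz _) (dz _) => *; ring.
exact: hp.
Qed.

Lemma run_fill7 : runs fill7 (tt, rest U6) (time7 W) (tt, rest U7).
Proof.
have e x : x \in [:: tout] -> U6 x = [::].
  by rewrite inE => /eqP ->; case: U6_tapes => _ [].
have hO x : mem [:: tout] x = (x == tout) by rewrite -[LHS]/(x \in _) inE.
have sz : size (map ob (adj_word x0 U R u)) = (W * W * #|TN|).+1 * (W * W * #|SN|).+1.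
  by rewrite size_map -(encode_graph x0 t0) size_encode_bigraph.
have := @runs_Fill G unit tapeK tt [:: tout] matrix_prog U6 (map ob (adj_word x0 U R u)) _ e.
rewrite sz; apply; rewrite /adj_word !map_cat.
have st0 : same_store (st 0 0 0 0) (rest U6).
  split=> x; first by [].
  by rewrite [LHS]/= /hd; move: (dz _) (dz _) (dz _) (dz _) => *; ring.
apply: Emits_ext st0; have ae := at_end_st.
have mapf (T S : Type) (f : T -> S) (I : Type) (h : I -> seq T) (l : seq I) :
    map f (flatten [seq h i | i <- l]) = flatten [seq map f (h i) | i <- l].
  by rewrite map_flatten -map_comp.
have mapff (T S : Type) (f : T -> S) (I J : Type) (h : I -> J -> seq T) (l : seq I) (l' : seq J) :
    map f (flatten [seq flatten [seq h i j | j <- l'] | i <- l]) =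
    flatten [seq flatten [seq map f (h i j) | j <- l'] | i <- l].
  by rewrite mapf; congr flatten; apply: eq_map => i; rewrite mapf.
apply: Emits_seq.
  rewrite /ones_word mapff.
  apply: Emits_loops => // i' j' _ _; rewrite mapf.
  rewrite [#|TN|]cardE; apply: Emits_seqs => k _; exact: Emits_emit.
apply: Emits_seq; first exact: Emits_emit.
rewrite mapff.
apply: Emits_loops_outer => // i j iW jW; rewrite mapf.
rewrite [#|SN|]cardE; apply: Emits_seqs => k _.
rewrite map_cat; apply: Emits_seq; last exact: Emits_emit.
rewrite /adj_row mapff.
apply: Emits_loops => // i' j' _ _; rewrite mapf.
rewrite [#|TN|]cardE; apply: Emits_seqs => k' _; exact: Emits_cell.
Qed.

Let total (m : nat) := time1 m + (time2 m + (time3 m + (time4 m + (time5 +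
  (time6 + time7 (width a d a' d' m)))))).

Lemma run_generator : runs generator (tt, rest U0) (total n) (tt, rest U7).
Proof.
have h7 := run_fill7; rewrite /W size_profile in h7.
exact: runs_seq run_fill1 (runs_seq run_fill2 (runs_seq run_fill3 (runs_seq run_fill4
  (runs_seq run_fill5 (runs_seq run_fill6 h7))))).
Qed.

Lemma polyb_total : polyb total.
Proof.
rewrite /total /time1 /time2 /time3 /time4 /time5 /time6 /time7 /inner /width /size1 /poly_bound.
by prove_polyb.
Qed.

End Run.

Lemma generator_poly_time :
  poly_time_computable (fun w : seq A => encode_bigraph (graph x0 t0 U R (profile a d a' d' w))).
Proof.
have [enc [dec [encK e0 e1]]] := tape_names ('I_d + 'I_d' + 'I_9)%type.
have [b [e hb]] := polyb_total.
exists (compile enc dec generator tt predT), (fun x => Some (lp (inl x))),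
  (fun o => Some (ob o)), b, e; split.
- by split=> // x y [].
- by split=> // x y [].
move=> w c; rewrite {}/c.
have [m mT /(exec_run encK) h] := run_generator w.
have := h predT (poly_bound b e (size w)) e0 (leq_trans mT (hb _)).
rewrite -map_comp => -[hh _ hr]; split=> //.
apply: represents_outputs e1 _.
have := hr tout; rewrite {2}/rest /= /filled mem_head (encode_graph x0 t0).
by [].
Qed.

End Generator.

(** * Computations as tilings *)

Lemma tiling_nat (L Tile : finType) (U : bool -> bool -> L -> L -> Tile -> bool)
    (R : bool -> Tile -> Tile -> bool) (x0 : L) (t0 : Tile) (u : seq L) (W := size u) :
  tiling U R x0 u <-> exists t : nat -> nat -> Tile,
  [/\ forall i j, i < W -> j < W ->
        U (i == 0) (j == 0) (nth x0 u i) (nth x0 u j) (t i j),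
      forall i j, i < W -> j.+1 < W -> R true (t i j) (t i j.+1) &
      forall i j, i.+1 < W -> j < W -> R false (t i j) (t i.+1 j)].
Proof.
split=> [[t [hU hH hV]]|[t [hU hH hV]]]; last first.
  exists (fun i j => t i j); split=> [i j|i j j' e|i i' j e].
  - by apply: hU; exact: ltn_ord.
  - by rewrite e; apply: hH; rewrite -?e ltn_ord.
  - by rewrite e; apply: hV; rewrite -?e ltn_ord.
pose t' i j := if insub i is Some i' then if insub j is Some j' then t i' j' else t0 else t0.
have tE i j (iW : i < W) (jW : j < W) : t' i j = t (Ordinal iW) (Ordinal jW).
  by rewrite /t' !insubT.
exists t'; split=> [i j iW jW|i j iW jW|i j iW jW].
- by rewrite (tE _ _ iW jW); apply: (hU (Ordinal iW) (Ordinal jW)).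
- by rewrite (tE _ _ iW jW) (tE _ _ iW (ltnW jW)); apply: hH.
- by rewrite (tE _ _ iW jW) (tE _ _ (ltnW iW) jW); apply: hV.
Qed.

Section CookLevin.
Variable M : machine.
Let K := (tapes M).+1.
Let Sym := symbol M.
Let bl : Sym := blank M.
Definition scanned : finType := {ffun 'I_K -> Sym}.
Definition column : finType := {ffun 'I_K -> Sym * Sym}.

(* State, scanned symbols, "is this column 0", and the previous, current and
   next columns; column [j] holds, for each tape, the [j]-th cell to the left of
   the head and the [j]-th cell from the head on, after writing but before
   moving. *)
Definition tile : finType := (state M * scanned * bool * (column * column * column))%type.

(** A halted configuration goes on unchanged, as in [step], so that a run fills a tableau of any
    prescribed height. *)
Definition action (q : state M) (b : scanned) : state M * scanned * ('I_K -> move) :=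
  if halting q then (q, b, fun=> Stay) else delta q b.

Definition heads (y : column) : scanned := [ffun t => (y t).2].

Definition wrote (q : state M) (b : scanned) (z : bool) (y : column) : column :=
  [ffun t => ((y t).1, if z then (action q b).1.2 t else (y t).2)].

(** In the folded tape a move to the right pushes the left half one column away from the head and
    pulls the right half one column closer; a move to the left does the opposite. *)
Definition slide (m : move) (p x n : Sym * Sym) : Sym * Sym :=
  match m with
  | Stay => x
  | MoveRight => (p.1, n.2)
  | MoveLeft => (n.1, p.2)
  end.

Definition slides (q : state M) (b : scanned) (p x n : column) : column :=
  [ffun t => slide ((action q b).2 t) (p t) (x t) (n t)].

Definition swap (y : column) : column := [ffun t => ((y t).2, (y t).1)].

Definition content (c : config M) (j : nat) : column :=
  [ffun t => (nth bl (c.2 t).1 j, nth bl (c.2 t).2 j)].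

Definition written (c : config M) (j : nat) : column :=
  wrote c.1 (heads (content c 0)) (j == 0) (content c j).

(* Folding at the head: the cell to the left of column 0 on either half tape is
   column 0 of the other half. *)
Definition before (c : config M) (j : nat) : column :=
  if j is j'.+1 then written c j' else swap (written c 0).

Lemma step_state c : (step c).1 = (action c.1 (heads (content c 0))).1.1.
Proof.
rewrite /step /action; case: ifP => // _.
have -> : [ffun i => read (c.2 i)] = heads (content c 0).
  by apply/ffunP => t; rewrite !ffunE /read nth0.
by case: (delta _ _) => -[].
Qed.

(** A step determines each column from itself and its two neighbours, given the state and the
    scanned symbols; this is what tiles can check. *)
Lemma content_step c j : content (step c) j =
  slides c.1 (heads (content c 0)) (before c j) (written c j) (written c j.+1).
Proof.
apply/ffunP => t; rewrite /slides ffunE.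
have hd : [ffun i => read (c.2 i)] = heads (content c 0).
  by apply/ffunP => i; rewrite !ffunE /read nth0.
rewrite /step hd /before /written /wrote /swap /action; case hlt: (halting c.1).
  by rewrite !ffunE /=; case: j => [|j] /=; rewrite ?ffunE //; case: ifP => // /eqP ->.
case e: (delta _ _) => [[q a] m]; rewrite /content /= !ffunE /=.
case: j => [|[|j]] /=; rewrite !ffunE /= ?ffunE /=; case: (c.2 t) => l r;
  by case: (m t) => /=; rewrite ?nth_behead ?nth0.
Qed.

Lemma content_blank w i j : 0 < size w -> size w + i <= j ->
  content (@run M w i) j = [ffun=> (bl, bl)].
Proof.
(* [w0] makes room for the first step on an empty tape: a write followed by a move to the left lists
   two cells at once. *)
move=> w0 ij; suff h t : size ((run w i).2 t).1 <= i /\ size ((run w i).2 t).2 <= size w + i.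
  apply/ffunP => t; rewrite !ffunE; have [h1 h2] := h t.
  by rewrite !nth_default // ?(leq_trans h1) ?(leq_trans h2) //; lia.
elim: i {ij} t => [|i IH] t; first by rewrite /run /=; case: eqP => _ /=; lia.
rewrite /run iterS -/(run w i); have := IH t; move: (run w i) => c hc.
rewrite /step; case: ifP => _; first by lia.
case: (delta _ _) => [[q b] m] /=; case: (c.2 t) hc => l r /=.
by case: (m t) => /=; rewrite ?size_behead; case: l r => [|? l] [|? r] /=; lia.
Qed.

Variables (A B : finType) (code : option (A + B) -> symbol M).
Hypothesis codeP : coding code.

Definition starts (l : letter A) (y : column) : bool :=
  [&& [forall t, (y t).1 == bl], [forall t, (t != ord0) ==> ((y t).2 == bl)] &
  match l with
  | inl s => (y ord0).2 == code (Some (inl s))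
  | inr (false, false) => (y ord0).2 == code None
  | inr (false, true) => ((y ord0).2 == bl) || [exists b, (y ord0).2 == code (Some (inr b))]
  | inr (true, _) => (y ord0).2 == bl
  end].

(** The end marker flags the last row and column, as [fi] and [fj] flag the first ones. Missing
    neighbours are supplied by the fold on the left and by blanks on the right. The last row must
    accept. The first row holds content allowed by its letters, and a blank in a free cell must be
    followed by a blank, so that the certificate is one word. *)
Definition unary (fi fj : bool) (xi xj : letter A) (s : tile) : bool :=
  let: (q, b, z, (p, x, n)) := s in
  [&& z == fj, fj ==> (p == swap x),
      (xj == inr (true, true)) ==> (n == [ffun=> (bl, bl)]),
      (xi == inr (true, true)) ==> halting q && accepting q &
      fi ==> [&& q == start M,
        [exists y, [&& starts xj y, x == wrote q b z y & z ==> (b == heads y)]] &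
        (xj == inr (false, true)) && ((x ord0).2 == bl) ==> ((n ord0).2 == bl)]].

Definition binary (horizontal : bool) (s s' : tile) : bool :=
  let: (q, b, z, (p, x, n)) := s in
  let: (q', b', z', (p', x', n')) := s' in
  if horizontal then [&& q == q', b == b', x == p' & n == x']
  else [&& q' == (action q b).1.1, x' == wrote q' b' z' (slides q b p x n)
         & z' ==> (b' == heads (slides q b p x n))].

(** * Tableaux for a fixed input word *)

Section Word.
Variables (a d a' d' : nat) (w : seq A).
Let n := size w.
Let q := poly_bound a d n.
Let pr := profile a d a' d' w.
Let W := size pr.
Let x0 : letter A := inr (true, true).
Let T := poly_bound a' d' (n + q.+1).

Lemma sizeW : W = n + q.+1 + T + 1.
Proof. by rewrite /W size_profile /width /size1 -/q -/T addnA. Qed.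

Lemma nth_letter j : j < n -> nth x0 pr j = nth x0 (map inl w) j.
Proof.
by move=> jn; rewrite /pr /profile /profile1 -catA nth_cat size_map -/n jn.
Qed.

Lemma nth_sep : nth x0 pr n = inr (false, false).
Proof. by rewrite /pr /profile /profile1 -catA nth_cat size_map -/n ltnn subnn. Qed.

Lemma nth_free k : k < q -> nth x0 pr (n + k.+1) = inr (false, true).
Proof.
move=> kq; rewrite /pr /profile /profile1 -catA nth_cat size_map -/n.
by rewrite ltnNge leq_addr addKn /= nth_cat size_nseq kq nth_nseq kq.
Qed.

Lemma nth_blank j : n + q.+1 <= j ->
  nth x0 pr j = if j == W.-1 then inr (true, true) else if j < W then inr (true, false) else x0.
Proof.
move=> jq; rewrite sizeW /pr /profile nth_cat size_profile1 /size1 -/n -/q ltnNge jq /=.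
rewrite nth_cat size_nseq -/T; case: ltnP => h.
  by rewrite nth_nseq h; case: eqP => [|_]; [lia|]; rewrite ifT //; lia.
have -> : (j < n + q.+1 + T + 1) = (j == (n + q.+1 + T + 1).-1).
  by apply/idP/eqP; lia.
by case: eqP => [e|e]; [rewrite (_ : _ - _ = 0) //; lia|rewrite nth_default //=; lia].
Qed.

Lemma last_letter j : j < W -> (nth x0 pr j == inr (true, true)) = (j.+1 == W).
Proof.
move=> jW; case: (ltngtP j n) => [lt|gt|->].
- have -> : (j.+1 == W) = false by apply/eqP; rewrite sizeW; lia.
  rewrite nth_letter //; have : nth x0 (map inl w) j \in map inl w by rewrite mem_nth // size_map.
  by case/mapP => s _ ->.
- case: (ltnP j (n + q.+1)) => h.
    have -> : (j.+1 == W) = false by apply/eqP; rewrite sizeW; lia.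
    by rewrite (_ : j = n + (j - n.+1).+1) ?nth_free //; lia.
  rewrite nth_blank // jW (_ : (j.+1 == W) = (j == W.-1)); last by apply/eqP/eqP; lia.
  by case: (j == W.-1).
- have -> : (n.+1 == W) = false by apply/eqP; rewrite sizeW; lia.
  by rewrite nth_sep.
Qed.

Let word (y : seq B) : seq (option (A + B)) :=
  map (fun s => Some (inl s)) w ++ None :: map (fun b => Some (inr b)) y.

Let c0 (y : seq B) := init (map code (word y) : seq (symbol M)).

Lemma nth_code y j : nth bl (map code (word y)) j =
  if j < n then nth bl (map (fun s => code (Some (inl s))) w) j
  else if j == n then code None
  else nth bl (map (fun b => code (Some (inr b))) y) (j - n.+1).
Proof.
rewrite /word map_cat nth_cat !size_map -/n /= -!map_comp; case: (ltnP j n) => // h.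
case: eqP => [->|ne]; first by rewrite subnn.
by rewrite (_ : j - n = (j - n.+1).+1) //; lia.
Qed.

Lemma content0 y j : content (c0 y) j =
  [ffun t => (bl, if t == ord0 then nth bl (map code (word y)) j else bl)].
Proof.
by apply/ffunP => t; rewrite !ffunE /=; case: eqP => _ /=; rewrite nth_nil.
Qed.

Lemma starts_content y j : size y <= q -> starts (nth x0 pr j) (content (c0 y) j).
Proof.
move=> yq; rewrite /starts content0; apply/and3P; split.
- by apply/forallP => t; rewrite ffunE.
- by apply/forallP => t; apply/implyP => /negPf nt; rewrite ffunE nt.
rewrite ffunE eqxx /= nth_code; case: (ltngtP j n) => [lt|gt|->]; last by rewrite nth_sep.
  (* [nth_map] needs a default in [A]; there is one because position [j] lies inside [w]. *)
  have [s0 _] : exists s0 : A, true by move: lt; rewrite /n; case: (w) => [|s0 w'] // _; exists s0.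
  by rewrite nth_letter // !(nth_map s0).
case: (ltnP j (n + q.+1)) => h.
  rewrite {1}(_ : j = n + (j - n.+1).+1) ?nth_free //; [|lia|lia].
  case: (ltnP (j - n.+1) (size y)) => hy; last by rewrite nth_default ?size_map // eqxx.
  case ys: y hy => [//|b y'] hy; rewrite -ys in hy *.
  by apply/orP; right; apply/existsP; exists (nth b y (j - n.+1)); rewrite (nth_map b).
rewrite nth_blank // nth_default ?size_map ?eqxx; last by lia.
by do 2?case: ifP.
Qed.

(** The freedom left in the first row is exactly the choice of a certificate. *)
Lemma content_starts (f : nat -> column) :
  (forall j, j < W -> starts (nth x0 pr j) (f j)) ->
  (forall j, j.+1 < W -> nth x0 pr j = inr (false, true) ->
     (f j ord0).2 = bl -> (f j.+1 ord0).2 = bl) ->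
  exists2 y, size y <= q & forall j, j < W -> f j = content (c0 y) j.
Proof.
move=> hs hm.
(* The cells before the first blank spell [y], and blanks propagate to the end of the area. *)
have free_word m (g : nat -> Sym) :
    (forall k, k < m -> g k = bl \/ exists b, g k = code (Some (inr b))) ->
    (forall k, k.+1 < m -> g k = bl -> g k.+1 = bl) ->
    exists2 y : seq B, size y <= m &
      forall k, k < m -> g k = nth bl (map (fun b => code (Some (inr b))) y) k.
  elim: m g => [|m IH] g hg hb; first by exists [::].
  case: (hg 0 isT) => [g0|[b g0]].
    exists [::] => // k; rewrite nth_nil; elim: k => // k IHk km.
    by apply: hb => //; apply: IHk; exact: ltnW.
  have [k km|k km|y ym yE] := IH (fun k => g k.+1); [exact: hg|exact: hb|].
  by exists (b :: y) => // -[|k] km //=; exact: yE.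
have [k kq|k kq e|y yq yE] := free_word q (fun k => (f (n + k.+1) ord0).2).
- have kW : n + k.+1 < W by rewrite sizeW; lia.
  have /and3P [_ _] := hs _ kW; rewrite nth_free //.
  by case/orP => [/eqP|/existsP [b /eqP]] h; [left|right; exists b].
- rewrite [n + k.+2]addnS; apply: hm => //; first by rewrite sizeW; lia.
  by rewrite nth_free // ltnW.
exists y => // j jW; have /and3P [/forallP h1 /forallP h2 h3] := hs j jW.
rewrite content0; apply/ffunP => t; rewrite ffunE.
rewrite [LHS]surjective_pairing (eqP (h1 t)); congr pair.
case: eqP => [->|/eqP nt]; last by apply/eqP; apply: (implyP (h2 t)).
rewrite nth_code; case: (ltngtP j n) => [lt|gt|e].
- move: h3; rewrite nth_letter //.
  have [s0 _] : exists s0 : A, true by move: lt; rewrite /n; case: (w) => [|s0 w'] // _; exists s0.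
  by rewrite !(nth_map s0) // => /eqP.
- case: (ltnP j (n + q.+1)) => h.
    have := yE (j - n.+1); rewrite (_ : n + (j - n.+1).+1 = j); last by lia.
    by apply; lia.
  rewrite nth_default ?size_map; last by lia.
  by move: h3; rewrite nth_blank //; do 2?case: ifP => _; move/eqP.
- by move: h3; rewrite e nth_sep => /eqP.
Qed.

Variable Rel : seq A -> seq B -> Prop.
Hypothesis decides : forall z,
  let c := run (map code z) (poly_bound a' d' (size z)) in
  halting c.1 /\ (accepting c.1 <-> pair_language Rel z).

Lemma pair_language_word y : pair_language Rel (word y) <-> Rel w y.
Proof.
split=> [[w' [y' [e h]]]|h]; last by exists w, y.
have inj : w = w' /\ y = y'.
  move: e; rewrite /word {h}; elim: (w) w' => [|s v IH] [|s' v'] //=.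
    case=> e; split=> //; elim: y y' e => [|b y IH] [|b' y'] //= [-> /IH -> //].
  by case=> -> /IH [-> ->].
by case: inj => -> ->.
Qed.

Lemma size_word y : size y <= q -> 0 < size (map code (word y)) <= n + q.+1.
Proof. by move=> yq; rewrite size_map size_cat /= !size_map; lia. Qed.

Let conf y i := run (map code (word y)) i.

Lemma conf_late y i : size y <= q -> T <= i ->
  halting (conf y i).1 /\ (accepting (conf y i).1 <-> Rel w y).
Proof.
move=> yq Ti; have [h1 h2] := decides (word y).
have le : poly_bound a' d' (size (word y)) <= i.
  apply: leq_trans Ti; rewrite /T /poly_bound leq_add2r leq_mul2l.
  have /andP [_] := size_word yq; rewrite size_map => h.
  by apply/orP; right; case: (d') => // e; rewrite leq_exp2r.
by rewrite /conf (run_stable h1 le) -pair_language_word.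
Qed.

(** In [T] steps nothing at this distance is reached, and afterwards the configuration no longer
    changes. *)
Lemma conf_blank y i j : size y <= q -> n + q.+1 + T <= j ->
  content (conf y i) j = [ffun=> (bl, bl)].
Proof.
move=> yq h; have /andP [z0 zq] := size_word yq.
case: (leqP i T) => iT; first by apply: content_blank => //; lia.
have [hl _] := conf_late yq (leqnn T).
by rewrite /conf (run_stable hl (ltnW iT)); apply: content_blank => //; lia.
Qed.

Lemma written_blank y i j : size y <= q -> n + q.+1 + T <= j -> 
  written (conf y i) j = [ffun=> (bl, bl)].
Proof.
move=> yq h; rewrite /written /wrote conf_blank //; apply/ffunP => t; rewrite !ffunE.
by rewrite ifF //; apply/eqP; lia.
Qed.

Let tile_of y i j : tile :=
  let c := conf y i in
  (c.1, heads (content c 0), j == 0, (before c j, written c j, written c j.+1)).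

Lemma accepts_tiling y : size y <= q -> Rel w y -> tiling unary binary x0 pr.
Proof.
move=> yq hR; apply/(tiling_nat _ _ _ (tile_of y 0 0)); exists (tile_of y).
split=> [i j iW jW|i j iW jW|i j iW jW].
- rewrite /unary /tile_of eqxx /=; apply/and4P; split.
  + by apply/implyP => /eqP ->.
  + apply/implyP; rewrite last_letter // => /eqP e.
    by rewrite written_blank //; move: e; rewrite sizeW; lia.
  + apply/implyP; rewrite last_letter // => /eqP e.
    have [|-> h] := @conf_late y i yq; first by move: e; rewrite sizeW; lia.
    exact/h.
  apply/implyP => /eqP ->; apply/and3P; split=> //.
    apply/existsP; exists (content (conf y 0) j); rewrite starts_content // eqxx /=.
    by apply/implyP => /eqP ->.
  apply/implyP => /andP [/eqP fr]; rewrite /written /wrote !ffunE /=.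
  (* A free cell comes after the separator, hence not in column 0, the only one changed by
     writing. *)
  have j0 : (j == 0) = false.
    apply/eqP => e; move: fr; rewrite e; case: (posnP n) => n0.
      by rewrite -[X in nth _ _ X]n0 nth_sep.
    rewrite nth_letter //.
    have : nth x0 (map inl w) 0 \in map inl w by rewrite mem_nth // size_map.
    by case/mapP => s _ ->.
  rewrite j0 !nth_code.
  case: (ltngtP j n) => [lt|gt|e]; last by move: fr; rewrite e nth_sep.
    move: fr; rewrite nth_letter //.
    have : nth x0 (map inl w) j \in map inl w by rewrite mem_nth // size_map.
    by case/mapP => s _ ->.
  have -> : (j.+1 < n) = false by lia.
  have -> : (j.+1 == n) = false by apply/eqP; lia.
  case: (ltnP (j - n.+1) (size y)) => hy.
    have [b0 _] : exists b0 : B, true by case: (y) hy => [//|b0 y' _]; exists b0.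
    by rewrite (nth_map b0) // => /eqP; case: codeP => _ /(_ _ _) h /h.
  by rewrite !nth_default ?size_map //; lia.
- by rewrite /binary /tile_of /= !eqxx.
- have e : conf y i.+1 = step (conf y i) by rewrite /conf /run iterS.
  rewrite /binary /tile_of e -content_step -step_state !eqxx /=.
  by apply/implyP => /eqP ->.
Qed.

Lemma tiling_accepts : tiling unary binary x0 pr -> exists2 y, size y <= q & Rel w y.
Proof.
pose bls : column := [ffun=> (bl, bl)].
move=> /(tiling_nat _ _ _ (start M, [ffun=> bl], true, (bls, bls, bls))).
case=> t [hU hH hV].
pose st i j : state M := (t i j).1.1.1.
pose sc i j : scanned := (t i j).1.1.2.
pose fl i j : bool := (t i j).1.2.
pose pv i j : column := (t i j).2.1.1.
pose cu i j : column := (t i j).2.1.2.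
pose nx i j : column := (t i j).2.2.
have tE i j : t i j = (st i j, sc i j, fl i j, (pv i j, cu i j, nx i j)).
  by rewrite /st /sc /fl /pv /cu /nx; case: (t i j) => [[[? ?] ?] [[? ?] ?]].
have W0 : 0 < W by rewrite sizeW addn1.
have row i j : i < W -> j < W -> st i j = st i 0 /\ sc i j = sc i 0.
  move=> iW; elim: j => // j IH jW; have [<- <-] := IH (ltnW jW).
  by have := hH i j iW jW; rewrite !tE /= => /and4P [/eqP -> /eqP -> _ _].
have pvS i j : i < W -> j.+1 < W -> pv i j.+1 = cu i j.
  by move=> iW jW; have := hH i j iW jW; rewrite !tE /= => /and4P [_ _ /eqP -> _].
have nxS i j : i < W -> j.+1 < W -> nx i j = cu i j.+1.
  by move=> iW jW; have := hH i j iW jW; rewrite !tE /= => /and4P [_ _ _ /eqP ->].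
have flE i j : i < W -> j < W -> fl i j = (j == 0).
  by move=> iW jW; have := hU i j iW jW; rewrite tE /= => /andP [/eqP ->].
have pv0 i : i < W -> pv i 0 = swap (cu i 0).
  by move=> iW; have := hU i 0 iW W0; rewrite tE /= => /and3P [_ /eqP].
have nxl i : i < W -> nx i W.-1 = bls.
  move=> iW; have jW : W.-1 < W by rewrite prednK.
  have := hU i W.-1 iW jW; rewrite tE /= last_letter // prednK // eqxx.
  by case/and3P => _ _ /andP [/eqP].
have init0 j : j < W -> exists y : column,
    [/\ starts (nth x0 pr j) y, cu 0 j = wrote (start M) (sc 0 0) (j == 0) y &
        j = 0 -> sc 0 0 = heads y].
  move=> jW; have := hU 0 j W0 jW; rewrite tE /= => /and5P [_ _ _ _].
  case/and3P => /eqP e /existsP [y /and3P [h1 /eqP h2 h3]] _; exists y.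
  have [e1 e2] := row 0 j W0 jW; rewrite -e -e2 -(flE 0 j) //; split=> // j0.
  by move: h3; rewrite flE // j0 => /eqP.
have st0 : st 0 0 = start M.
  by have := hU 0 0 W0 W0; rewrite tE /= => /and5P [_ _ _ _ /and3P [/eqP]].
have [f hf] : exists f : nat -> column, forall j, j < W ->
    [/\ starts (nth x0 pr j) (f j), cu 0 j = wrote (start M) (sc 0 0) (j == 0) (f j) &
        j = 0 -> sc 0 0 = heads (f j)].
  have [g hg] := fin_all_exists (fun j : 'I_W => init0 j (ltn_ord j)).
  exists (fun j => if insub j is Some j' then g j' else bls) => j jW.
  by rewrite insubT; exact: (hg (Ordinal jW)).
have [y yq fE] : exists2 y, size y <= q & forall j, j < W -> f j = content (c0 y) j.
  apply: content_starts => [j jW|j jW fr fb]; first by case: (hf j jW).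
  have fcu k : k < W -> k != 0 -> (cu 0 k ord0).2 = (f k ord0).2.
    by move=> kW /negPf k0; have [_ -> _] := hf k kW; rewrite ffunE k0.
  have j0 : j != 0.
    apply/eqP => e; move: fr; rewrite e; case: (posnP n) => n0.
      by rewrite -[X in nth _ _ X]n0 nth_sep.
    rewrite nth_letter //.
    have : nth x0 (map inl w) 0 \in map inl w by rewrite mem_nth // size_map.
    by case/mapP => s _ ->.
  rewrite -fcu // -nxS //; have := hU 0 j W0 (ltnW jW).
  rewrite tE /= => /and5P [_ _ _ _ /and3P [_ _]]; rewrite fr eqxx fcu ?fb ?eqxx //; last exact: ltnW.
  by move/eqP.
exists y => //.
(* Row by row the tiles reproduce the run on the certificate read off row 0. *)
have main i : i < W -> [/\ st i 0 = (conf y i).1, sc i 0 = heads (content (conf y i) 0) &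
    forall j, j < W -> cu i j = written (conf y i) j].
  elim: i => [|i IH] iW.
    have s0 : sc 0 0 = heads (content (conf y 0) 0).
      by have [_ _ ->] := hf 0 W0; rewrite ?fE.
    split=> // j jW; have [_ -> _] := hf j jW; rewrite s0 fE //.
  have [e1 e2 e3] := IH (ltnW iW).
  have e : conf y i.+1 = step (conf y i) by rewrite /conf /run iterS.
  have sl j : j < W -> slides (st i j) (sc i j) (pv i j) (cu i j) (nx i j) = content (conf y i.+1) j.
    move=> jW; have [-> ->] := row i j (ltnW iW) jW.
    rewrite e content_step e1 e2; congr slides.
    - case: j jW => [|j] jW /=; first by rewrite pv0 ?(ltnW iW) // e3.
      by rewrite pvS ?(ltnW iW) // e3 // ltnW.
    - exact: e3.
    case: (ltnP j.+1 W) => jW'; first by rewrite nxS ?(ltnW iW) // e3.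
    have ej : j = W.-1 by lia.
    by rewrite ej nxl ?(ltnW iW) // prednK // written_blank // sizeW; lia.
  have hv j : j < W -> [/\ st i.+1 j = (action (st i j) (sc i j)).1.1,
      cu i.+1 j = wrote (st i.+1 j) (sc i.+1 j) (j == 0) (content (conf y i.+1) j) &
      j = 0 -> sc i.+1 j = heads (content (conf y i.+1) j)].
    move=> jW; have := hV i j iW jW; rewrite !tE /= sl // flE //.
    case/and3P => /eqP -> /eqP -> h; split=> // j0.
    by move: h; rewrite j0 => /eqP.
  have [s1 _ s2] := hv 0 W0.
  have s1' : st i.+1 0 = (conf y i.+1).1 by rewrite s1 e1 e2 e step_state.
  split=> //; first exact: s2.
  move=> j jW; have [_ -> _] := hv j jW; have [-> ->] := row _ _ iW jW.
  by rewrite s1' s2.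
(* The last row is not before time [T], when the verdict of the verifier has been reached. *)
have lW : W.-1 < W by rewrite prednK.
have := hU W.-1 0 lW W0; rewrite tE /= (last_letter lW) prednK //.
case/and5P => _ _ _ /implyP /(_ (eqxx W)) /andP [_]; have [-> _ _] := main _ lW => acc _.
have TW : T <= W.-1 by rewrite sizeW; lia.
by have [_ <-] := conf_late yq TW.
Qed.

End Word.

End CookLevin.

Lemma NP_hard_Vfree :
  NP_hard (problem_language encode_bigraph
    (fun G : bigraph => max_degree (edges G) <= 4)
    has_Vfree_2matching_covering_T).
Proof.
move=> A L [B [Rel [a [d [[M [code [a' [d' [codeP decides]]]]] certP]]]]].
pose t0 : tile M := (start M, [ffun=> blank M], true,
  ([ffun=> (blank M, blank M)], [ffun=> (blank M, blank M)], [ffun=> (blank M, blank M)])).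
exists (fun w => encode_bigraph (graph (inr (true, true)) t0 (unary code) (@binary M) (profile a d a' d' w))).
split; first exact: generator_poly_time.
move=> w; rewrite certP; split=> [[y [yq h]]|[G [/encode_bigraph_inj <- _]]].
  eexists; split; first by reflexivity.
    exact: graph_degree.
  by apply/graph_tiling; apply: (accepts_tiling codeP decides yq h).
by move/graph_tiling/(tiling_accepts decides) => [y yq h]; exists y.
Qed.

(** * A verifier for matchings *)

(** The ranges enforce the degree bounds: ['I_5] admits 4 edges of the graph, ['I_3] admits 2 of the
    matching. *)
Definition counts : finType := ('I_5 * 'I_3 * bool)%type.
Definition cert : finType := option (bool * counts * counts).
Definition symb : finType := option bool.

Definition zero_counts : counts := (ord0, ord0, false).

(* A certificate letter for a matrix entry holds: the entry of the matching, the
   number of edges and of matching edges of its row so far, whether the row so far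
   has a matching edge into a column of matching degree 2, the number of edges and
   of matching edges of its column so far, and whether the latter ends at 2. *)
Definition local (prev : cert) (e : symb) (b up : cert) : bool :=
  match e, b, up with
  | Some e, Some (m, (re, rm, rh), (ce, cm, cf)), Some (_, _, (ce0, cm0, cf0)) =>
    let: (re0, rm0, rh0) := if prev is Some (_, r, _) then r else zero_counts in
    [&& m ==> e, re == re0 + e :> nat, rm == rm0 + m :> nat, rh == rh0 || (m && cf),
        ce == ce0 + e :> nat, cm == cm0 + m :> nat & cf == cf0]
  | None, None, None =>
    if prev is Some (_, (_, rm, rh), _) then (rm == 2 :> nat) ==> rh else true
  | _, _, _ => false
  end.

Definition top (e : symb) (b : cert) : bool :=
  if b is Some (_, _, (ce, cm, _)) then [&& e == Some true, ce == 0 :> nat & cm == 0 :> nat]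
  else false.

(** Checks the guess carried down the column from the top row. A final count of 1 or 2 also means
    that the T-node is covered. *)
Definition bottom (b : cert) : bool :=
  if b is Some (_, _, (_, cm, cf)) then cm == (if cf then 2 else 1) :> nat else true.

Definition onthb (T : Type) (s : seq T) (i : nat) : option T := nth None (map Some s) i.

(** Follows the passes of the machine. [k], the number of columns, is read off the certificate;
    running past the end of a word fails the test. The last [None] tests say that [w] is no longer
    than [y] and that [y] ends with a complete row. *)
Definition accept (w : seq symb) (y : seq cert) : bool :=
  let k := find (pred1 None) y in
  let n := size y in
  [&& all (fun i => match onthb w i, onthb y i with
                    | Some e, Some b => top e b | _, _ => false end) (iota 0 k),
      onthb w k == Some None, onthb y k == Some None,
      all (fun i => match onthb w i, onthb y i, onthb y (i - k.+1) with
                    | Some e, Some b, Some up => local (odflt None (onthb y i.-1)) e b up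
                    | _, _, _ => false end) (iota k.+1 (n - k.+1)),
      onthb w (k.+1 + (n - k.+1)) == None,
      odflt None (onthb y (k.+1 + (n - k.+1)).-1) == None &
      all (fun i => if onthb y i is Some b then bottom b else false)
        (iota (n - k.+1) (n - (n - k.+1)))].

Section Verifier.
Let G : finType := option (symb + cert).
Let X : finType := option (option bool).
Let tz : X := None.
Let tw : X := Some (Some false).
Let ty : X := Some (Some true).
Let tv : X := Some None.
Let Q : finType := (bool * bool * cert)%type.
Let la (e : symb) : G := Some (inl e).
Let lb (b : cert) : G := Some (inr b).
Let ua (o : option G) : option symb := if o is Some (Some (inl e)) then Some e else None.
Let ub (o : option G) : option cert := if o is Some (Some (inr b)) then Some b else None.

(** The fold computed by the copying pass; misplaced letters are dropped and clear the flag [ok]. *)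
Definition parse1 (s : bool * bool * seq symb * seq cert) (l : G) :=
  let: (seen, ok, w, y) := s in
  match l with
  | None => (true, ok && ~~ seen, w, y)
  | Some (inl e) => if seen then (seen, false, w, y) else (seen, ok, rcons w e, y)
  | Some (inr b) => if seen then (seen, ok, w, rcons y b) else (seen, false, w, y)
  end.

Definition parse (z : seq G) := foldl parse1 (false, true, [::], [::]) z.

Let word (w : seq symb) (y : seq cert) : seq G := map la w ++ None :: map lb y.

Lemma parse_word w y : parse (word w y) = (true, true, w, y).
Proof.
rewrite /parse /word foldl_cat /=.
have h1 v : foldl parse1 (false, true, v, [::]) (map la w) = (false, true, v ++ w, [::]).
  by elim: w v => [|e w IH] v; rewrite ?cats0 //= IH cat_rcons.
have h2 v : foldl parse1 (true, true, w, v) (map lb y) = (true, true, w, v ++ y).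
  by elim: y v => [|e y IH] v; rewrite ?cats0 //= IH cat_rcons.
by rewrite h1 /= h2.
Qed.

Lemma parse_ok z seen w y : parse z = (seen, true, w, y) ->
  z = if seen then word w y else map la w.
Proof.
have : (let: (seen, ok, w, y) := parse z in
  ok -> z = (if seen then word w y else map la w) /\ (~~ seen -> y = [::])).
  elim/last_ind: z => [|z l IH] //; rewrite /parse foldl_rcons -/(parse z).
  case: (parse z) IH => [[[s ok] w'] y'] IH; case: l => [[e|b]|] /=; case: s IH => IH //.
  - by move=> /IH [-> h]; split=> //; rewrite map_rcons.
  - by move=> /IH [-> h]; split=> //; rewrite /word map_rcons -!cats1 -catA.
  - by rewrite andbF.
  - by rewrite andbT => /IH [-> h]; split=> //; rewrite h // /word cats1.
by move=> + e; rewrite e => /(_ isT) [].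
Qed.

Lemma parse_size z : let: (_, _, w, y) := parse z in size w <= size z /\ size y <= size z.
Proof.
elim/last_ind: z => [|z l IH] //; rewrite /parse foldl_rcons -/(parse z) size_rcons.
case: (parse z) IH => [[[s ok] w'] y'] [h1 h2].
by case: l => [[e|b]|] /=; case: s => //=; rewrite ?size_rcons; rewrite ?ltnS; split=> //; exact: leqW.
Qed.

Let put (b : bool) (l : G) : option G * move := if b then (Some l, MoveRight) else (None, Stay).
Let go (l : seq X) (x : X) : option G * move := (None, if x \in l then MoveRight else Stay).

(** [parse1] is called with empty words because the flags do not depend on them. *)
Let copy_prog : prog G Q X := While (on tz) (Act (fun q r =>
  let: (seen, ok, reg) := q in
  if r tz is Some l then
    let: (seen', ok', _, _) := parse1 (seen, ok, [::], [::]) l in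
    ((seen', ok', reg), fun x =>
      if x == tz then (None, MoveRight)
      else if x == tw then put (~~ seen && (ua (Some l) != None)) l
      else put (seen && (ub (Some l) != None)) l)
  else (q, fun x => (None, Stay)))).

Let top_prog : prog G Q X := While (fun _ r => if ub (r ty) is Some (Some _) then true else false)
  (Act (fun q r => let: (seen, ok, reg) := q in
    ((seen, ok && (match ua (r tw), ub (r ty) with Some e, Some b => top e b | _, _ => false end), reg),
     go [:: tw; ty]))).

Let skip_prog : prog G Q X := Act (fun q r => let: (seen, ok, reg) := q in
  ((seen, [&& ok, ua (r tw) == Some None & ub (r ty) == Some None], None), go [:: tw; ty])).

(** The head of [tv] still stands at 0 when [ty] has passed the first row, which makes the delay;
    the control state keeps the previous letter of [ty]. *)
Let main_prog : prog G Q X := While (on ty) (Act (fun q r => let: (seen, ok, reg) := q in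
  ((seen, ok && (match ua (r tw), ub (r ty), ub (r tv) with
      Some e, Some b, Some up => local reg e b up | _, _, _ => false end), odflt None (ub (r ty))),
     go [:: tw; ty; tv]))).

Let end_prog : prog G Q X := Act (fun q r => let: (seen, ok, reg) := q in
  ((seen, [&& ok, ua (r tw) == None & reg == None], reg), go [::])).

(** Thanks to the delay, the head of [tv] already stands at the beginning of the last row. *)
Let bottom_prog : prog G Q X := While (on tv) (Act (fun q r => let: (seen, ok, reg) := q in
  ((seen, ok && (if ub (r tv) is Some b then bottom b else false), reg), go [:: tv]))).

Let verifier : prog G Q X := Seq copy_prog (Seq (seqs (map (@Rewind G Q X) [:: tw; ty; tv]))
  (Seq top_prog (Seq skip_prog (Seq main_prog (Seq end_prog bottom_prog))))).

Lemma runs_iter (b : Q -> {ffun X -> option G} -> bool) p (g : nat -> Q * store G X) k :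
  (forall i, i < k -> b (g i).1 (reading (g i).2) /\ runs p (g i) 1 (g i.+1)) ->
  ~~ b (g k).1 (reading (g k).2) ->
  runs (While b p) (g 0) (k * 2 + 1) (g k).
Proof.
elim: k g => [|k IH] g hg hk.
  by move: hk; case: (g 0) => q s; exact: runs_stop.
have := IH (fun i => g i.+1) (fun i => hg i.+1) hk.
have [h1 h2] := hg 0 isT; case: (g 0) h1 h2 => q s h1 h2 h3.
by apply: runs_le (runs_loop h1 h2 h3) _; lia.
Qed.

Let U (z : seq G) (w : seq symb) (y : seq cert) (x : X) : seq G :=
  match x with None => z | Some None => map lb y
  | Some (Some false) => map la w | Some (Some true) => map lb y end.

Let H (i j k l : nat) (x : X) : int :=
  match x with None => i%:Z%R | Some None => l%:Z%R
  | Some (Some false) => j%:Z%R | Some (Some true) => k%:Z%R end.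

Lemma run_copy z seen ok w y : parse z = (seen, ok, w, y) ->
  runs copy_prog ((false, true, None), (U z [::] [::], fun=> 0%R)) (size z * 2 + 1)
    ((seen, ok, None), (U z w y, H (size z) (size w) (size y) (size y))).
Proof.
move=> pz.
pose g i : Q * store G X := let: (seen, ok, w, y) := parse (take i z) in
  ((seen, ok, None), (U z w y, H i (size w) (size y) (size y))).
have gz : g (size z) = ((seen, ok, None), (U z w y, H (size z) (size w) (size y) (size y))).
  by rewrite /g take_size pz.
have g0 : g 0 = ((false, true, None), (U z [::] [::], H 0 0 0 0)) by rewrite /g take0.
have h : runs copy_prog (g 0) (size z * 2 + 1) (g (size z)).
  apply: runs_iter.
  - move=> i iz; have [l0 _] : exists l0 : G, true by exists None.
    rewrite /g (take_nth l0) // /parse foldl_rcons -/(parse _); set l := nth l0 z i.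
    have gl : get z i%:Z%R = Some l by rewrite /get (nth_map l0).
    case: (parse (take i z)) => [[[sn k] w'] y'].
    case e: (parse1 (sn, k, w', y') l) => [[[sn' k'] w''] y'']; split.
      by rewrite /on ffunE /= gl.
    apply: runs_act; rewrite /reading !ffunE /= gl.
      by move: e; rewrite /parse1; case: l {gl} => [[a|b]|]; case: sn => -[<- <- _ _].
    case e2: (parse1 (sn, k, [::], [::]) l) => [[[? ?] ?] ?] x /=.
    move: e; rewrite /parse1 {e2 gl}; case: l => [[a|b]|]; case: sn => -[_ _ <- <-];
      case: x => [[[]|]|] /=; rewrite ?GRing.addr0 ?size_map ?map_rcons ?size_rcons //; split=> //; lia.
  - by rewrite gz /= /on ffunE /= /get nth_default ?size_map.
by rewrite gz g0 in h; apply: runs_ext h _ _; split=> // -[[[]|]|].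
Qed.

Lemma run_rewinds z seen ok w y q : parse z = (seen, ok, w, y) ->
  runs (seqs (map (@Rewind G Q X) [:: tw; ty; tv]))
    (q, (U z w y, H (size z) (size w) (size y) (size y))) (3 * (size z * 2 + 3) + 1)
    (q, (U z w y, H (size z) 0 0 0)).
Proof.
move=> pz; have := parse_size z; rewrite pz => -[sw sy].
have h := @runs_rewinds G Q X q [:: tw; ty; tv]
  (U z w y, H (size z) (size w) (size y) (size y)) (size z).
apply: runs_extr (h _ _) _.
- by move=> x; rewrite !inE => /or3P [] /eqP -> /=; rewrite size_map; lia.
- by move=> x; rewrite !inE => /or3P [] /eqP -> /=; rewrite size_map.
by split=> // -[[[]|]|] //.
Qed.

Lemma all_iotaS (P : pred nat) m i : all P (iota m i.+1) = all P (iota m i) && P (m + i).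
Proof. by rewrite -addn1 iotaD all_cat /= andbT. Qed.

Lemma all_iotaP (P : pred nat) m k : exists A : nat -> bool,
  [/\ A 0 = true, forall i, A i.+1 = A i && P (m + i) & all P (iota m k) = A k].
Proof.
by exists (fun i => all P (iota m i)); split=> // i; rewrite all_iotaS.
Qed.

Section Scans.
Variables (z : seq G) (w : seq symb) (y : seq cert) (seen : bool).
Let k := find (pred1 None) y.
Let n := size y.
Let m := n - k.+1.
Let S (i j l : nat) : store G X := (U z w y, H (size z) i j l).

Let P1 i := match onthb w i, onthb y i with Some e, Some b => top e b | _, _ => false end.
Let P2 i := match onthb w i, onthb y i, onthb y (i - k.+1) with
  | Some e, Some b, Some up => local (odflt None (onthb y i.-1)) e b up
  | _, _, _ => false end.
Let P3 i := if onthb y i is Some b then bottom b else false.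

Lemma ua_get i : ua (get (map la w) (Posz i)) = onthb w i.
Proof.
rewrite /get /onthb; case: (ltnP i (size w)) => h; last by rewrite !nth_default ?size_map.
have [e0 _] : exists e0 : symb, true by exists None.
by rewrite -map_comp !(nth_map e0).
Qed.

Lemma ub_get i : ub (get (map lb y) (Posz i)) = onthb y i.
Proof.
rewrite /get /onthb; case: (ltnP i (size y)) => h; last by rewrite !nth_default ?size_map.
have [e0 _] : exists e0 : cert, true by exists None.
by rewrite -map_comp !(nth_map e0).
Qed.

Lemma onth_some i : i < n -> onthb y i = Some (nth None y i).
Proof. by move=> h; rewrite /onthb (nth_map None). Qed.

Lemma run_top ok reg : runs top_prog ((seen, ok, reg), S 0 0 0) (k * 2 + 1)
  ((seen, ok && all P1 (iota 0 k), reg), S k k 0).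
Proof.
have [A [A0 AS ->]] := all_iotaP P1 0 k.
have := @runs_iter (fun _ r => if ub (r ty) is Some (Some _) then true else false) _
  (fun i => ((seen, ok && A i, reg), S i i 0)) k.
rewrite /= A0 andbT; apply.
  move=> i ik; rewrite !ffunE /= ub_get; have iy : i < n.
    by apply: leq_trans ik _; exact: find_size.
  split; first by have := before_find None ik; rewrite onth_some //=; case: (nth _ _ _).
  apply: runs_act; rewrite /reading ?ffunE /= ?ua_get ?ub_get.
    by rewrite AS andbA.
  by move=> x; case: x => [[[]|]|] /=; split=> //; lia.
rewrite ffunE /= ub_get; case: (ltnP k n) => h; last by rewrite /onthb nth_default ?size_map.
rewrite onth_some //; have : has (pred1 None) y by rewrite has_find.
by move/(nth_find None) => /= /eqP ->.
Qed.

Lemma run_skip ok reg : runs skip_prog ((seen, ok, reg), S k k 0) 1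
  ((seen, [&& ok, onthb w k == Some None & onthb y k == Some None], None), S k.+1 k.+1 0).
Proof.
apply: runs_act; rewrite /reading ?ffunE /= ?ua_get ?ub_get //.
by move=> x; case: x => [[[]|]|] /=; split=> //; lia.
Qed.

Lemma run_main ok : runs main_prog ((seen, ok, None), S k.+1 k.+1 0) (m * 2 + 1)
  ((seen, ok && all P2 (iota k.+1 m), odflt None (onthb y (k.+1 + m).-1)),
   S (k.+1 + m) (k.+1 + m) m).
Proof.
have [A [A0 AS ->]] := all_iotaP P2 k.+1 m.
have := @runs_iter (on ty) _ (fun i => ((seen, ok && A i,
  odflt None (onthb y (k.+1 + i).-1)), S (k.+1 + i) (k.+1 + i) i)) m.
have yk : odflt None (onthb y k) = None.
  case: (ltnP k n) => h; last by rewrite /onthb nth_default ?size_map.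
  rewrite onth_some //; have : has (pred1 None) y by rewrite has_find.
  by move/(nth_find None) => /= /eqP ->.
rewrite /= !addn0 A0 andbT /= yk; apply.
  move=> i im; rewrite /on !ffunE /= get_in size_map.
  split; first by rewrite -ltn_subRL.
  apply: runs_act; rewrite /reading ?ffunE /= ?ua_get ?ub_get.
    by rewrite AS andbA /P2 addKn addnS.
  by move=> x; case: x => [[[]|]|] /=; split=> //; lia.
by rewrite /on ffunE /= get_in size_map -leqNgt -leq_subLR.
Qed.

Lemma run_end ok reg : runs end_prog ((seen, ok, reg), S (k.+1 + m) (k.+1 + m) m) 1
  ((seen, [&& ok, onthb w (k.+1 + m) == None & reg == None], reg), S (k.+1 + m) (k.+1 + m) m).
Proof.
apply: runs_act; rewrite /reading ?ffunE /= ?ua_get ?ub_get //.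
by move=> x; rewrite /= GRing.addr0.
Qed.

Lemma run_bottom ok reg j : runs bottom_prog ((seen, ok, reg), S j j m) ((n - m) * 2 + 1)
  ((seen, ok && all P3 (iota m (n - m)), reg), S j j n).
Proof.
have [A [A0 AS ->]] := all_iotaP P3 m (n - m).
have := @runs_iter (on tv) _ (fun i => ((seen, ok && A i, reg), S j j (m + i))) (n - m).
rewrite /= addn0 A0 andbT subnKC ?leq_subr //; apply.
  move=> i im; rewrite /on !ffunE /= get_in size_map; split; first by rewrite -ltn_subRL.
  apply: runs_act; rewrite /reading ?ffunE /= ?ua_get ?ub_get.
    by rewrite AS andbA.
  by move=> x; case: x => [[[]|]|] /=; split=> //; lia.
by rewrite /on ffunE /= get_in size_map ltnn.
Qed.

End Scans.

Lemma run_verifier z seen ok w y : parse z = (seen, ok, w, y) ->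
  exists reg s, runs verifier ((false, true, None), (fun x => if x == tz then z else [::], fun=> 0%R))
    (poly_bound 40 1 (size z)) ((seen, ok && accept w y, reg), s).
Proof.
move=> pz; have := parse_size z; rewrite pz => -[sw sy].
set k := find (pred1 None) y; set n := size y; set m := n - k.+1.
have kn : k <= n by exact: find_size.
(* Every pass is linear in the input; 40 is a generous constant for their sum. *)
do 2 eexists; rewrite /accept -/k -/n -/m; apply: runs_le (_ : runs _ _ ((size z * 2 + 1) +
  ((3 * (size z * 2 + 3) + 1) + ((k * 2 + 1) + (1 + ((m * 2 + 1) + (1 + ((n - m) * 2 + 1))))))) _) _;
  last by rewrite /poly_bound expn1; move: sy; rewrite -/n /m; lia.
apply: runs_seq.
  apply: runs_ext (run_copy pz) _ _; last by split.
  by split=> // -[[[]|]|].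
apply: runs_seq (run_rewinds _ pz) _.
apply: runs_seq (run_top _ _ _ _ _ _) _.
apply: runs_seq (run_skip _ _ _ _ _ _) _.
apply: runs_seq (run_main _ _ _ _ _) _.
apply: runs_seq (run_end _ _ _ _ _ _) _.
have := run_bottom z w y seen.
move=> h; rewrite -/k -/n -/m in h; rewrite !andbA; exact: h.
Qed.

Lemma accept_in_P : in_P (pair_language (fun w y => accept w y)).
Proof.
have [enc [dec [encK e0 e1]]] := tape_names bool.
exists (compile enc dec verifier (false, true, None) (fun q => q.1.1 && q.1.2)), Some, 40, 1.
split; first by split=> // x y [].
move=> z c; rewrite {}/c.
case pz: (parse z) => [[[seen ok] w] y].
have [reg [s [m mT /(exec_run encK) h]]] := run_verifier pz.
have [hh -> _] := h (fun q => q.1.1 && q.1.2) _ e0 mT; split=> //=; split.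
  move=> /andP [hs /andP [hok ha]]; rewrite hs hok in pz.
  by exists w, y; rewrite (parse_ok pz).
move=> [w' [y' [ez ha]]]; have := parse_word w' y'.
by rewrite /word -ez pz => -[-> -> -> ->].
Qed.

End Verifier.

(** * The certificate of a given matching is accepted *)

Definition at_nat (n m : nat) (F : 'I_n -> 'I_m -> bool) (s t : nat) : bool :=
  match insub s, insub t with Some s', Some t' => F s' t' | _, _ => false end.

Lemma at_natE n m (F : 'I_n -> 'I_m -> bool) (s : 'I_n) (t : 'I_m) : at_nat F s t = F s t.
Proof.
rewrite /at_nat (insubT (fun i => i < n) (ltn_ord s)) (insubT (fun i => i < m) (ltn_ord t)).
by congr F; apply: val_inj.
Qed.

Lemma card_sum n (P : nat -> bool) : #|[set i : 'I_n | P i]| = \sum_(0 <= i < n) P i.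
Proof.
rewrite -sum1_card big_mkcond big_mkord; apply: eq_bigr => i _.
by rewrite inE; case: (P i).
Qed.

(** In base [m.+1] the last digit [m] marks row terminators. Word row 0 is the leading row of ones,
    so matrix row [s] is word row [s.+1]. *)
Definition entry_symbol (m : nat) (E : nat -> nat -> bool) (i : nat) : symb :=
  if i %% m.+1 == m then None
  else Some (if i %/ m.+1 is s.+1 then E s (i %% m.+1) else true).

Lemma encode_mkseq (G : bigraph) (E := at_nat (fun s t => (s, t) \in edges G)) :
  encode_bigraph G = mkseq (entry_symbol (nT G) E) ((nS G).+1 * (nT G).+1).
Proof.
set m := nT G; set n := nS G.
rewrite /mkseq -flatten_map1 flatten_iota_mul.
have rowE r : [seq entry_symbol m E (r * m.+1 + c) | c <- iota 0 m.+1] =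
    rcons [seq Some (if r is s.+1 then E s t else true) | t <- iota 0 m] None.
  rewrite -[X in iota 0 X]addn1 iotaD map_cat cats1 add0n /=; congr rcons.
    apply/eq_in_map => t; rewrite mem_iota add0n => /andP [_ tm].
    rewrite /entry_symbol modnMDl modn_small ?divnMDl ?divn_small ?addn0 // ?ltnS ?(ltnW tm) //.
    by rewrite ltn_eqF.
  by rewrite /entry_symbol modnMDl modn_small // eqxx.
under eq_map => r do rewrite flatten_map1 rowE.
rewrite -[n.+1]add1n iotaD map_cat flatten_cat /= cats0; congr (_ ++ _).
  by congr rcons; rewrite -/m; elim: (m) 0 => //= m' IH j; rewrite -IH.
rewrite (iotaDl 1 0 n) -map_comp -(val_enum_ord n) -map_comp; congr flatten.
apply: eq_map => s /=; congr rcons; rewrite -(val_enum_ord m) -map_comp; apply: eq_map => t /=.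
by rewrite /E at_natE.
Qed.

Lemma onthb_in (T : Type) (x : T) (s : seq T) i : i < size s -> onthb s i = Some (nth x s i).
Proof. by move=> h; rewrite /onthb (nth_map x). Qed.

Lemma onthb_out (T : Type) (s : seq T) i : size s <= i -> onthb s i = None.
Proof. by move=> h; rewrite /onthb nth_default ?size_map. Qed.

Lemma onthb_Some (T : Type) (x : T) (s : seq T) i e : onthb s i = Some e ->
  i < size s /\ nth x s i = e.
Proof.
case: (ltnP i (size s)) => h; last by rewrite onthb_out.
by rewrite (onthb_in x) // => -[].
Qed.

Section Complete.
Variables (n m : nat) (E N : nat -> nat -> bool).
Hypotheses (subEN : forall s t, N s t -> E s t)
  (rowE : forall s, s < n -> \sum_(0 <= t < m) E s t <= 4)
  (colE : forall t, t < m -> \sum_(0 <= s < n) E s t <= 4)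
  (rowN : forall s, s < n -> \sum_(0 <= t < m) N s t <= 2)
  (colN : forall t, t < m -> 0 < \sum_(0 <= s < n) N s t <= 2)
  (locN : forall s, s < n -> \sum_(0 <= t < m) N s t = 2 ->
     exists2 t, t < m & N s t && (\sum_(0 <= s' < n) N s' t == 2)).

Let final t := \sum_(0 <= s < n) N s t == 2.
Let rowst s t : counts := (inord (\sum_(0 <= j < t) E s j), inord (\sum_(0 <= j < t) N s j),
  has (fun j => N s j && final j) (iota 0 t)).
(** In word row [s.+1], both [rowst s t.+1] and [colst s.+1 t] include the present entry; [inord]
    loses nothing thanks to the bounds on the sums. *)
Let colst r t : counts := (inord (\sum_(0 <= s < r) E s t), inord (\sum_(0 <= s < r) N s t), final t).
Let letter i : cert :=
  let r := i %/ m.+1 in let t := i %% m.+1 in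
  if t == m then None else
  Some (if r is s.+1 then N s t else false, if r is s.+1 then rowst s t.+1 else zero_counts, colst r t).
Let w := mkseq (entry_symbol m E) (n.+1 * m.+1).
Let y := mkseq letter (n.+1 * m.+1).

Lemma sum_prefix (F : nat -> nat) a b : a <= b -> \sum_(0 <= i < a) F i <= \sum_(0 <= i < b) F i.
Proof. by move=> ab; rewrite (big_cat_nat _ ab) //= leq_addr. Qed.

Lemma letter_digits r t : t < m -> letter (r * m.+1 + t) =
  Some (if r is s.+1 then N s t else false, if r is s.+1 then rowst s t.+1 else zero_counts, colst r t).
Proof.
move=> tm; rewrite /letter modnMDl modn_small ?divnMDl ?divn_small ?addn0 // ?ltnS ?(ltnW tm) //.
by rewrite ltn_eqF.
Qed.

Lemma letter_end r : letter (r * m.+1 + m) = None.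
Proof. by rewrite /letter modnMDl modn_small // eqxx. Qed.

Lemma symbol_digits r t : t < m -> entry_symbol m E (r * m.+1 + t) =
  Some (if r is s.+1 then E s t else true).
Proof.
move=> tm; rewrite /entry_symbol modnMDl modn_small ?divnMDl ?divn_small ?addn0 // ?ltnS ?(ltnW tm) //.
by rewrite ltn_eqF.
Qed.

Lemma symbol_end r : entry_symbol m E (r * m.+1 + m) = None.
Proof. by rewrite /entry_symbol modnMDl modn_small // eqxx. Qed.

Lemma find_y : find (pred1 None) y = m.
Proof.
have mN : m < size y by rewrite size_mkseq; nia.
have ym : nth None y m = None.
  rewrite nth_mkseq; last by rewrite size_mkseq in mN.
  by have := letter_end 0; rewrite mul0n add0n.
have hs : has (pred1 None) y by apply/hasP; exists (nth None y m); [exact: mem_nth|rewrite /= ym].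
case: (ltngtP (find (pred1 None) y) m) => // lt.
  have /eqP := nth_find None hs; rewrite nth_mkseq; last by rewrite size_mkseq in mN; apply: ltn_trans lt mN.
  by have := letter_digits 0 lt; rewrite mul0n add0n => ->.
by have /= := before_find None lt; rewrite ym eqxx.
Qed.

Lemma rowstS s t : rowst s t.+1 =
  (inord (\sum_(0 <= j < t) E s j + E s t), inord (\sum_(0 <= j < t) N s j + N s t),
   has (fun j => N s j && final j) (iota 0 t) || (N s t && final t)).
Proof.
have e : iota 0 t.+1 = iota 0 t ++ [:: t] by rewrite -[t.+1]addn1 iotaD.
by rewrite /rowst e has_cat !big_nat_recr //= orbF.
Qed.

Lemma local_digits s t : s < n -> t < m ->
  local (letter (s.+1 * m.+1 + t).-1) (Some (E s t)) (letter (s.+1 * m.+1 + t)) (letter (s * m.+1 + t)).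
Proof.
move=> sn tm; rewrite !letter_digits // rowstS /=.
have -> : (if letter (s.+1 * m.+1 + t).-1 is Some (_, r, _) then r else zero_counts) = rowst s t.
  case: t tm => [|t] tm.
    (* The letter before the first entry of a row is a terminator, so counting restarts from
       [zero_counts]. *)
    have -> : (s.+1 * m.+1 + 0).-1 = s * m.+1 + m by rewrite mulSn; lia.
    rewrite letter_end.
    by rewrite /rowst !big_geq //; congr (_, _, _); apply: val_inj; rewrite /= inordK.
  by rewrite addnS /= letter_digits // ltnW.
have bE b : (b : bool) <= 1 by case: b.
have sE j : j <= m -> \sum_(0 <= i < j) E s i < 5.
  by move=> jm; rewrite ltnS (leq_trans (sum_prefix _ jm)) ?rowE.
have sN j : j <= m -> \sum_(0 <= i < j) N s i < 3.
  by move=> jm; rewrite ltnS (leq_trans (sum_prefix _ jm)) ?rowN.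
have cE j : j <= n -> \sum_(0 <= i < j) E i t < 5.
  by move=> jm; rewrite ltnS (leq_trans (sum_prefix (fun i => E i t) jm)) ?colE.
have cN j : j <= n -> \sum_(0 <= i < j) N i t < 3.
  by move=> jm; rewrite ltnS (leq_trans (sum_prefix (fun i => N i t) jm)) //; case/andP: (colN tm).
have := sE t.+1 tm; have := sN t.+1 tm; have := cE s.+1 sn; have := cN s.+1 sn.
rewrite !big_nat_recr //= => h1 h2 h3 h4.
rewrite !inordK ?sE ?sN ?cE ?cN // ?(ltnW tm) ?(ltnW sn) //.
rewrite !eqxx /= !andbT; exact/implyP/subEN.
Qed.

Let S := n.+1 * m.+1.

Lemma wE i : i < S -> onthb w i = Some (entry_symbol m E i).
Proof. by move=> iS; rewrite (onthb_in None) ?size_mkseq // nth_mkseq. Qed.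

Lemma yE i : i < S -> onthb y i = Some (letter i).
Proof. by move=> iS; rewrite (onthb_in None) ?size_mkseq // nth_mkseq. Qed.

Lemma accept_complete : accept w y.
Proof.
rewrite /accept find_y size_mkseq -/S.
have SE : S - m.+1 = n * m.+1 by rewrite /S mulSn addKn.
have SE' : m.+1 + n * m.+1 = S by rewrite /S mulSn.
have SE2 : S - n * m.+1 = m.+1 by rewrite -SE' addnK.
have mS : m < S by rewrite -SE' ltnS leq_addr.
have SE3 : S.-1 = n * m.+1 + m by rewrite -SE' addnC addnS.
rewrite SE SE' SE2 SE3.
have L0 t : t < m -> letter t = Some (false, zero_counts, colst 0 t).
  by move=> tm; have := letter_digits 0 tm; rewrite mul0n add0n.
have sumN0 t : t < m -> \sum_(0 <= s < n) N s t < 3.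
  by move=> tm; rewrite ltnS; case/andP: (colN tm).
have wm : onthb w m = Some None by rewrite wE //; have := symbol_end 0; rewrite mul0n add0n => ->.
have ym : onthb y m = Some None by rewrite yE //; have := letter_end 0; rewrite mul0n add0n => ->.
rewrite wm ym !eqxx !andTb; apply/and5P; split.
- apply/allP => t; rewrite mem_iota add0n => /andP [_ tm].
  rewrite wE ?yE ?(ltn_trans tm) // L0 //.
  have := symbol_digits 0 tm; rewrite mul0n add0n => -> /=.
  by rewrite /colst !big_geq // !inordK.
- apply/allP => i; rewrite mem_iota SE' => /andP [mi iS].
  have [s [t [sn tm ei]]] : exists s t, [/\ s < n, t <= m & i = s.+1 * m.+1 + t].
    exists ((i - m.+1) %/ m.+1), ((i - m.+1) %% m.+1); split.
    - by rewrite ltn_divLR // -(ltn_add2l m.+1) SE' subnKC.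
    - by rewrite -ltnS ltn_pmod.
    - by rewrite mulSn -addnA -divn_eq subnKC.
  have i1 : i.-1 < S by apply: leq_ltn_trans iS; exact: leq_pred.
  have iu : i - m.+1 < S by apply: leq_ltn_trans iS; exact: leq_subr.
  rewrite wE // (yE iS) (yE iu) (yE i1) /=.
  have -> : i - m.+1 = s * m.+1 + t by rewrite ei mulSn -addnA addKn.
  move: tm; rewrite leq_eqVlt => /orP [/eqP et|tm].
    have e1 : entry_symbol m E i = None by rewrite ei et symbol_end.
    have e2 : letter i = None by rewrite ei et letter_end.
    (* Without columns there are only terminators, and the previous letter is one too. *)
    rewrite e1 e2 et letter_end /=; case: (posnP m) => m0.
      have -> : i.-1 = s * m.+1 + m by rewrite ei et mulSn m0; lia.
      by rewrite letter_end.
    have -> : i.-1 = s.+1 * m.+1 + m.-1 by rewrite ei et; lia.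
    rewrite letter_digits ?prednK //=; apply/implyP.
    have sN : \sum_(0 <= j < m) N s j < 3 by rewrite ltnS rowN.
    rewrite inordK // => /eqP /(locN sn) [t' tm' h].
    by apply/hasP; exists t'; rewrite ?mem_iota.
  by rewrite ei symbol_digits //; exact: local_digits.
- by rewrite onthb_out // size_mkseq.
- by rewrite yE ?letter_end // -SE' addnC ltn_add2r.
- apply/allP => i; rewrite mem_iota => /andP [i1 i2].
  have ei : i = n * m.+1 + (i - n * m.+1) by rewrite subnKC.
  have iS : i < S by rewrite -SE' addnC.
  rewrite yE //; have : i - n * m.+1 <= m by rewrite leq_subLR -ltnS -addnS.
  rewrite leq_eqVlt => /orP [/eqP e|tm]; first by rewrite ei e letter_end.
  rewrite ei letter_digits //= inordK ?sumN0 //; set t := i - _.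
  rewrite -/(final t); case: ifP => [/eqP -> //|h]; have := colN tm; move: h; rewrite /final.
  by case: (\sum_(0 <= s < n) N s _) => [|[|[|k]]].
Qed.

End Complete.

(** * An accepted certificate yields a graph and a matching *)

Section Sound.
Variables (w : seq symb) (y : seq cert).
Hypothesis acc : accept w y.
Let m := find (pred1 None) y.
Let L := m.+1.
Let S := size y.
Let Y i := nth None y i.
Let V i := nth None w i.

Let YE i : i < S -> onthb y i = Some (Y i).
Proof. by move=> h; rewrite (onthb_in None). Qed.

Lemma accept_facts :
  [/\ L <= S, size w = S, V m = None, Y m = None &
  [/\ forall i, i < m -> top (V i) (Y i),
      forall i, L <= i < S -> local (Y i.-1) (V i) (Y i) (Y (i - L)),
      Y S.-1 = None & forall i, S - L <= i < S -> bottom (Y i)]].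
Proof.
move: acc; rewrite /accept -/m -/L -/S.
case/and5P => /allP h1 /eqP wm /eqP ym /allP h2 /and3P [/eqP h3 /eqP h4 /allP h5].
have [mS ym'] := onthb_Some None ym; have [_ wm'] := onthb_Some None wm.
have LS : L <= S by [].
rewrite subnKC // in h2 h3 h4.
have S0 : S.-1 < S by rewrite prednK //; apply: leq_ltn_trans mS.
have wle : size w <= S.
  by rewrite leqNgt; apply/negP => /(onthb_in None) e; rewrite e in h3.
have inw i : i < S -> i < size w /\ ((i < m -> top (V i) (Y i)) /\
    (L <= i -> local (Y i.-1) (V i) (Y i) (Y (i - L)))).
  move=> iS; case: (ltngtP i m) => [im|im|->].
  - have := h1 i; rewrite mem_iota add0n im => /(_ isT); rewrite YE //.
    case e: (onthb w i) => [a|//] t; have [iw va] := onthb_Some None e.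
    by rewrite /V va; split=> //; split=> //; rewrite /L leqNgt ltnS ltnW.
  - have i1 : i.-1 < S by apply: leq_ltn_trans iS; rewrite leq_pred.
    have iL : i - L < S by apply: leq_ltn_trans iS; rewrite leq_subr.
    have := h2 i; rewrite mem_iota subnKC // im iS (YE iS) (YE i1) (YE iL) => /(_ isT).
    case e: (onthb w i) => [a|//] t; have [iw va] := onthb_Some None e.
    by rewrite /V va; split=> //; split=> // lt.
  - by have [mw _] := onthb_Some None wm.
have szw : size w = S.
  by apply/eqP; rewrite eqn_leq wle; have [h _] := inw _ S0; move: h; rewrite prednK //; apply: leq_ltn_trans mS.
split=> //; split.
- by move=> i im; have [|_ [h _]] := inw i; [apply: ltn_trans mS|exact: h].
- by move=> i /andP [Li iS]; have [_ [_ h]] := inw i iS; exact: h.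
- by move: h4; rewrite YE.
move=> i /andP [i1 i2]; have := h5 i; rewrite mem_iota i1 subnKC ?leq_subr // i2.
by move=> /(_ isT); rewrite YE.
Qed.

(** [local] puts terminators below terminators and entries below entries, so the shape of the top
    row repeats with period [L]. *)
Lemma Y_None i : i < S -> (Y i == None) = (i %% L == m).
Proof.
have [LS _ _ Ym [tp lc _ _]] := accept_facts.
have [j] := ubnP i; elim: j i => // j IH i ij iS.
case: (ltngtP i m) => [im|im|->].
- have /= := before_find None im; rewrite -/(Y i) => ->.
  by rewrite modn_small ?ltnS 1?ltnW // ltn_eqF.
- have := lc i; rewrite im iS => /(_ isT) hl.
  have -> : i %% L = (i - L) %% L by rewrite -{1}(subnK im) modnDr.
  rewrite -IH; [|lia|by apply: leq_ltn_trans iS; rewrite leq_subr].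
  move: hl; rewrite /local; case: (V i) => [e|]; case: (Y i) => [[[n' [[a b] c]] [[a' b'] c']]|];
    by case: (Y (i - L)) => [[[? ?] [[? ?] ?]]|].
- by rewrite Ym modn_small // eqxx.
Qed.

Let n := S.-1 %/ L.

(** The last letter is a terminator, so the last row is complete; one of the [n.+1] rows is the row
    of ones. *)
Lemma size_rows : S = n.+1 * L.
Proof.
have [LS _ _ Ym [_ _ last _]] := accept_facts.
have S0 : 0 < S by apply: leq_trans LS.
have S1 : S.-1 < S by rewrite prednK.
have := Y_None S1; rewrite last eqxx => /esym/eqP e.
by rewrite -(prednK S0) {1}(divn_eq S.-1 L) e mulSn /n /L addnC addSn addnC.
Qed.

Let E s t := V (s.+1 * L + t) == Some true.
Let N s t := if Y (s.+1 * L + t) is Some (b, _, _) then b else false.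
Let final t := if Y t is Some (_, _, (_, _, f)) then f else false.
Let rowst s t : counts := if Y (s.+1 * L + t).-1 is Some (_, r, _) then r else zero_counts.

Lemma index_lt_S r t : r <= n -> t <= m -> r * L + t < S.
Proof. by move=> rn tm; rewrite size_rows digits_lt. Qed.

Lemma Y_Some r t : r <= n -> t < m -> Y (r * L + t) != None.
Proof.
move=> rn tm; rewrite Y_None; last exact: index_lt_S (ltnW tm).
by rewrite modnMDl modn_small ?ltnS 1?ltnW // ltn_eqF.
Qed.

Lemma Y_end r : r <= n -> Y (r * L + m) = None.
Proof.
move=> rn; apply/eqP; rewrite Y_None; last exact: index_lt_S.
by rewrite modnMDl modn_small.
Qed.

Lemma local_entry s t : s < n -> t < m ->
  exists re rm rh ce cm cf b0 r0 ce0 cm0,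
  let: (re0, rm0, rh0) := rowst s t in
  [/\ V (s.+1 * L + t) = Some (E s t),
      Y (s.+1 * L + t) = Some (N s t, (re, rm, rh), (ce, cm, cf)),
      Y (s * L + t) = Some (b0, r0, (ce0, cm0, cf)) &
  [/\ N s t ==> E s t, re = re0 + E s t :> nat, rm = rm0 + N s t :> nat,
      rh = rh0 || (N s t && cf) & ce = ce0 + E s t :> nat /\ cm = cm0 + N s t :> nat]].
Proof.
move=> sn tm; have [_ _ _ _ [_ lc _ _]] := accept_facts.
have := lc (s.+1 * L + t); have -> : s.+1 * L + t - L = s * L + t by rewrite mulSn -addnA addKn.
have c : L <= s.+1 * L + t < S by rewrite (index_lt_S sn (ltnW tm)) andbT mulSn -addnA leq_addr.
move/(_ c).
have y1 := Y_Some sn tm; have y0 := Y_Some (ltnW sn) tm.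
rewrite /N /E /rowst /local; case: (V _) => [e|]; last by case: (Y (s.+1 * L + t)) y1 => [[[? [[? ?] ?]] [[? ?] ?]]|].
case: (Y (s.+1 * L + t)) y1 => [[[b [[re rm] rh]] [[ce cm] cf]]|] // _.
case: (Y (s * L + t)) y0 => [[[b0 r0] [[ce0 cm0] cf0]]|] // _.
have -> : (Some e == Some true) = e by case: e.
case: (if Y _.-1 is Some _ then _ else _) => [[re0 rm0] rh0].
case/and5P => h1 /eqP h2 /eqP h3 /eqP h4 /and3P [/eqP h5 /eqP h6 /eqP h7]; subst cf0.
by exists re, rm, rh, ce, cm, cf, b0, r0, ce0, cm0.
Qed.

(** Counts start at 0 in the top row and grow entry by entry, while the flag is copied down
    unchanged; this is why [final t] may be read in the top row. *)
Lemma colst_sum r t : r <= n -> t < m ->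
  exists b q ce cm, [/\ Y (r * L + t) = Some (b, q, (ce, cm, final t)),
    ce = \sum_(0 <= s < r) E s t :> nat & cm = \sum_(0 <= s < r) N s t :> nat].
Proof.
move=> rn tm; have [_ _ _ _ [tp _ _ _]] := accept_facts.
elim: r rn => [|r IH] rn.
  have := tp t tm; rewrite mul0n add0n !big_geq // /final.
  case: (Y t) => [[[b q] [[ce cm] cf]]|] //= /and3P [_ /eqP h1 /eqP h2].
  by exists b, q, ce, cm.
have [b [q [ce [cm [e h1 h2]]]]] := IH (ltnW rn).
have [re [rm [rh [ce' [cm' [cf [b0 [r0 [ce0 [cm0]]]]]]]]]] := local_entry rn tm.
case: (rowst r t) => [[re0 rm0] rh0] [_ -> + [_ _ _ _ [h3 h4]]].
rewrite e => -[_ _ ec em ef]; subst.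
exists (N r t), (re, rm, rh), ce', cm'; rewrite !big_nat_recr //=.
by rewrite h3 h4 h1 h2.
Qed.

Lemma rowst_sum s t : s < n -> t <= m ->
  [/\ (rowst s t).1.1 = \sum_(0 <= j < t) E s j :> nat,
      (rowst s t).1.2 = \sum_(0 <= j < t) N s j :> nat &
      (rowst s t).2 -> exists2 j, j < t & N s j && final j].
Proof.
move=> sn; elim: t => [|t IH] tm.
  rewrite /rowst; have -> : (s.+1 * L + 0).-1 = s * L + m by rewrite mulSn /L; lia.
  by rewrite Y_end 1?ltnW // !big_geq.
have [re [rm [rh [ce [cm [cf [b0 [r0 [ce0 [cm0]]]]]]]]]] := local_entry sn tm.
have [b [q [ce1 [cm1 [e _ _]]]]] := colst_sum (ltnW sn) tm.
have [] := IH (ltnW tm).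
case: (rowst s t) => [[re0 rm0] rh0] /= h1 h2 h3 [_ e1 e0 [_ h4 h5 h6 _]].
have ef : cf = final t by move: e0; rewrite e => -[].
have -> : rowst s t.+1 = (re, rm, rh) by rewrite /rowst addnS /= e1.
rewrite !big_nat_recr //= h4 h5 h1 h2; split=> //.
rewrite h6 ef => /orP [/h3 [j jt hj]|h]; first by exists j => //; exact: ltnW.
by exists t.
Qed.

Lemma accept_sound : exists G, [/\ w = encode_bigraph G, max_degree (edges G) <= 4 &
  has_Vfree_2matching_covering_T G].
Proof.
have [LS sw Vm Ym [tp lc _ bt]] := accept_facts.
have symbols r t : r <= n -> t <= m ->
    V (r * L + t) = if t == m then None else Some (if r is s.+1 then E s t else true).
  move=> rn; rewrite leq_eqVlt => /orP [/eqP ->|tm].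
    rewrite eqxx; case: r rn => [|s] sn; first by rewrite mul0n.
    have c : L <= s.+1 * L + m < S by rewrite (index_lt_S sn (leqnn _)) andbT mulSn -addnA leq_addr.
    by have := lc _ c; rewrite (Y_end sn) /local; case: (V _).
  rewrite ltn_eqF //; case: r rn => [|s] sn.
    rewrite mul0n add0n; have := tp t tm; rewrite /top.
    by case: (Y t) => [[[b q] [[ce cm] cf]]|] //= /and3P [/eqP].
  have [re [rm [rh [ce [cm [cf [b0 [r0 [ce0 [cm0]]]]]]]]]] := local_entry sn tm.
  by case: (rowst s t) => [[? ?] ?] [].
pose G := @BiGraph n m [set e | E (val e.1) (val e.2)].
(* The counter equals the true sum and has type ['I_3]. *)
have rowNE s : s < n -> \sum_(0 <= t < m) N s t <= 2.
  by move=> sn; have [_ <- _] := rowst_sum sn (leqnn m); rewrite -ltnS.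
have colNE t : t < m -> \sum_(0 <= s < n) N s t = if final t then 2 else 1.
  move=> tm; have [b [q [ce [cm [e _ <-]]]]] := colst_sum (leqnn n) tm.
  have := bt (n * L + t); rewrite size_rows mulSn addKn leq_addr -mulSn.
  by rewrite digits_lt // 1?ltnW // e => /(_ isT) /eqP.
exists G; split.
- rewrite encode_mkseq; apply: (@eq_from_nth _ None); first by rewrite size_mkseq sw size_rows.
  move=> i; rewrite sw size_rows => iS.
  rewrite nth_mkseq // -/(V i).
  have iE := divn_eq i L; have im : i %% L <= m by rewrite -ltnS ltn_pmod.
  have rn : i %/ L <= n by rewrite -ltnS ltn_divLR.
  rewrite iE symbols // /entry_symbol -/L modnMDl modn_mod divnMDl // (divn_small (ltn_pmod _ _)) // addn0.
  case: eqP => // /eqP nm; congr Some; case: (i %/ L) rn => // s sn.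
  have tm : i %% L < m by rewrite ltn_neqAle nm.
  by rewrite -[s]/(val (Ordinal sn)) -[i %% L]/(val (Ordinal tm)) at_natE inE.
- apply/bigmax_leqP => -[s|t] _; rewrite ?degree_inl ?degree_inr.
    rewrite (_ : [set t | _] = [set t : 'I_m | E s t]); last by apply/setP => t; rewrite !inE.
    by rewrite card_sum; have [<- _ _] := rowst_sum (ltn_ord s) (leqnn m); rewrite -ltnS.
  rewrite (_ : [set s | _] = [set s : 'I_n | E s t]); last by apply/setP => s; rewrite !inE.
  rewrite (card_sum n (fun s => E s t)).
  have [b [q [ce [cm [_ <- _]]]]] := colst_sum (leqnn n) (ltn_ord t); by rewrite -ltnS.
apply/has_VfreeP; exists (fun (s : 'I_n) (t : 'I_m) => N s t); split.
- move=> s t h; rewrite inE /=.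
  have [re [rm [rh [ce [cm [cf [b0 [r0 [ce0 [cm0]]]]]]]]]] := local_entry (ltn_ord s) (ltn_ord t).
  by case: (rowst s t) => [[? ?] ?] [_ _ _ [/implyP hi _ _ _ _]]; exact: hi.
- by move=> s; rewrite card_sum rowNE.
- by move=> t; rewrite (card_sum n (fun s => N s t)) colNE //; case: ifP.
- move=> t; have : 0 < #|[set s : 'I_n | N s t]|.
    by rewrite (card_sum n (fun s => N s t)) colNE //; case: ifP.
  by case/card_gt0P => s; rewrite inE; exists s.
(* Two distinct matching edges exhaust the row of [s], so the column of degree 2 promised by the row
   flag is [t1] or [t2]. *)
move=> s t1 t2 nt N1 N2.
have c2 : #|[set t : 'I_m | N s t]| <= 2 by rewrite card_sum rowNE.
have s2 : [set t1; t2] \subset [set t : 'I_m | N s t].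
  by apply/subsetP => t; rewrite !inE => /orP [] /eqP ->.
have e12 : [set t1; t2] = [set t : 'I_m | N s t].
  by apply/eqP; rewrite eqEcard s2 cards2 nt.
have cE : \sum_(0 <= t < m) N s t = 2 by rewrite -card_sum -e12 cards2 nt.
have [t tf tN] : exists2 t : 'I_m, final t & N s t.
  have [_ r2 r3] := rowst_sum (ltn_ord s) (leqnn m).
  have : (rowst s m).2.
    have c : L <= s.+1 * L + m < S.
      by rewrite (index_lt_S (ltn_ord s) (leqnn _)) andbT mulSn -addnA leq_addr.
    have := lc _ c; rewrite (Y_end (ltn_ord s)).
    have -> : s.+1 * L + m - L = s * L + m by rewrite mulSn -addnA addKn.
    rewrite (Y_end (ltnW (ltn_ord s))) /local; case: (V _) => // h.
    move: r2 h; rewrite cE /rowst; case: (Y _.-1) => [[[b [[re rm] rh]] q]|] //=.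
    by move=> -> /=.
  by case/r3 => j jm /andP [hN hf]; exists (Ordinal jm).
have : [set s] \proper [set s' : 'I_n | N s' t].
  rewrite properEcard sub1set inE tN cards1 (card_sum n (fun s => N s t)) colNE //.
  by rewrite tf.
case/properP => _ [s']; rewrite !inE => h ns; exists s' => //.
have : t \in [set t1; t2] by rewrite e12 inE.
by rewrite !inE => /orP [] /eqP <-; rewrite h ?orbT.
Qed.

End Sound.

Lemma in_NP_Vfree :
  in_NP (problem_language encode_bigraph
    (fun G : bigraph => max_degree (edges G) <= 4)
    has_Vfree_2matching_covering_T).
Proof.
exists cert, (fun w y => accept w y), 1, 1; split; first exact: accept_in_P.
move=> w; split=> [[G [-> deg]]|[y [_ /accept_sound [G [-> h1 h2]]]]]; last by exists G.
move/has_VfreeP => [N [sub dS dT cov loc]].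
pose E := at_nat (fun s t => (s, t) \in edges G).
pose N' := at_nat N.
have rowF (F : 'I_(nS G) -> 'I_(nT G) -> bool) s (sn : s < nS G) :
    \sum_(0 <= t < nT G) at_nat F s t = #|[set t | F (Ordinal sn) t]|.
  rewrite -card_sum; congr #|pred_of_set _|; apply/setP => t; rewrite !inE.
  by rewrite -[s]/(val (Ordinal sn)) at_natE.
have colF (F : 'I_(nS G) -> 'I_(nT G) -> bool) t (tm : t < nT G) :
    \sum_(0 <= s < nS G) at_nat F s t = #|[set s | F s (Ordinal tm)]|.
  rewrite -(card_sum _ (fun s => at_nat F s t)); congr #|pred_of_set _|; apply/setP => s; rewrite !inE.
  by rewrite -[t]/(val (Ordinal tm)) at_natE.
have degE x : degree (edges G) x <= 4 by apply: leq_trans deg; exact: leq_bigmax.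
eexists; split; last first.
  rewrite encode_mkseq; apply: (@accept_complete _ _ E N').
  - move=> s t; rewrite /N' /E /at_nat; case: insubP => // s' _ _; case: insubP => // t' _ _.
    exact: sub.
  - by move=> s sn; rewrite rowF -degree_inl.
  - by move=> t tm; rewrite colF -degree_inr.
  - by move=> s sn; rewrite rowF.
  - move=> t tm; rewrite colF dT andbT; apply/card_gt0P.
    by have [s h] := cov (Ordinal tm); exists s; rewrite inE.
  (* The S-node [s'] given by V-freeness meets [t1] or [t2], which thereby has matching degree 2. *)
  move=> s sn; rewrite rowF => /eqP/cards2P [t1 [t2 [nt e]]].
  have N1 : N (Ordinal sn) t1 by move/setP: e => /(_ t1); rewrite !inE eqxx.
  have N2 : N (Ordinal sn) t2 by move/setP: e => /(_ t2); rewrite !inE eqxx orbT.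
  have [s' ns h] := loc _ _ _ nt N1 N2.
  have two (t : 'I_(nT G)) : N (Ordinal sn) t -> N s' t -> exists2 t, t < nT G &
      N' s t && (\sum_(0 <= s'' < nS G) N' s'' t == 2).
    move=> h1 h2; exists t => //; rewrite {1}/N' -[s]/(val (Ordinal sn)) at_natE h1 /=.
    rewrite colF eqn_leq dT /=; have <- : #|[set s'; Ordinal sn]| = 2 by rewrite cards2 ns.
    apply/subset_leq_card/subsetP => x; rewrite !inE.
    have -> : Ordinal (ltn_ord t) = t by apply: val_inj.
    by case/orP => /eqP ->.
  by case/orP: h; [exact: two|exact: two].
by rewrite size_mkseq size_encode_bigraph /poly_bound expn1 mul1n mulnC addn1.
Qed.

Theorem theorem11 :
  NP_complete
    (problem_language encode_bigraph
       (fun G : bigraph => max_degree (edges G) <= 4)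
       has_Vfree_2matching_covering_T).
Proof. exact: (conj in_NP_Vfree NP_hard_Vfree). Qed.
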